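(* Let $X$ be a real or complex $C^*$-algebra. Then the following are equivalent: (i) $X$ has the Daugavet property. (ii) The norm of $X$ is extremely rough. (iii) The norm of $X$ is not Fréchet-smooth at any point of $S_X$.
   Context: For a Banach space $X$, $B_X$ and $S_X$ denote the closed unit ball and the unit sphere. $X$ has the Daugavet property if every rank-one bounded linear operator $T:X\to X$ satisfies $\|Id+T\|=1+\|T\|$. The norm of $X$ is Fréchet-smooth (Fréchet differentiable) at $u\in S_X$ if $\lim_{\alpha\to 0}\frac{\|u+\alpha x\|-1}{\alpha}$ exists uniformly for $x\in B_X$. The roughness of $X$ at $u\in S_X$ is $\eta(X,u)=\limsup_{\|h\|\to 0}\frac{\|u+h\|+\|u-h\|-2}{\|h\|}$. For $\delta>0$, $X$ (or its norm) is $\delta$-rough if $\eta(X,u)\ge\delta$ for every $u\in S_X$; it is extremely rough if it is $2$-rough. A real $C^*$-algebra is a norm-closed self-adjoint real subalgebra of a complex $C^*$-algebra. $C^*$-algebras are not assumed to be unital. *)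

(* Defs.v *)
From HB Require Import structures.
From mathcomp Require Import all_boot all_order all_algebra.
From mathcomp Require Import all_classical all_reals all_analysis.
From mathcomp Require Import complex.

Set Implicit Arguments.
Unset Strict Implicit.
Unset Printing Implicit Defensive.

Import Order.TTheory GRing.Theory Num.Theory.
Import numFieldNormedType.Exports.

Local Open Scope classical_set_scope.
Local Open Scope ring_scope.

Definition unit_ball (K : numFieldType) (X : normedModType K) : set X :=
  [set x | `|x| <= 1].

Definition unit_sphere (K : numFieldType) (X : normedModType K) : set X :=
  [set u | `|u| = 1].

(* Over K = R[i] the values of the norm are nonnegative elements of R[i], that
   is, nonnegative reals.  The supremum is the least upper bound for the order
   of K; it exists for every bounded linear operator when K is R or R[i]. *)
Definition opnorm (K : numFieldType) (X : normedModType K) (T : X -> X) : K :=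
  supremum 0 [set `|T x| | x in @unit_ball K X].

Definition rank_one (K : numFieldType) (X : normedModType K)
    (T : {linear X -> X}) : Prop :=
  exists2 y : X, y != 0 & range T = [set a *: y | a in [set: K]].

(* The scalars of the operators are those of X: K-linear operators. *)
Definition daugavet (K : numFieldType) (X : normedModType K) : Prop :=
  forall T : {linear X -> X}, bounded_near T (nbhs (0 : X)) -> rank_one T ->
    opnorm (fun x => x + T x) = 1 + opnorm T.

(* The increment a is a real number; a complex space enters through its
   underlying real normed space [realification], defined below. *)
Definition frechet_smooth (R : realType) (X : normedModType R) (u : X) : Prop :=
  exists l : X -> R,
    {uniform @unit_ball R X,
      (fun (a : R) (x : X) => (`|u + a *: x| - 1) / a) @ (0 : R)^' --> l}.

Definition roughness (R : realType) (X : normedModType R) (u : X) : \bar R :=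
  limf_esup (fun h : X => ((`|u + h| + `|u - h| - 2) / `|h|)%:E) (0 : X)^'.

Definition rough (R : realType) (d : R) (X : normedModType R) : Prop :=
  forall u : X, unit_sphere u -> (d%:E <= roughness u)%E.

Definition extremely_rough (R : realType) (X : normedModType R) : Prop :=
  rough 2 X.

Definition nowhere_frechet_smooth (R : realType) (X : normedModType R) : Prop :=
  forall u : X, unit_sphere u -> ~ frechet_smooth u.

(* A complex normed space regarded as a real one. *)
Definition realification (R : realType) (V : normedModType R[i]) : Type := V.

Section Realification.
Variables (R : realType) (V : normedModType R[i]).
Local Notation VR := (realification V).

HB.instance Definition _ := GRing.Zmodule.on VR.

Let rscale (a : R) (x : VR) : VR := (a%:C)%C *: (x : V).

Let rscaleA a b x : rscale a (rscale b x) = rscale (a * b) x.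
Proof. by rewrite /rscale scalerA rmorphM. Qed.

Let rscale1 : left_id 1 rscale.
Proof. by move=> x; rewrite /rscale rmorph1 scale1r. Qed.

Let rscaleDr : right_distributive rscale +%R.
Proof. by move=> a x y; rewrite /rscale scalerDr. Qed.

Let rscaleDl x : {morph rscale^~ x : a b / a + b}.
Proof. by move=> a b; rewrite /rscale rmorphD scalerDl. Qed.

HB.instance Definition _ := GRing.Zmodule_isLmodule.Build R VR
  rscaleA rscale1 rscaleDr rscaleDl.

Let rnorm (x : VR) : R := complex.Re `|x : V|.

Let rnormE x : ((rnorm x)%:C)%C = `|x : V|.
Proof. by rewrite /rnorm RRe_real// normr_real. Qed.

Let rnormD x y : rnorm (x + y) <= rnorm x + rnorm y.
Proof. by rewrite -lecR rmorphD/= !rnormE; exact: ler_normD. Qed.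

Let rnormZ (a : R) x : rnorm (a *: x) = `|a| * rnorm x.
Proof.
apply: (fmorph_inj (real_complex R)).
by rewrite rmorphM/= !rnormE normrZ normc_def/= expr0n/= addr0 sqrtr_sqr.
Qed.

Let rnorm0_eq0 x : rnorm x = 0 -> x = 0.
Proof.
move=> x0; have := rnormE x; rewrite x0 rmorph0 => /esym/eqP.
by rewrite normr_eq0 => /eqP.
Qed.

HB.instance Definition _ := Lmodule_isNormed.Build R VR
  rnormD rnormZ rnorm0_eq0.

End Realification.

(* Complex C*-algebras, not necessarily unital: the ring structures of the
   library all have a unit, so the product is a separate operation. *)
HB.mixin Record isCstarAlgebra (R : realType) A
    & CompleteNormedModule R[i] A := {
  cmul : A -> A -> A ;
  cstar : A -> A ;
  cmulA : associative cmul ;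
  cmulDl : left_distributive cmul +%R ;
  cmulDr : right_distributive cmul +%R ;
  cmulZl : forall (a : R[i]) (x y : A), cmul (a *: x) y = a *: cmul x y ;
  cmulZr : forall (a : R[i]) (x y : A), cmul x (a *: y) = a *: cmul x y ;
  cnormM : forall x y : A, `|cmul x y| <= `|x| * `|y| ;
  cstarK : involutive cstar ;
  cstarD : {morph cstar : x y / x + y} ;
  cstarZ : forall (a : R[i]) (x : A), cstar (a *: x) = a^* *: cstar x ;
  cstarM : forall x y : A, cstar (cmul x y) = cmul (cstar y) (cstar x) ;
  cstar_norm : forall x : A, `|cmul (cstar x) x| = `|x| ^+ 2
}.

#[short(type="cstarAlgType")]
HB.structure Definition CstarAlgebra (R : realType) :=
  {A of CompleteNormedModule R[i] A & isCstarAlgebra R A}.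

Record realCstarAlg (R : realType) (A : cstarAlgType R) := RealCstarAlg {
  rcs_set :> set A ;
  rcs0 : rcs_set 0 ;
  rcsD : forall x y, rcs_set x -> rcs_set y -> rcs_set (x + y) ;
  rcsZ : forall (a : R) x, rcs_set x -> rcs_set ((a%:C)%C *: x) ;
  rcsM : forall x y, rcs_set x -> rcs_set y -> rcs_set (cmul x y) ;
  rcs_star : forall x, rcs_set x -> rcs_set (cstar x) ;
  rcs_closed : closed rcs_set
}.

(* The underlying real normed space: the subset itself, with the real-linear
   structure and the norm of A. *)
Section RealCstarSpace.
Variables (R : realType) (A : cstarAlgType R) (S : realCstarAlg A).

Definition rcs_pred : {pred realification A} := fun x => (x : A) \in rcs_set S.

Let rcs_submod : submod_closed rcs_pred.
Proof.
split=> [|a x y]; rewrite !unfold_in /=; first by rewrite inE; exact: rcs0.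
rewrite !inE => Sx Sy.
exact: (@rcsD _ _ S ((a%:C)%C *: (x : A)) y (rcsZ a Sx) Sy).
Qed.

HB.instance Definition _ :=
  GRing.isSubmodClosed.Build R (realification A) rcs_pred rcs_submod.

Definition rcs_space : Type := {x : realification A | x \in rcs_pred}.

HB.instance Definition _ := SubChoice.on rcs_space.
HB.instance Definition _ :=
  [SubChoice_isSubLmodule of rcs_space by <:].

Let snorm (x : rcs_space) : R := `|val x|.

Let snormD x y : snorm (x + y) <= snorm x + snorm y.
Proof. by rewrite /snorm raddfD/= ler_normD. Qed.

Let snormZ (a : R) x : snorm (a *: x) = `|a| * snorm x.
Proof. by rewrite /snorm linearZ/= normrZ. Qed.

Let snorm0_eq0 x : snorm x = 0 -> x = 0.
Proof.
by move/eqP; rewrite normr_eq0 => /eqP x0; apply: val_inj; rewrite x0 raddf0.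
Qed.

HB.instance Definition _ := Lmodule_isNormed.Build R rcs_space
  snormD snormZ snorm0_eq0.

End RealCstarSpace.

(* Main.v *)
From HB Require Import structures.
Require Import Defs.
From mathcomp Require Import all_boot all_order all_algebra.
From mathcomp Require Import all_classical all_reals all_analysis.
From mathcomp Require Import complex separable cyclotomic cyclic ring lra.

Set Implicit Arguments.
Unset Strict Implicit.
Unset Printing Implicit Defensive.

Import Order.TTheory GRing.Theory Num.Theory.
Import numFieldNormedType.Exports.

Import ComplexField.Normc.

Local Open Scope classical_set_scope.
Local Open Scope ring_scope.

(** Call a self-adjoint idempotent e <> 0 of the algebra minimal when e a e is
    a real multiple of e for every self-adjoint a.  Each of the three properties
    holds exactly when the algebra has no minimal projection, and this is how
    they are shown to be equivalent.  A complex algebra is compared with the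
    real algebra of all its elements, so one argument covers both cases; only
    the Daugavet property sees the scalars.

    Suppose that e is minimal.  Then e x e has a real part phi(x) e.  Cutting
    e + t x with e and 1 - e and applying the C*-identity on each side leaves a
    corner that is essentially the scalar 1 + t phi(x), and remainders of order
    t^2: the norm of e + t x is 1 + t phi(x) up to 5 t^2, uniformly on the unit
    ball ([minimal_upper], [minimal_lower]).  So the norm is Frechet-smooth and
    not rough at e.  The same expansion keeps the x of the ball with phi(x)
    close to 1 away from distance 2 to e ([far_from_smooth_point]), so that the
    rank-one operator -phi(x) e, or - e x e in the complex case, violates the
    Daugavet equation.

    Suppose that no projection is minimal.  Spectral cut-offs of a self-adjoint
    element of norm one then split forever into orthogonal pieces: if the part
    of j near the top of its spectrum did not split, every self-adjoint
    element m of norm one under that part would satisfy m^2 = m or m^2 = -m, and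
    this forces a minimal projection ([not_splits_minimal]).  Start from
    h = x^* x with x of norm one, cut off where h is close to a constant s = 1 or
    s = -1, and split there into N orthogonal pieces, with cut-offs p_n, q_n,
    r_n such that p_n q_n = q_n and q_n r_n = r_n ([plateau_family]).  Put
    c_n = (x p_n x^* )^2.  For y in the ball, the element
    (1 - c_n) y (1 - p_n) + x q_n has almost orthogonal summands, so its norm is
    almost at most 1; on r_n it agrees with x, so its sum with x has norm almost
    2; and a functional of norm one sees it as y up to two terms that are small
    for some n <= N by a Bessel inequality ([bessel]).  This is [slices], the
    geometric form of the Daugavet property ([daugavet_lower]).  Likewise
    x q_0 - x q_1 is almost at distance 2 from both x and -x ([two_sided]),
    which makes the norm extremely rough and excludes Frechet smoothness.

    Everything rests on a functional calculus for one self-adjoint h of norm at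
    most one, carried out in the unitization with its multiplier norm.  With
    u = h + i sqrt(1 - h^2), which is unitary, a polynomial p(h) of degree n is
    u^(-n) q(u), where the coefficients of q are bounded by the supremum of |p|
    on [-1, 1]; so the norm of p(h) is at most 2n + 1 times that supremum, and
    the factor disappears when the estimate is applied to the powers p^(2^m)
    ([ev_bound]). *)

(** * The real-valued norm of a C*-algebra *)

Section CstarNorm.
Variables (R : realType) (A : cstarAlgType R).
Implicit Types (x y z : A) (a : R[i]).

Definition rnorm x : R := complex.Re `|x|.

Lemma rnormE x : ((rnorm x)%:C)%C = `|x|.
Proof. by rewrite /rnorm RRe_real// normr_real. Qed.

Lemma normc_val a : `|a| = ((normc a)%:C)%C.
Proof. by case: a => a b; rewrite normc_def. Qed.

Lemma normc_real (r : R) : normc (r%:C)%C = `|r|.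
Proof. by rewrite /= expr0n/= addr0 sqrtr_sqr. Qed.

Lemma rnorm_ge0 x : 0 <= rnorm x.
Proof. by rewrite -ler0c rnormE. Qed.

Lemma rnormD x y : rnorm (x + y) <= rnorm x + rnorm y.
Proof. by rewrite -lecR rmorphD/= !rnormE; exact: ler_normD. Qed.

Lemma rnormZ a x : rnorm (a *: x) = normc a * rnorm x.
Proof.
apply: (fmorph_inj (real_complex R)).
by rewrite rmorphM/= !rnormE normrZ normc_val.
Qed.

Lemma rnormN x : rnorm (- x) = rnorm x.
Proof. by rewrite /rnorm normrN. Qed.

Lemma rnorm0 : rnorm 0 = 0.
Proof. by rewrite /rnorm normr0. Qed.

Lemma rnorm0_eq0 x : rnorm x = 0 -> x = 0.
Proof.
move=> x0; have := rnormE x; rewrite x0 rmorph0 => /esym/eqP.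
by rewrite normr_eq0 => /eqP.
Qed.

Lemma rnormM x y : rnorm (cmul x y) <= rnorm x * rnorm y.
Proof. by rewrite -lecR rmorphM/= !rnormE; exact: cnormM. Qed.

Lemma rnorm_cstar x : rnorm (cmul (cstar x) x) = rnorm x ^+ 2.
Proof.
apply: (fmorph_inj (real_complex R)).
by rewrite rmorphXn/= !rnormE cstar_norm.
Qed.

Lemma rnorm_star x : rnorm (cstar x) = rnorm x.
Proof.
suff H y : rnorm y <= rnorm (cstar y).
  by apply/eqP; rewrite eq_le H -{2}[x]cstarK H.
have [->|] := eqVneq (rnorm y) 0; first exact: rnorm_ge0.
rewrite -normr_gt0 ger0_norm ?rnorm_ge0// => y0.
rewrite -(ler_pM2r y0) -expr2 -rnorm_cstar; exact: rnormM.
Qed.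

Lemma cmul0x x : cmul 0 x = 0.
Proof. by rewrite -[X in cmul X _](scale0r (0 : A)) cmulZl scale0r. Qed.

Lemma cmulx0 x : cmul x 0 = 0.
Proof. by rewrite -[X in cmul _ X](scale0r (0 : A)) cmulZr scale0r. Qed.

End CstarNorm.

(** * The unitization as a ring *)

Definition unitization (R : realType) (A : cstarAlgType R) : Type :=
  (R[i] * A)%type.

Section UnitizationRing.
Variables (R : realType) (A : cstarAlgType R).
Local Notation U := (unitization A).

HB.instance Definition _ := GRing.Lmodule.on U.

Definition umul (u v : U) : U :=
  (u.1 * v.1, u.1 *: v.2 + v.1 *: u.2 + cmul u.2 v.2).

Fact umulA : associative umul.
Proof.
move=> u v w; congr pair => /=; first by rewrite mulrA.
rewrite !scalerDr !scalerA !cmulDr !cmulDl !cmulZl !cmulZr !cmulA.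
rewrite [w.1 * u.1]mulrC [w.1 * v.1]mulrC -!addrA; congr (_ + _).
congr (_ + _); rewrite [LHS]addrCA; congr (_ + _); rewrite [RHS]addrCA.
by congr (_ + _); rewrite [RHS]addrCA.
Qed.

Fact umul1u : left_id ((1, 0) : U) umul.
Proof.
move=> [a x]; congr pair => /=; first by rewrite mul1r.
by rewrite scale1r scaler0 cmul0x !addr0.
Qed.

Fact umulu1 : right_id ((1, 0) : U) umul.
Proof.
move=> [a x]; congr pair => /=; first by rewrite mulr1.
by rewrite scale1r scaler0 cmulx0 addr0 add0r.
Qed.

Fact umulDl : left_distributive umul +%R.
Proof.
move=> u v w; congr pair => /=; first by rewrite mulrDl.
by rewrite scalerDr scalerDl cmulDl [RHS]addrACA; congr (_ + _); rewrite addrACA.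
Qed.

Fact umulDr : right_distributive umul +%R.
Proof.
move=> u v w; congr pair => /=; first by rewrite mulrDr.
by rewrite scalerDr scalerDl cmulDr [RHS]addrACA; congr (_ + _); rewrite addrACA.
Qed.

Fact uoner_neq0 : ((1, 0) : U) != 0.
Proof. by apply/eqP => -[/eqP]; rewrite oner_eq0. Qed.

HB.instance Definition _ := GRing.Zmodule_isNzRing.Build U
  umulA umul1u umulu1 umulDl umulDr uoner_neq0.

Fact uscaleAl (a : R[i]) (u v : U) : a *: (u * v) = a *: u * v.
Proof.
congr pair => /=; first by rewrite -mulrA.
by rewrite !scalerDr !scalerA cmulZl [v.1 * _]mulrC.
Qed.

HB.instance Definition _ := GRing.Lmodule_isLalgebra.Build R[i] U uscaleAl.

Fact uscaleAr (a : R[i]) (u v : U) : a *: (u * v) = u * (a *: v).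
Proof.
congr pair => /=; first by rewrite mulrCA.
by rewrite !scalerDr !scalerA cmulZr [u.1 * _]mulrC.
Qed.

HB.instance Definition _ := GRing.Lalgebra_isAlgebra.Build R[i] U uscaleAr.

End UnitizationRing.

(** * Involution and multiplier norm of the unitization *)

Section UnitizationNorm.
Variables (R : realType) (A : cstarAlgType R).
Local Notation U := (unitization A).
Implicit Types (u v : U) (x y z : A) (a : R[i]) (r M : R).

Definition act u z : A := u.1 *: z + cmul u.2 z.

Definition star u : U := (u.1^*, cstar u.2).

Lemma actDl u v z : act (u + v) z = act u z + act v z.
Proof. by rewrite /act scalerDl cmulDl addrACA. Qed.

Lemma actZ u a z : act u (a *: z) = a *: act u z.
Proof. by rewrite /act scalerDr cmulZr !scalerA mulrC. Qed.

Lemma actZl u a z : act (a *: u) z = a *: act u z.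
Proof. by rewrite /act scalerDr cmulZl !scalerA. Qed.

Lemma actM u v z : act (u * v) z = act u (act v z).
Proof.
rewrite /act /= scalerDr !scalerA !cmulDl !cmulDr !cmulZl !cmulZr !cmulA.
by rewrite -!addrA.
Qed.

Lemma act0 u : act u 0 = 0.
Proof. by rewrite /act scaler0 cmulx0 addr0. Qed.

Lemma act1 z : act 1 z = z.
Proof. by rewrite /act scale1r cmul0x addr0. Qed.

(** The C*-identity of the unitization is derived from this adjunction, as for
    operators on a Hilbert module. *)
Lemma act_adj u y z : cmul (cstar (act u y)) z = cmul (cstar y) (act (star u) z).
Proof.
by rewrite /act cstarD cstarZ cstarM cmulDl cmulDr cmulZl cmulZr cmulA.
Qed.

Lemma starK : involutive star.
Proof. by move=> u; rewrite /star /= conjCK cstarK; case: u. Qed.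

Lemma starD u v : star (u + v) = star u + star v.
Proof. by rewrite /star /= rmorphD cstarD. Qed.

Lemma starZ a u : star (a *: u) = a^* *: star u.
Proof. by rewrite /star /= rmorphM cstarZ. Qed.

Lemma starM u v : star (u * v) = star v * star u.
Proof.
congr pair => /=; first by rewrite rmorphM mulrC.
by rewrite !cstarD !cstarZ cstarM [X in X + _]addrC.
Qed.

Lemma starRZ r u : star ((r%:C)%C *: u) = (r%:C)%C *: star u.
Proof. by rewrite starZ; congr (_ *: _); exact: conjc_real. Qed.

Lemma starN u : star (- u) = - star u.
Proof. by rewrite -scaleN1r starZ rmorphN1 scaleN1r. Qed.

Lemma starB u v : star (u - v) = star u - star v.
Proof. by rewrite starD starN. Qed.

Lemma star0 : star 0 = 0.
Proof. by apply: (addIr (star 0)); rewrite -starD addr0 add0r. Qed.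

Lemma star1 : star 1 = 1.
Proof. by rewrite -[LHS]mulr1 -{2}[1]starK -starM mulr1 starK. Qed.

Lemma starX u n : star (u ^+ n) = star u ^+ n.
Proof. by elim: n => [|n IH]; rewrite ?expr0 ?star1// exprS starM IH -exprSr. Qed.

(** The norm of u as a left multiplier of A.  It is only a seminorm on the
    unitization when A is already unital, because (1, -1) then acts as zero; it is
    a norm on the elements with zero scalar part, by [unorm_eq0]. *)
Definition unorm u : R :=
  sup [set rnorm (act u z) | z in [set z | rnorm z <= 1]].

Lemma act_ub u z : rnorm (act u z) <= (normc u.1 + rnorm u.2) * rnorm z.
Proof.
apply: (le_trans (rnormD _ _)); rewrite mulrDl rnormZ lerD2l; exact: rnormM.
Qed.

Lemma unorm_has_sup u :
  has_sup [set rnorm (act u z) | z in [set z | rnorm z <= 1]].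
Proof.
split; first by exists (rnorm (act u 0)), 0; rewrite //= rnorm0.
exists (normc u.1 + rnorm u.2) => _ [z /= z1 <-].
apply: (le_trans (act_ub _ _)); rewrite -[leRHS]mulr1 ler_wpM2l//.
by rewrite addr_ge0 ?rnorm_ge0// -ler0c -normc_val.
Qed.

Lemma unorm_ge0 u : 0 <= unorm u.
Proof.
apply: ub_le_sup; first by case: (unorm_has_sup u).
by exists 0; rewrite /= ?rnorm0 // act0 rnorm0.
Qed.

Lemma unorm_act u z : rnorm (act u z) <= unorm u * rnorm z.
Proof.
have [z0|z0] := eqVneq (rnorm z) 0.
  by rewrite (rnorm0_eq0 z0) act0 rnorm0 mulr0.
have {}z0 : 0 < rnorm z by rewrite lt_def z0 rnorm_ge0.
rewrite -ler_pdivrMr//; apply: ub_le_sup; first by case: (unorm_has_sup u).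
have nz : normc ((rnorm z)^-1%:C)%C = (rnorm z)^-1.
  by rewrite /= expr0n/= addr0 sqrtr_sqr ger0_norm// invr_ge0 ltW.
exists (((rnorm z)^-1%:C)%C *: z) => /=.
  by rewrite rnormZ nz mulVf// gt_eqF.
by rewrite actZ rnormZ nz mulrC.
Qed.

Lemma unorm_le u M : 0 <= M -> (forall z, rnorm (act u z) <= M * rnorm z) ->
  unorm u <= M.
Proof.
move=> M0 H; apply: ge_sup; first by case: (unorm_has_sup u).
move=> _ [z /= z1 <-]; apply: (le_trans (H z)).
by rewrite -[leRHS]mulr1 ler_wpM2l.
Qed.

Lemma unormD u v : unorm (u + v) <= unorm u + unorm v.
Proof.
apply: unorm_le => [|z]; first by rewrite addr_ge0 ?unorm_ge0.
by rewrite actDl (le_trans (rnormD _ _))// mulrDl lerD ?unorm_act.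
Qed.

Lemma unormM u v : unorm (u * v) <= unorm u * unorm v.
Proof.
apply: unorm_le => [|z]; first by rewrite mulr_ge0 ?unorm_ge0.
rewrite actM (le_trans (unorm_act _ _))// -mulrA ler_wpM2l ?unorm_ge0//.
exact: unorm_act.
Qed.

Lemma unormZ_le a u : unorm (a *: u) <= normc a * unorm u.
Proof.
have a0 : 0 <= normc a by rewrite -ler0c -normc_val.
apply: unorm_le => [|z]; first by rewrite mulr_ge0 ?unorm_ge0.
by rewrite actZl rnormZ -mulrA ler_wpM2l// unorm_act.
Qed.

Lemma unormZ a u : unorm (a *: u) = normc a * unorm u.
Proof.
apply/eqP; rewrite eq_le unormZ_le /=.
have [->|a0] := eqVneq a 0.
  by rewrite /= expr0n/= addr0 sqrtr0 mul0r unorm_ge0.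
have na : 0 < normc a.
  by rewrite -ltcR -normc_val normr_gt0.
rewrite -ler_pdivlMl// -normcV; apply: (le_trans _ (unormZ_le _ _)).
by rewrite scalerA mulVf// scale1r.
Qed.

Lemma unormRZ r u : unorm ((r%:C)%C *: u) = `|r| * unorm u.
Proof. by rewrite unormZ /= expr0n/= addr0 sqrtr_sqr. Qed.

Lemma unormN u : unorm (- u) = unorm u.
Proof.
by rewrite -scaleN1r unormZ /= oppr0 expr0n addr0 sqrtr_sqr normrN1 mul1r.
Qed.

Lemma unormB u v : unorm (u - v) <= unorm u + unorm v.
Proof. by rewrite (le_trans (unormD _ _))// unormN. Qed.

Lemma unorm0 : unorm 0 = 0.
Proof.
by rewrite -[0](scale0r (0 : U)) unormZ /= expr0n/= addr0 sqrtr0 mul0r.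
Qed.

Lemma unorm1 : unorm 1 <= 1.
Proof. by apply: unorm_le => // z; rewrite act1 mul1r. Qed.

Lemma unormX u n : unorm (u ^+ n) <= unorm u ^+ n.
Proof.
elim: n => [|n IH]; first by rewrite !expr0 unorm1.
rewrite !exprS (le_trans (unormM _ _))// ler_wpM2l ?unorm_ge0//.
Qed.

Lemma unorm_cstar_le u : unorm u ^+ 2 <= unorm (star u * u).
Proof.
rewrite -[leRHS]sqr_sqrtr ?unorm_ge0// ler_sqr ?nnegrE ?unorm_ge0 ?sqrtr_ge0//.
apply: unorm_le => [|z]; first by rewrite sqrtr_ge0.
rewrite -[leLHS]ger0_norm ?rnorm_ge0// -sqrtr_sqr.
rewrite -[X in _ * X]ger0_norm ?rnorm_ge0// -sqrtr_sqr -sqrtrM ?unorm_ge0//.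
rewrite ler_wsqrtr// -rnorm_cstar act_adj -actM.
rewrite (le_trans (rnormM _ _))// rnorm_star expr2 mulrCA ler_wpM2l ?rnorm_ge0//.
exact: unorm_act.
Qed.

Lemma unorm_star u : unorm (star u) = unorm u.
Proof.
suff H v : unorm v <= unorm (star v).
  by apply/eqP; rewrite eq_le H -{2}[u]starK H.
have [->|v0] := eqVneq (unorm v) 0; first exact: unorm_ge0.
have {}v0 : 0 < unorm v by rewrite lt_def v0 unorm_ge0.
rewrite -(ler_pM2r v0) -expr2 (le_trans (unorm_cstar_le _))//; exact: unormM.
Qed.

Lemma unorm_cstar u : unorm (star u * u) = unorm u ^+ 2.
Proof.
apply/eqP; rewrite eq_le unorm_cstar_le andbT.
by rewrite (le_trans (unormM _ _))// unorm_star.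
Qed.

Lemma unorm_cstarr u : unorm (u * star u) = unorm u ^+ 2.
Proof. by rewrite -{1}[u]starK unorm_cstar unorm_star. Qed.

Lemma unorm_sa u : star u = u -> unorm (u ^+ 2) = unorm u ^+ 2.
Proof. by move=> su; rewrite -unorm_cstar su expr2. Qed.

Definition emb x : U := (0, x).

Lemma unorm_emb x : unorm (emb x) = rnorm x.
Proof.
apply/eqP; rewrite eq_le; apply/andP; split.
  apply: unorm_le => [|z]; first exact: rnorm_ge0.
  by rewrite /act scale0r add0r rnormM.
have [->|x0] := eqVneq (rnorm x) 0; first exact: unorm_ge0.
have {}x0 : 0 < rnorm x by rewrite lt_def x0 rnorm_ge0.
rewrite -(ler_pM2r x0) -expr2 -rnorm_star -rnorm_cstar cstarK.
have := unorm_act (emb x) (cstar x).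
by rewrite /act scale0r add0r rnorm_star.
Qed.

Lemma embD x y : emb (x + y) = emb x + emb y.
Proof. by congr pair; rewrite /= addr0. Qed.

Lemma embZ a x : emb (a *: x) = a *: emb x.
Proof. by congr pair; rewrite /= scaler0. Qed.

Lemma embN x : emb (- x) = - emb x.
Proof. by congr pair; rewrite /= oppr0. Qed.

Lemma embM x y : emb (cmul x y) = emb x * emb y.
Proof. by congr pair; rewrite /= ?mul0r// !scale0r !add0r. Qed.

Lemma unorm_eq0 u : u.1 = 0 -> unorm u = 0 -> u = 0.
Proof.
case: u => a x /= -> /eqP; rewrite unorm_emb => /eqP/rnorm0_eq0 ->.
by [].
Qed.

End UnitizationNorm.

Section FirstComponent.
Variables (R : realType) (A : cstarAlgType R).
Implicit Types (u v : unitization A).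

Lemma fstD u v : (u + v).1 = u.1 + v.1. Proof. by []. Qed.
Lemma fstN u : (- u).1 = - u.1. Proof. by []. Qed.
Lemma fstB u v : (u - v).1 = u.1 - v.1. Proof. by []. Qed.
Lemma fstM u v : (u * v).1 = u.1 * v.1. Proof. by []. Qed.
Lemma fstZ a u : (a *: u).1 = a * u.1. Proof. by []. Qed.
Lemma fst_star u : (star u).1 = u.1^*. Proof. by []. Qed.
Definition fstE := (fstD, fstN, fstB, fstM, fstZ, fst_star).

End FirstComponent.

Section FirstComponentZero.
Variables (R : realType) (A : cstarAlgType R).
Implicit Types (u v : unitization A).

Lemma fst0D u v : u.1 = 0 -> v.1 = 0 -> (u + v).1 = 0.
Proof. by rewrite fstD => -> ->; rewrite addr0. Qed.

Lemma fst0B u v : u.1 = 0 -> v.1 = 0 -> (u - v).1 = 0.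
Proof. by rewrite fstB => -> ->; rewrite subr0. Qed.

Lemma fst0Ml u v : u.1 = 0 -> (u * v).1 = 0.
Proof. by rewrite fstM => ->; rewrite mul0r. Qed.

Lemma fst0Mr u v : v.1 = 0 -> (u * v).1 = 0.
Proof. by rewrite fstM => ->; rewrite mulr0. Qed.

Lemma fst0Z a u : u.1 = 0 -> (a *: u).1 = 0.
Proof. by rewrite fstZ => ->; rewrite mulr0. Qed.

Lemma fst0_star u : u.1 = 0 -> (star u).1 = 0.
Proof. by rewrite fst_star => ->; rewrite conjC0. Qed.

End FirstComponentZero.

(** * Coefficients of a polynomial bounded on the circle *)

Section RootsOfUnity.
Variable R : realType.

Lemma primitive_root_exists n : (0 < n)%N ->
  exists w : R[i], n.-primitive_root w.
Proof.
move=> n0; have [r] := closed_field_poly_normal ('X^n - 1 : {poly R[i]}).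
rewrite (monicP _) ?monicXnsubC// scale1r => er.
have r_root : all n.-unity_root r.
  by apply/allP => z; rewrite -root_prod_XsubC -er.
have r_uniq : uniq r.
  by rewrite -separable_prod_XsubC -er separable_Xn_sub_1// pnatr_eq0 -lt0n.
have r_size : (n <= size r)%N.
  by rewrite -ltnS -(size_prod_XsubC r id) -er size_XnsubC.
by have /hasP[w _ ww] := has_prim_root n0 r_root r_uniq r_size; exists w.
Qed.

(** A geometric sum, whose product with w^m - 1 is w^(mn) - 1 = 0. *)
Lemma sum_unity (n m : nat) (w : R[i]) : n.-primitive_root w ->
  \sum_(j < n) (w ^+ m) ^+ j = if (n %| m)%N then n%:R else 0.
Proof.
move=> ww; rewrite (prim_order_dvd ww); case: eqVneq => [->|w1].
  by under eq_bigr do rewrite expr1n; rewrite sumr_const card_ord.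
apply/eqP; rewrite -(mulrI_eq0 _ (@mulfI _ (w ^+ m - 1) _)) ?subr_eq0//.
by rewrite -subrX1 -exprM mulnC exprM (prim_expr_order ww) expr1n subrr.
Qed.

(** The coefficient of degree k is the mean of q(z) z^(-k) over the roots of unity
    of an order exceeding the degree of q, so it is at most the supremum of |q|. *)
Lemma coef_le_sup_circle (q : {poly R[i]}) (M : R) :
  (forall z, normc z = 1 -> normc q.[z] <= M) -> forall k, normc q`_k <= M.
Proof.
move=> qM k; have M0 : 0 <= M.
  have n1 : normc (1 : R[i]) = 1 by exact: normc1.
  by rewrite (le_trans _ (qM _ n1))// -ler0c -normc_val.
have [kq|kq] := leqP (size q) k.
  by rewrite nth_default//= expr0n/= addr0 sqrtr0.
set n := size q; have n0 : (0 < n)%N by exact: leq_ltn_trans kq.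
have [w ww] := primitive_root_exists n0.
have w1 : normc w = 1.
  have : normc w ^+ n = 1.
    apply: (fmorph_inj (real_complex R)); rewrite rmorphXn/= -normc_val.
    by rewrite -normrX (prim_expr_order ww) normr1.
  have nw0 : 0 <= normc w by rewrite -ler0c -normc_val.
  by move/eqP; rewrite pexprn_eq1// gtn_eqF// => /eqP.
have nX j : normc (w ^+ j) = 1.
  apply: (fmorph_inj (real_complex R)); rewrite /= -normc_val normrX normc_val w1.
  by rewrite expr1n.
have key : n%:R * q`_k = \sum_(j < n) q.[w ^+ j] * w ^+ (j * (n - k)).
  under eq_bigr do rewrite horner_coef mulr_suml.
  rewrite exchange_big /= (bigD1 (Ordinal kq))//=.
  rewrite [X in _ + X]big1 ?addr0 => [|i ik].
    under eq_bigr => j _.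
      rewrite -mulrA -exprM -exprD -mulnDr subnKC 1?ltnW// mulnC exprM.
      over.
    by rewrite -mulr_sumr sum_unity// dvdnn mulrC.
  under eq_bigr => j _.
    rewrite -mulrA -exprM -exprD -mulnDr mulnC exprM.
    over.
  rewrite -mulr_sumr sum_unity//; case: ifPn => [dv|]; last by rewrite mulr0.
  case/eqP: ik; apply: val_inj => /=.
  have : (i + (n - k) = n)%N.
    case/dvdnP: dv => -[|[|d]] e; last 1 first.
    - have := ltn_ord i; rewrite -/n => i1.
      have : (i + (n - k) < n + n)%N by rewrite -addSn leq_add// leq_subr.
      by rewrite e mulSn mulSn addnA -[X in (_ < X)%N]addn0 ltn_add2l ltn0.
    - by move/eqP: e; rewrite mul0n addn_eq0 subn_eq0 leqNgt kq andbF.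
    - by rewrite e mul1n.
  by move/(congr1 (addn^~ k)); rewrite -addnA subnK 1?ltnW// addnC => /addnI.
have : `|n%:R * q`_k| <= (((M *+ n)%:C)%C : R[i]).
  rewrite key (le_trans (ler_norm_sum _ _ _))// rmorphMn/=.
  rewrite -[X in _ *+ X]card_ord -sumr_const ler_sum// => j _.
  by rewrite normrM !normc_val nX mulr1 lecR qM.
rewrite normrM normr_nat normc_val rmorphMn/= -[X in _ <= X]mulr_natl.
by rewrite ler_pM2l ?ltr0n// lecR.
Qed.

End RootsOfUnity.

(** * The square root of 1 - h^2 *)

Section HalfRecursion.
Variable R : realType.
Implicit Types (r : R).

(** The iteration behind 1 - sqrt(1 - a) = y, that is y = (a + y^2) / 2, at a = 1.
    It dominates the same iteration for every a of norm at most one. *)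
Fixpoint halfseq (n : nat) : R :=
  if n is m.+1 then (1 + halfseq m ^+ 2) / 2 else 0.

Lemma halfseq_ge0 n : 0 <= halfseq n.
Proof. by case: n => //= n; rewrite divr_ge0// addr_ge0 ?sqr_ge0. Qed.

Lemma halfseq_le1 n : halfseq n <= 1.
Proof.
elim: n => //= n IH; have := halfseq_ge0 n => h0.
by have : halfseq n ^+ 2 <= 1 by [rewrite expr_le1]; lra.
Qed.

(** With d = 1 - r the recursion reads d' = d - d^2 / 2. *)
Lemma halfseq_cvg n : 1 - halfseq n <= 2 / (n%:R + 2).
Proof.
have n2 m : 0 < m%:R + 2 :> R by rewrite ltr_wpDl.
elim: n => [|n]; first by rewrite /= subr0 add0r divff.
rewrite /= -[n.+1%:R]natr1 !ler_pdivlMr//.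
have := halfseq_ge0 n; have := halfseq_le1 n; have := ler0n R n.
move: (halfseq n) (n%:R : R) => r k k0 r1 r0 H.
have -> : 1 - (1 + r ^+ 2) / 2 = (1 - r) - (1 - r) ^+ 2 / 2 by field.
set d := 1 - r in H *.
have d0 : 0 <= d by rewrite /d; lra.
have d1 : d <= 1 by rewrite /d; lra.
have : 0 <= (2 - d * (k + 2)) * (1 - d / 2) by rewrite mulr_ge0//; lra.
have := sqr_ge0 d; lra.
Qed.

Lemma halfseq_lim (e : R) : 0 < e -> exists n, 1 - halfseq n < e.
Proof.
move=> e0; exists (Num.truncn (2 / e)).
apply: (le_lt_trans (halfseq_cvg _)).
rewrite ltr_pdivrMr ?ltr_wpDl// mulrC -ltr_pdivrMr//.
have := truncnS_gt (2 / e); rewrite -natr1; lra.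
Qed.

End HalfRecursion.

Section Completeness.
Variables (R : realType) (A : cstarAlgType R).

Definition rcvg (f : nat -> A) (l : A) : Prop :=
  forall e : R, 0 < e -> exists N, forall n, (N <= n)%N -> rnorm (f n - l) < e.

Lemma rcauchy_cvg (f : nat -> A) :
  (forall e : R, 0 < e ->
     exists N, forall n, (N <= n)%N -> rnorm (f n - f N) < e) ->
  exists l, rcvg f l.
Proof.
move=> H; have ReE (e : R[i]) : 0 < e -> 0 < complex.Re e /\ e = ((complex.Re e)%:C)%C.
  move=> e0; have := RRe_real (gtr0_real e0) => ee; split => //.
  by rewrite -ltcR ee.
have : cvg (f @ \oo).
  apply/cauchy_cvgP; apply: cauchy_exP => e e0.
  have [re0 ee] := ReE _ e0; have [N HN] := H _ re0.
  exists (f N); exists N => // n /= Nn.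
  by rewrite -ball_normE /= distrC -rnormE ee ltcR; exact: HN.
move=> cf; exists (lim (f @ \oo)) => e e0.
move/cvgrPdist_lt : cf => /(_ (e%:C)%C); rewrite ltcR => /(_ e0) [N _ HN].
exists N => n Nn; have := HN n Nn.
by rewrite /= distrC -rnormE ltcR.
Qed.

End Completeness.

Section SquareRoot.
Variables (R : realType) (A : cstarAlgType R).
Local Notation U := (unitization A).
Implicit Types (u v h : U) (r : R).

Lemma unorm_small u (M : R) : u.1 = 0 -> 0 <= M ->
  (forall e : R, 0 < e -> unorm u <= M * e) -> u = 0.
Proof.
move=> u0 M0 H; apply: unorm_eq0 => //; apply/eqP; rewrite eq_le unorm_ge0 andbT.
apply/ler_addgt0Pl => e e0; rewrite addr0.
have M1 : 0 < M + 1 by rewrite ltr_wpDl.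
have := H (e / (M + 1)); rewrite divr_gt0// => /(_ isT) /le_trans; apply.
rewrite mulrCA ger_pMr// ler_pdivrMr// mul1r; lra.
Qed.

Fixpoint sqrtseq (a : U) (n : nat) : U :=
  if n is m.+1 then ((2^-1)%:C)%C *: (a + sqrtseq a m ^+ 2) else 0.

Variable h : U.
Hypotheses (h1 : h.1 = 0) (hs : star h = h) (hN : unorm h <= 1).

Local Notation y := (sqrtseq (h ^+ 2)).

Lemma sqrtseq_fst n : (y n).1 = 0.
Proof.
by elim: n => //= n IH; rewrite !expr2 /= h1 IH !mul0r addr0 scaler0.
Qed.

Lemma sqrtseq_star n : star (y n) = y n.
Proof.
by elim: n => [|n IH] /=; rewrite ?star0// starRZ starD !starX hs IH.
Qed.

(** The iterates are polynomials in h^2, so they commute with whatever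
    commutes with h; in particular with each other. *)
Lemma sqrtseq_comm n v : GRing.comm v h -> GRing.comm v (y n).
Proof.
move=> vh; elim: n => [|n IH] /=; first exact: commr0.
rewrite /GRing.comm -scalerAr -scalerAl; congr (_ *: _).
by apply: commrD; exact: commrX.
Qed.

Lemma sqrtseq_norm n : unorm (y n) <= halfseq R n.
Proof.
elim: n => [|n IH] /=; first by rewrite unorm0.
rewrite unormRZ ger0_norm ?invr_ge0// mulrC ler_pM2r ?invr_gt0//.
rewrite (le_trans (unormD _ _))// lerD//.
  by rewrite (le_trans (unormX _ _))// expr_le1// unorm_ge0.
by rewrite (le_trans (unormX _ _))// lerXn2r ?nnegrE ?unorm_ge0 ?halfseq_ge0.
Qed.

(** Twice a difference of consecutive iterates is
    (y_(n+1) + y_n)(y_(n+1) - y_n), and [halfseq] obeys the same identity. *)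
Lemma sqrtseq_step n : unorm (y n.+1 - y n) <= halfseq R n.+1 - halfseq R n.
Proof.
elim: n => [|n IH]; first by rewrite !subr0 sqrtseq_norm.
have -> : y n.+2 - y n.+1 =
    ((2^-1)%:C)%C *: ((y n.+1 + y n) * (y n.+1 - y n)).
  have c : GRing.comm (y n.+1) (y n).
    by apply: sqrtseq_comm; apply/commr_sym/sqrtseq_comm.
  have yS k : y k.+1 = ((2^-1)%:C)%C *: (h ^+ 2 + y k ^+ 2) by [].
  rewrite (yS n.+1) [X in _ - X](yS n) -scalerBr opprD addrACA subrr add0r.
  congr (_ *: _).
  by rewrite mulrBr !mulrDl c opprD addrA addrK !expr2.
rewrite unormRZ ger0_norm ?invr_ge0// mulrC ler_pdivrMr//.
have -> : (halfseq R n.+2 - halfseq R n.+1) * 2 =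
    (halfseq R n.+1 + halfseq R n) * (halfseq R n.+1 - halfseq R n).
  by move=> /=; field.
rewrite (le_trans (unormM _ _))// ler_pM ?unorm_ge0//.
by rewrite (le_trans (unormD _ _))// lerD ?sqrtseq_norm.
Qed.

Lemma sqrtseq_cauchy n m : (n <= m)%N ->
  unorm (y m - y n) <= 1 - halfseq R n.
Proof.
move=> nm; have : unorm (y m - y n) <= halfseq R m - halfseq R n.
  rewrite -(subnK nm); elim: (m - n)%N => [|k IH].
    by rewrite add0n !subrr unorm0.
  rewrite addSn -(subrKA (y (k + n)%N)) -[leRHS](subrKA (halfseq R (k + n)%N)).
  by rewrite (le_trans (unormD _ _))// lerD// sqrtseq_step.
move=> /le_trans; apply; rewrite lerD2r; exact: halfseq_le1.
Qed.

(** The element s = 1 - y, where y is the limit of the iteration for h^2, so that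
    2 y - y^2 = h^2. *)
Lemma cosine_has_sine : exists s : U,
  [/\ star s = s, GRing.comm s h & s ^+ 2 = 1 - h ^+ 2].
Proof.
pose f n := (y n).2.
have fE n : emb (f n) = y n by rewrite /emb /f -(sqrtseq_fst n); case: (y n).
have [|l fl] := @rcauchy_cvg R A f.
  move=> e /halfseq_lim [N HN]; exists N => n Nn.
  rewrite -unorm_emb embD embN !fE (le_lt_trans _ HN)//.
  exact: sqrtseq_cauchy.
have yl e : 0 < e -> exists n, unorm (emb l - y n) < e /\ unorm (emb l - y n.+1) < e.
  move=> /fl[N HN]; exists N; rewrite -!fE -!embN -!embD !unorm_emb -!(rnormN (l - _)).
  by rewrite !opprB; split; exact: HN.
have ls : star (emb l) = emb l.
  apply/eqP; rewrite -subr_eq0; apply/eqP; apply: (@unorm_small _ 2) => //.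
    by rewrite /= conjC0 subr0.
  move=> e /yl [n [Hn _]].
  have -> : star (emb l) - emb l = star (emb l - y n) - (emb l - y n).
    by rewrite starB sqrtseq_star opprB addrA subrK.
  by rewrite (le_trans (unormB _ _))// unorm_star -mulr2n mulr_natl lerMn2r ltW.
have lh : GRing.comm h (emb l).
  apply/eqP; rewrite -subr_eq0; apply/eqP; apply: (@unorm_small _ 2) => //.
    by rewrite !fstE /= h1 !mul0r subr0.
  move=> e /yl [n [Hn _]].
  have -> : h * emb l - emb l * h = h * (emb l - y n) - (emb l - y n) * h.
    rewrite mulrBr mulrBl; have -> : h * y n = y n * h by exact: sqrtseq_comm.
    by rewrite opprB addrA subrK.
  have -> : 2 * e = e + e by ring.
  rewrite (le_trans (unormB _ _))// lerD//.
    by rewrite (le_trans (unormM _ _))// -[leRHS]mul1r ler_pM ?unorm_ge0// ltW.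
  by rewrite (le_trans (unormM _ _))// -[leRHS]mulr1 ler_pM ?unorm_ge0// ltW.
have lE : emb l *+ 2 - emb l ^+ 2 = h ^+ 2.
  apply/eqP; rewrite -subr_eq0; apply/eqP.
  apply: (@unorm_small _ (2 + (unorm (emb l) + 1))).
  - by rewrite mulr2n !expr2 !fstE /= h1 !mul0r !addr0 !subr0.
  - by rewrite !addr_ge0// unorm_ge0.
  move=> e /yl [n [Hn Hn1]].
  have -> : emb l *+ 2 - emb l ^+ 2 - h ^+ 2 = (emb l - y n.+1) *+ 2
     - (emb l * (emb l - y n) + (emb l - y n) * y n).
    have : h ^+ 2 = y n.+1 *+ 2 - y n ^+ 2.
      rewrite [y n.+1]/(((2^-1)%:C)%C *: (h ^+ 2 + y n ^+ 2)).
      rewrite -scaler_nat scalerA -[2%:R in X in X *: _](rmorph_nat (real_complex R)).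
      by rewrite -rmorphM/= mulfV// scale1r addrK.
    move: (y n.+1) (y n) => p q ->.
    rewrite mulrBr mulrBl addrA subrK mulrnBl -!expr2 !opprB !addrA.
    by rewrite [RHS]addrAC [X in _ = X + _]addrAC [RHS]addrAC.
  rewrite (le_trans (unormB _ _))// [leRHS]mulrDl lerD//.
    have -> : 2 * e = e + e by ring.
    by rewrite mulr2n (le_trans (unormD _ _))// lerD ?ltW.
  rewrite (le_trans (unormD _ _))// [leRHS]mulrDl lerD//.
    by rewrite (le_trans (unormM _ _))// ler_wpM2l ?unorm_ge0// ltW.
  rewrite (le_trans (unormM _ _))// mul1r -[leRHS]mulr1 ler_pM ?unorm_ge0 ?(ltW Hn)//.
  exact: le_trans (sqrtseq_norm n) (halfseq_le1 _ n).
exists (1 - emb l); split.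
- by rewrite starB star1 ls.
- by apply: commr_sym; apply: commrB => //; exact: commr1.
- by rewrite -lE -sqrrN opprB sqrrB1 opprB addrC.
Qed.

End SquareRoot.

(** * Polynomials of a self-adjoint element *)

Section PolynomialCalculus.
Variables (R : realType) (A : cstarAlgType R).
Local Notation U := (unitization A).
Implicit Types (u v h : U) (p q : {poly R}).

Definition ev h p : U := horner_alg h (map_poly (real_complex R) p).

Lemma evD h p q : ev h (p + q) = ev h p + ev h q.
Proof. by rewrite /ev !rmorphD. Qed.

Lemma evB h p q : ev h (p - q) = ev h p - ev h q.
Proof. by rewrite /ev !rmorphB. Qed.

Lemma evM h p q : ev h (p * q) = ev h p * ev h q.
Proof. by rewrite /ev !rmorphM. Qed.

Lemma ev1 h : ev h 1 = 1.
Proof. by rewrite /ev !rmorph1. Qed.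

Lemma evXn h p n : ev h (p ^+ n) = ev h p ^+ n.
Proof. by rewrite /ev !rmorphXn. Qed.

Lemma evC h (c : R) : ev h c%:P = (c%:C)%C *: 1.
Proof. by rewrite /ev map_polyC /= horner_algC. Qed.

Lemma evX h : ev h 'X = h.
Proof. by rewrite /ev map_polyX horner_algX. Qed.

Lemma evZ h (c : R) p : ev h (c *: p) = (c%:C)%C *: ev h p.
Proof. by rewrite -mul_polyC evM evC -scalerAl mul1r. Qed.

Lemma ev_sum h p n : (size p <= n)%N ->
  ev h p = \sum_(i < n) ((p`_i)%:C)%C *: h ^+ i.
Proof.
move=> pn; have e : p = \poly_(i < n) p`_i.
  apply/polyP => i; rewrite coef_poly; case: ltnP => // ni.
  by rewrite nth_default// (leq_trans pn).
have ev0 : ev h 0 = 0 by rewrite -polyC0 evC scale0r.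
rewrite [in LHS]e poly_def (big_morph (ev h) (evD h) ev0).
by apply: eq_bigr => i _; rewrite evZ evXn evX.
Qed.

Lemma ev_star h p : star h = h -> star (ev h p) = ev h p.
Proof.
move=> hs; elim/poly_ind: p => [|p c IH].
  by rewrite -polyC0 evC scale0r star0.
rewrite evD evM evC evX starD starM starRZ star1 IH hs; congr (_ + _).
by rewrite -{1 4}(evX h) -!evM mulrC.
Qed.

Lemma unorm_sa_pow2 u m : star u = u -> unorm (u ^+ (2 ^ m)) = unorm u ^+ (2 ^ m).
Proof.
move=> us; elim: m => [|m IH]; first by rewrite expn0 !expr1.
by rewrite expnSr exprM unorm_sa ?starX ?us// IH -exprM.
Qed.

(** For unitary u = h + i s and v = h - i s one has 2 h u = u^2 + 1, so u^n p(h) is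
    a polynomial q in u of degree at most 2n.  On the unit circle |q(z)| equals
    |p(Re z)|, which bounds the coefficients of q. *)
Lemma ev_rough h p n (M : R) : h.1 = 0 -> star h = h -> unorm h <= 1 ->
  (size p <= n.+1)%N -> (forall t, -1 <= t <= 1 -> `|p.[t]| <= M) ->
  unorm (ev h p) <= M *+ n.*2.+1.
Proof.
move=> h1 hs hN pn pM; have [s [ss sh se]] := cosine_has_sine h1 hs hN.
pose u := h + 'i%C *: s; pose v := h - 'i%C *: s.
have uv : star u = v.
  by rewrite /u /v starD starZ hs ss -scaleNr; congr (_ + _ *: _); simpc.
have shc : s * h = h * s by [].
have i2 : 'i%C * 'i%C = -1 :> R[i] by rewrite -expr2 sqr_i.
have uv1 : u * v = 1.
  rewrite /u /v mulrDl !mulrBr -!scalerAr -!scalerAl scalerA i2 scaleN1r shc.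
  by rewrite opprK addrA subrK -!expr2 se addrC subrK.
have vu1 : v * u = 1.
  rewrite /u /v mulrBl !mulrDr -!scalerAr -!scalerAl scalerA i2 scaleN1r shc.
  by rewrite opprD opprK addrA addrK -!expr2 se addrC subrK.
have uN : unorm u <= 1.
  rewrite -(@ler_pXn2r _ 2) ?nnegrE ?unorm_ge0// expr1n -unorm_cstar uv vu1.
  exact: unorm1.
have vN : unorm v <= 1 by rewrite -uv unorm_star.
pose q : {poly R[i]} := \sum_(i < n.+1)
  ((p`_i / 2 ^+ i)%:C)%C *: (('X ^+ 2 + 1) ^+ i * 'X ^+ (n - i)).
have qS : (size q <= n.*2.+1)%N.
  apply: (leq_trans (size_sum _ _ _)); apply/bigmax_leqP => i _.
  apply: (leq_trans (size_scale_leq _ _)).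
  apply: (leq_trans (size_polyMleq _ _)); rewrite size_polyXn.
  rewrite addnS /= (leq_trans (leq_add (size_poly_exp_leq _ _) (leqnn _)))//.
  rewrite -polyC1 size_XnaddC//= addSn ltnS mul2n -!addnn.
  by rewrite -addnA subnKC ?leq_ord// leq_add2r leq_ord.
have qz z : normc z = 1 -> normc q.[z] <= M.
  move=> z1; have zz : z * z^*%C = 1.
    by rewrite -sqr_normc normc_val z1 expr1n.
  have e2 : z ^+ 2 + 1 = z * (2 * ((complex.Re z)%:C)%C).
    by rewrite -addcJ mulrDr zz expr2.
  have -> : q.[z] = z ^+ n * ((p.[complex.Re z])%:C)%C.
    rewrite (horner_coef_wide _ pn) rmorph_sum/= mulr_sumr horner_sum.
    apply: eq_bigr => i _; rewrite !hornerE e2 exprMn_comm; last exact: mulrC.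
    rewrite exprMn_comm; last exact: mulrC.
    rewrite !rmorphM/= fmorphV/= !rmorphXn/= rmorph_nat.
    have -> : z ^+ n = z ^+ i * z ^+ (n - i) by rewrite -exprD subnKC ?leq_ord.
    have : (2 : R[i]) ^+ i != 0 by rewrite expf_neq0// pnatr_eq0.
    by move: (2 ^+ i) => c c0; field.
  rewrite normcM.
  have -> : normc (z ^+ n) = 1.
    apply: (fmorph_inj (real_complex R)).
    by rewrite /= -normc_val normrX normc_val z1 expr1n.
  rewrite mul1r /= expr0n/= addr0 sqrtr_sqr pM// -ler_norml -lecR.
  by rewrite (le_trans (normc_ge_Re _))// normc_val z1.
have qu : horner_alg u q = u ^+ n * ev h p.
  rewrite (ev_sum _ pn) mulr_sumr rmorph_sum; apply: eq_bigr => i _.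
  rewrite -mul_polyC rmorphM /= horner_algC mulr_algl (rmorphM (horner_alg u)).
  rewrite !(rmorphXn (horner_alg u)) /= rmorphD.
  rewrite rmorphXn /= rmorph1 horner_algX.
  have -> : u ^+ 2 + 1 = u * (((2:R)%:C)%C *: h).
    rewrite -uv1 expr2 -mulrDr; congr (_ * _).
    by rewrite /u /v addrACA subrr addr0 rmorph_nat scaler_nat mulr2n.
  have uh : GRing.comm u h.
    apply: commr_sym; apply: commrD => //.
    by rewrite /GRing.comm -scalerAr -scalerAl shc.
  rewrite exprMn_comm; last by rewrite /GRing.comm -scalerAr -scalerAl uh.
  have c2 : ((p`_i / 2 ^+ i)%:C)%C * ((2:R)%:C)%C ^+ i = ((p`_i)%:C)%C.
    have -> : ((2:R)%:C)%C ^+ i = ((2 ^+ i)%:C)%C by rewrite [RHS]rmorphXn.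
    have n2 : (2 : R) ^+ i != 0 by rewrite expf_neq0// pnatr_eq0.
    by rewrite -(rmorphM (real_complex R)) /= mulfVK.
  rewrite exprZn -!scalerAr -!scalerAl scalerA c2.
  congr (_ *: _).
  rewrite -mulrA; have -> : h ^+ i * u ^+ (n - i) = u ^+ (n - i) * h ^+ i.
    by apply: commrX; apply: commr_sym; apply: commrX.
  by rewrite mulrA -exprD subnKC ?leq_ord.
have vun : v ^+ n * u ^+ n = 1.
  rewrite -exprMn_comm ?vu1 ?expr1n//.
  by rewrite /GRing.comm vu1 uv1.
have -> : ev h p = v ^+ n * horner_alg u q by rewrite qu mulrA vun mul1r.
rewrite (le_trans (unormM _ _))// (@le_trans _ _ (1 * unorm (horner_alg u q)))//.
  rewrite ler_wpM2r ?unorm_ge0// (le_trans (unormX _ _))//.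
  by rewrite exprn_ile1 ?unorm_ge0.
rewrite mul1r -[q]coefK poly_def rmorph_sum /=.
have M0 : 0 <= M by rewrite (le_trans _ (pM 0 _)) ?lerN10 ?ler01.
apply: (@le_trans _ _ (\sum_(i < size q) M)).
  elim/big_ind2: _ => [|x a y b xa yb|i _]; first by rewrite unorm0.
    by rewrite (le_trans (unormD _ _))// lerD.
  rewrite -mul_polyC rmorphM /= horner_algC mulr_algl rmorphXn /= horner_algX unormZ -[leRHS]mulr1.
  rewrite ler_pM ?unorm_ge0//; first by rewrite -ler0c -normc_val.
    exact: coef_le_sup_circle.
  by rewrite (le_trans (unormX _ _))// exprn_ile1 ?unorm_ge0.
by rewrite sumr_const card_ord ler_wpMn2l.
Qed.

(** Bernoulli's inequality for half of the exponent, squared. *)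
Lemma expr_beats_linear (d : R) (n : nat) : 0 < d ->
  exists m, (n * 2 ^ m)%:R + 1 < (1 + d) ^+ (2 ^ m).
Proof.
move=> d0; pose m := (Num.truncn (2 * n%:R / d ^+ 2)).+1; exists m.+1.
have d1 : 0 < d ^+ 2 by rewrite exprn_gt0.
have bern k : 1 + d *+ k <= (1 + d) ^+ k.
  elim: k => [|k IH]; first by rewrite mulr0n addr0.
  rewrite exprS; apply: (@le_trans _ _ ((1 + d) * (1 + d *+ k))).
    rewrite mulrDl mul1r mulrDr mulr1 mulrS -addrA lerD2l addrCA lerD2l.
    by rewrite lerDl mulr_ge0 ?mulrn_wge0// ltW.
  by rewrite ler_wpM2l// addr_ge0// ltW.
(* L is half of the exponent, and exceeds 2 n / d^2 *)
set L := (2 ^ m)%N.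
have HL : 2 * n%:R < d ^+ 2 * L%:R.
  rewrite [ltRHS]mulrC -ltr_pdivrMr//.
  have := truncnS_gt (2 * n%:R / d ^+ 2); rewrite -/m => /lt_trans; apply.
  by rewrite ltr_nat ltn_expl.
have L0 : 0 < L%:R :> R by rewrite ltr0n expn_gt0.
rewrite expnSr exprM -/L.
apply: (@lt_le_trans _ _ ((1 + d *+ L) ^+ 2)); last first.
  rewrite lerXn2r ?nnegrE//; first by rewrite addr_ge0 ?mulrn_wge0// ltW.
  by rewrite exprn_ge0// addr_ge0// ltW.
rewrite natrM natrM -[d *+ L]mulr_natr.
move: (L%:R : R) (n%:R : R) HL L0 d0 => l k; clear; move=> H l0 d0.
have : 0 < (d ^+ 2 * l - 2 * k) * l by rewrite mulr_gt0//; lra.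
have : 0 < d * l by rewrite mulr_gt0.
lra.
Qed.

(** If the norm of p(h) exceeded M, that of p(h)^(2^m), which is the (2^m)-th
    power of it by the C*-identity, would outgrow the bound of [ev_rough], which is
    M^(2^m) times a linear function of 2^m. *)
Lemma ev_bound h p (M : R) : h.1 = 0 -> star h = h -> unorm h <= 1 ->
  (forall t, -1 <= t <= 1 -> `|p.[t]| <= M) -> unorm (ev h p) <= M.
Proof.
move=> h1 hs hN pM.
suff H M' : 0 < M' -> (forall t, -1 <= t <= 1 -> `|p.[t]| <= M') ->
    unorm (ev h p) <= M'.
  have M0 : 0 <= M by rewrite (le_trans _ (pM 0 _)) ?lerN10 ?ler01.
  apply/ler_addgt0Pl => e e0; apply: H => [|t t1]; first by rewrite ltr_wpDr.
  by rewrite (le_trans (pM _ t1))// lerDr ltW.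
move=> {M pM} M0 pM; rewrite leNgt; apply/negP => HM.
pose d := unorm (ev h p) / M' - 1.
have d0 : 0 < d by rewrite subr_gt0 ltr_pdivlMr// mul1r.
have [m] := @expr_beats_linear d (size p).*2 d0.
rewrite ltNge => /negP; apply.
have -> : 1 + d = unorm (ev h p) / M' by rewrite addrC subrK.
rewrite expr_div_n ler_pdivrMr ?exprn_gt0// -unorm_sa_pow2 ?ev_star// -evXn.
have := @ev_rough h (p ^+ (2 ^ m)) (size p * 2 ^ m) (M' ^+ (2 ^ m)) h1 hs hN.
rewrite natr1 -doubleMl mulr_natl; apply.
  rewrite (leq_trans (size_poly_exp_leq _ _))// ltnS leq_mul2r leq_pred orbT//.
move=> t t1; rewrite horner_exp normrX lerXn2r ?nnegrE//; first exact: ltW.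
exact: pM.
Qed.

End PolynomialCalculus.

(** * Uniform limits of polynomials *)

Section PolynomialLimits.
Variable R : realType.
Implicit Types (F G : R -> R) (p q : {poly R}) (t s e : R).

Definition approx F := forall e, 0 < e ->
  exists p, forall t, -1 <= t <= 1 -> `|F t - p.[t]| <= e.

Lemma poly_bounded p :
  exists2 B : R, 0 < B & forall t, -1 <= t <= 1 -> `|p.[t]| <= B.
Proof.
exists (1 + \sum_(i < size p) `|p`_i|) => [|t t1].
  by rewrite ltr_pwDl// sumr_ge0.
apply: (@le_trans _ _ (\sum_(i < size p) `|p`_i|)); last by rewrite lerDr.
rewrite horner_coef (le_trans (ler_norm_sum _ _ _))// ler_sum// => i _.
by rewrite normrM ler_piMr// normrX exprn_ile1// ler_norml.
Qed.

Lemma approx_bounded F : approx F ->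
  exists2 B : R, 0 < B & forall t, -1 <= t <= 1 -> `|F t| <= B.
Proof.
move=> /(_ 1 ltr01)[p Hp]; have [B B0 HB] := poly_bounded p.
exists (1 + B) => [|t t1]; first by rewrite addr_gt0.
by rewrite -(subrK p.[t] (F t)) (le_trans (ler_normD _ _))// lerD ?Hp ?HB.
Qed.

Lemma approx_poly p : approx (fun t => p.[t]).
Proof. by move=> e e0; exists p => t _; rewrite subrr normr0 ltW. Qed.

Lemma approx_ext F G : (forall t, -1 <= t <= 1 -> F t = G t) ->
  approx F -> approx G.
Proof. by move=> FG HF e /HF[p Hp]; exists p => t t1; rewrite -FG// Hp. Qed.

Lemma approx_id : approx id.
Proof. by apply: (approx_ext _ (approx_poly 'X)) => t _; rewrite hornerX. Qed.

Lemma approx_cst c : approx (fun=> c).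
Proof. by apply: (approx_ext _ (approx_poly c%:P)) => t _; rewrite hornerC. Qed.

Lemma approxD F G : approx F -> approx G -> approx (fun t => F t + G t).
Proof.
move=> HF HG e e0; have e2 : 0 < e / 2 by rewrite divr_gt0.
have [p Hp] := HF _ e2; have [q Hq] := HG _ e2; exists (p + q) => t t1.
rewrite hornerD opprD addrACA (le_trans (ler_normD _ _))//.
by rewrite [leRHS]splitr lerD ?Hp ?Hq.
Qed.

Lemma approxM F G : approx F -> approx G -> approx (fun t => F t * G t).
Proof.
move=> HF HG e e0; have [B B0 FB] := approx_bounded HF.
have e2 : 0 < e / 2 / B by rewrite !divr_gt0.
have [q Hq] := HG _ e2; have [C C0 qC] := poly_bounded q.
have e3 : 0 < e / 2 / C by rewrite !divr_gt0.
have [p Hp] := HF _ e3; exists (p * q) => t t1.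
have -> : F t * G t - (p * q).[t] = F t * (G t - q.[t]) + (F t - p.[t]) * q.[t].
  by rewrite hornerM; ring.
rewrite (le_trans (ler_normD _ _))// [leRHS]splitr !normrM lerD//.
  rewrite -[leRHS](divfK (lt0r_neq0 B0)) mulrC ler_pM ?Hq ?FB//.
by rewrite -[leRHS](divfK (lt0r_neq0 C0)) ler_pM ?Hp ?qC.
Qed.

(** The iteration of [halfseq] with 1 - s^2 in place of 1: its limit is 1 - |s|. *)
Fixpoint abspoly n : {poly R} :=
  if n is m.+1 then (2^-1) *: (1 - 'X ^+ 2 + abspoly m ^+ 2) else 0.

Lemma abspoly_cvg n s : -1 <= s <= 1 ->
  [/\ 0 <= (abspoly n).[s], (abspoly n).[s] <= halfseq R n &
      `|1 - `|s| - (abspoly n).[s]| <= 1 - halfseq R n].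
Proof.
have step (r y a : R) : a <= 1 -> 0 <= a -> r <= 1 -> 0 <= r ->
    [/\ 0 <= y, y <= r & `|1 - a - y| <= 1 - r] ->
    [/\ 0 <= 2^-1 * (1 - a ^+ 2 + y ^+ 2),
      2^-1 * (1 - a ^+ 2 + y ^+ 2) <= (1 + r ^+ 2) / 2 &
      `|1 - a - 2^-1 * (1 - a ^+ 2 + y ^+ 2)| <= 1 - (1 + r ^+ 2) / 2].
  move=> a1 a0 r1 r0 [y0 yr].
  have e : 1 - a - 2^-1 * (1 - a ^+ 2 + y ^+ 2) = (1 - a + y) * (1 - a - y) / 2.
    by field.
  rewrite e !normrM [`|2^-1|]ger0_norm ?invr_ge0// => H.
  have a2 : a ^+ 2 <= 1 by rewrite expr_le1.
  have y2 : y ^+ 2 <= r ^+ 2 by rewrite lerXn2r.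
  have y3 := sqr_ge0 y; have a3 := sqr_ge0 a.
  split; [lra|lra|].
  have : `|1 - a + y| * `|1 - a - y| <= (1 + r) * (1 - r).
    by rewrite ler_pM// ger0_norm; lra.
  lra.
rewrite -ler_norml => s1; have s0 := normr_ge0 s.
elim: n => [|n IH].
  by rewrite /= horner0 !subr0 ler_norml; split => //; apply/andP; split; lra.
rewrite /= !hornerE -[s ^+ 2]real_normK ?num_real//.
by apply: step => //; [exact: halfseq_le1|exact: halfseq_ge0].
Qed.

Lemma approx_abs F : approx F -> approx (fun t => `|F t|).
Proof.
move=> HF e e0; have e2 : 0 < e / 2 by rewrite divr_gt0.
have [p Hp] := HF _ e2; have [B B0 pB] := poly_bounded p.
have [n Hn] := @halfseq_lim R (e / 2 / B) (divr_gt0 e2 B0).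
exists (B *: (1 - (abspoly n \Po (B^-1 *: p)))) => t t1.
rewrite !hornerE horner_comp hornerZ.
have s1 : -1 <= B^-1 * p.[t] <= 1.
  rewrite -ler_norml normrM [`|B^-1|]ger0_norm ?invr_ge0 ?(ltW B0)//.
  by rewrite ler_pdivrMl// mulr1 pB.
have [_ _ H] := abspoly_cvg n s1.
set s := B^-1 * p.[t] in H *.
have ps : `|p.[t]| = B * `|s|.
  by rewrite /s normrM [`|B^-1|]ger0_norm ?invr_ge0 ?(ltW B0)// mulrA divff ?mul1r// gt_eqF.
have -> : `|F t| - B * (1 - (abspoly n).[s]) =
   (`|F t| - `|p.[t]|) + - (B * (1 - `|s| - (abspoly n).[s])).
  by rewrite ps; ring.
rewrite (le_trans (ler_normD _ _))// [leRHS]splitr lerD//.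
  by rewrite (le_trans (ler_dist_dist _ _))// Hp.
rewrite normrN normrM (gtr0_norm B0) -[leRHS](divfK (lt0r_neq0 B0)) mulrC.
by rewrite ler_wpM2r ?(ltW B0)// (le_trans H)// ltW.
Qed.

(** The projection of the line onto [0, 1], written with absolute values so that
    it preserves uniform limits of polynomials. *)
Definition clamp s : R := (`|s| + 1 - `|s - 1|) / 2.

Lemma clamp0 s : s <= 0 -> clamp s = 0.
Proof. by move=> s0; rewrite /clamp ler0_norm// ler0_norm; [field|lra]. Qed.

Lemma clamp1 s : 1 <= s -> clamp s = 1.
Proof.
by move=> s1; rewrite /clamp ger0_norm ?ger0_norm; [field|lra|lra].
Qed.

Lemma clamp_id s : 0 <= s <= 1 -> clamp s = s.
Proof.
case/andP=> s0 s1; rewrite /clamp ger0_norm// ler0_norm; first by field.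
lra.
Qed.

Lemma clamp_itv s : 0 <= clamp s <= 1.
Proof.
have [s0|s0] := leP s 0; first by rewrite clamp0// lexx ler01.
have [s1|s1] := leP 1 s; first by rewrite clamp1// ler01 lexx.
by rewrite clamp_id !ltW.
Qed.

Lemma approx_clamp F : approx F -> approx (fun t => clamp (F t)).
Proof.
move=> HF; have H1 := approxD (approx_abs HF) (approx_cst 1).
have H2 := approx_abs (approxD HF (approx_cst (-1))).
have H3 := approxM (approxD H1 (approxM (approx_cst (-1)) H2)) (approx_cst 2^-1).
by apply: (approx_ext _ H3) => t _; rewrite mulN1r.
Qed.

Definition bump (a b t : R) : R := clamp ((t - a) / (b - a)).

Lemma approx_bump a b F : approx F -> approx (fun t => bump a b (F t)).
Proof.
move=> HF; apply: approx_clamp; apply: approxM (approx_cst _).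
by apply: approxD HF (approx_cst _).
Qed.

Lemma bump_itv a b t : 0 <= bump a b t <= 1.
Proof. exact: clamp_itv. Qed.

Lemma bump0 a b t : a < b -> t <= a -> bump a b t = 0.
Proof.
move=> ab ta; apply: clamp0.
by rewrite mulr_le0_ge0// ?subr_le0// invr_ge0 subr_ge0 ltW.
Qed.

Lemma bump1 a b t : a < b -> b <= t -> bump a b t = 1.
Proof.
move=> ab ta; apply: clamp1.
by rewrite ler_pdivlMr ?subr_gt0// mul1r lerD2r.
Qed.

Lemma bumpM a b c d t : a < b -> b <= c -> c < d ->
  bump a b t * bump c d t = bump c d t.
Proof.
move=> ab bc cd; have [tb|tb] := leP b t; first by rewrite bump1// mul1r.
by rewrite [bump c d t]bump0 ?mulr0// (le_trans (ltW tb)).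
Qed.

End PolynomialLimits.

(** * Functional calculus *)

Section FunctionalCalculus.
Variables (R : realType) (A : cstarAlgType R).
Local Notation U := (unitization A).
Implicit Types (u v w g h : U) (F G : R -> R) (p q : {poly R}).

(** The element u is F(h): it is the limit of p(h) along polynomials p with no
    constant term that converge to F on [-1, 1].  In particular F(0) = 0, which keeps
    u inside A. *)
Definition fcalc h F u : Prop := u.1 = 0 /\
  forall e : R, 0 < e -> exists p, [/\ p.[0] = 0,
    forall t, -1 <= t <= 1 -> `|F t - p.[t]| <= e & unorm (u - ev h p) <= e].

Lemma ev_fst h p : h.1 = 0 -> (ev h p).1 = ((p.[0])%:C)%C.
Proof.
move=> h1; elim/poly_ind: p => [|p c _].
  by rewrite -polyC0 evC hornerC scale0r.
rewrite evD evM evX evC fstD (fst0Mr _ h1) add0r fstZ !hornerE.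
by [].
Qed.

Lemma ev_ind h (P : U -> Prop) : P h -> (forall u v, P u -> P v -> P (u + v)) ->
  (forall (r : R) u, P u -> P ((r%:C)%C *: u)) -> (forall u, P u -> P (h * u)) ->
  forall p, p.[0] = 0 -> P (ev h p).
Proof.
move=> Ph PD PZ PM p p0.
have {p0} : p = 'X * (p %/ 'X).
  by rewrite mulrC divpK// -['X]subr0 -polyC0 dvdp_XsubCl; apply/rootP.
move: (p %/ 'X) => q ->.
have PC (c : R) : P (ev h ('X * c%:P)).
  by rewrite mulrC mul_polyC evZ evX; exact: PZ.
elim/poly_ind: q => [|q c IH]; first by rewrite -polyC0.
rewrite mulrDr evD; apply: PD => //.
by rewrite [q * _]mulrC evM evX; exact: PM.
Qed.

Section Fixed.
Variable h : U.
Hypotheses (h1 : h.1 = 0) (hs : star h = h) (hN : unorm h <= 1).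

(** Closure properties pass from h to F(h): membership in a closed subalgebra,
    or being fixed by a left multiplier, are instances. *)
Lemma fcalc_ind (P : U -> Prop) :
  P h -> (forall u v, P u -> P v -> P (u + v)) ->
  (forall (r : R) u, P u -> P ((r%:C)%C *: u)) -> (forall u, P u -> P (h * u)) ->
  (forall u, u.1 = 0 ->
     (forall e : R, 0 < e -> exists v, [/\ v.1 = 0, P v & unorm (u - v) <= e]) ->
     P u) ->
  forall F u, fcalc h F u -> P u.
Proof.
move=> Ph PD PZ PM Pcl F u [u1 Hu]; apply: Pcl => // e /Hu[p [p0 _ up]].
by exists (ev h p); split => //; [rewrite ev_fst// p0|exact: ev_ind].
Qed.

Lemma fcalc_fix g F u : g * h = h -> fcalc h F u -> g * u = u.
Proof.
move=> gh; apply: (@fcalc_ind (fun u => g * u = u)) => //.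
- by move=> v w gv gw; rewrite mulrDr gv gw.
- by move=> r v gv; rewrite -scalerAr gv.
- by move=> v gv; rewrite mulrA gh.
move=> v v1 Hv; apply/eqP; rewrite -subr_eq0; apply/eqP.
apply: (@unorm_small _ _ _ (unorm g + 1)).
- by apply: fst0B => //; exact: fst0Mr.
- by rewrite addr_ge0// unorm_ge0.
move=> e /Hv[w [w1 gw vw]].
have -> : g * v - v = g * (v - w) - (v - w) by rewrite mulrBr gw opprB addrA subrK.
rewrite (le_trans (unormB _ _))// [leRHS]mulrDl mul1r lerD//.
by rewrite (le_trans (unormM _ _))// ler_wpM2l// unorm_ge0.
Qed.

Lemma fcalc_star F u : fcalc h F u -> star u = u.
Proof.
move=> [u1 Hu]; apply/eqP; rewrite -subr_eq0; apply/eqP.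
apply: (@unorm_small _ _ _ 2) => //; first by apply: fst0B => //; exact: fst0_star.
move=> e /Hu[p [_ _ up]].
have -> : star u - u = star (u - ev h p) - (u - ev h p).
  by rewrite starB ev_star// opprB addrA subrK.
have -> : 2 * e = e + e by ring.
by rewrite (le_trans (unormB _ _))// unorm_star lerD.
Qed.

(** The constant c gives access to 1 - F(h), which has a nonzero scalar part. *)
Lemma fcalc_le (c : R) F u M : fcalc h F u ->
  (forall t, -1 <= t <= 1 -> `|c + F t| <= M) ->
  unorm ((c%:C)%C *: 1 + u) <= M.
Proof.
move=> [u1 Hu] HM; apply/ler_addgt0Pl => e e0.
have [p [p0 Fp up]] := Hu _ (divr_gt0 e0 (ltr0n R 2)).
have -> : (c%:C)%C *: 1 + u = (u - ev h p) + ev h (c%:P + p).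
  by rewrite evD evC addrCA subrK.
rewrite (le_trans (unormD _ _))// [e]splitr -addrA lerD//.
apply: ev_bound => // t t1; rewrite hornerD hornerC.
have -> : c + p.[t] = - (F t - p.[t]) + (c + F t) by ring.
by rewrite (le_trans (ler_normD _ _))// normrN lerD ?Fp ?HM.
Qed.

Lemma fcalc_norm F u M : fcalc h F u ->
  (forall t, -1 <= t <= 1 -> `|F t| <= M) -> unorm u <= M.
Proof.
move=> Hu HM; rewrite -[u]add0r -(scale0r (1 : U)).
by apply: (@fcalc_le 0 _ _ _ Hu) => t t1; rewrite add0r HM.
Qed.

Lemma fcalc_compl F u : fcalc h F u ->
  (forall t, -1 <= t <= 1 -> 0 <= F t <= 1) -> unorm (1 - u) <= 1.
Proof.
move=> Hu HF; rewrite -unormN opprB addrC.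
have -> : - (1 : U) = (((-1)%:C)%C *: 1) by rewrite rmorphN1 scaleN1r.
apply: (@fcalc_le (-1) _ _ _ Hu) => t /HF/andP[F0 F1].
by rewrite ler_norml; apply/andP; split; lra.
Qed.

Lemma fcalc_poly p : p.[0] = 0 -> fcalc h (fun t => p.[t]) (ev h p).
Proof.
move=> p0; split; first by rewrite ev_fst// p0.
move=> e e0; exists p; split=> // [t _|]; first by rewrite subrr normr0 ltW.
by rewrite subrr unorm0 ltW.
Qed.

Lemma fcalc_id : fcalc h id h.
Proof.
have := @fcalc_poly 'X; rewrite hornerX evX => /(_ erefl) [_ H]; split => // e e0.
have [p [p0 Fp up]] := H _ e0; exists p; split => // t t1.
by rewrite -[t in t - _]hornerX Fp.
Qed.

Lemma fcalc_ext F G u : (forall t, -1 <= t <= 1 -> F t = G t) ->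
  fcalc h F u -> fcalc h G u.
Proof.
move=> FG [u1 H]; split => // e /H[p [p0 Fp up]]; exists p; split=> // t t1.
by rewrite -FG ?Fp.
Qed.

Lemma fcalcD F G u v : fcalc h F u -> fcalc h G v ->
  fcalc h (fun t => F t + G t) (u + v).
Proof.
move=> [u1 Hu] [v1 Hv]; split; first exact: fst0D.
move=> e e0; have e2 : 0 < e / 2 by rewrite divr_gt0.
have [p [p0 Fp up]] := Hu _ e2; have [q [q0 Gq vq]] := Hv _ e2.
exists (p + q); split => [|t t1|]; first by rewrite hornerD p0 q0 addr0.
  rewrite hornerD opprD addrACA (le_trans (ler_normD _ _))//.
  by rewrite [leRHS]splitr lerD ?Fp ?Gq.
rewrite evD opprD addrACA (le_trans (unormD _ _))//.
by rewrite [leRHS]splitr; exact: lerD.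
Qed.

Lemma fcalcZ (c : R) F u : fcalc h F u ->
  fcalc h (fun t => c * F t) ((c%:C)%C *: u).
Proof.
move=> [u1 Hu]; split; first exact: fst0Z.
move=> e e0; have c0 : 0 < `|c| + 1 by rewrite ltr_wpDl.
have [p [p0 Fp up]] := Hu _ (divr_gt0 e0 c0).
have ce x : 0 <= x -> x <= e / (`|c| + 1) -> `|c| * x <= e.
  move=> x0; rewrite ler_pdivlMr// => H; rewrite mulrC (le_trans _ H)//.
  by rewrite ler_wpM2l// lerDl.
exists (c *: p); split => [|t t1|]; first by rewrite hornerZ p0 mulr0.
  by rewrite hornerZ -mulrBr normrM ce ?Fp.
by rewrite evZ -scalerBr unormRZ ce ?unorm_ge0.
Qed.

Lemma fcalcB F G u v : fcalc h F u -> fcalc h G v ->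
  fcalc h (fun t => F t - G t) (u - v).
Proof.
move=> Hu Hv; have := fcalcD Hu (fcalcZ (-1) Hv).
rewrite rmorphN1 scaleN1r; apply: fcalc_ext => t _; by rewrite mulN1r.
Qed.

Lemma fcalcM F G u v : approx F -> fcalc h F u -> fcalc h G v ->
  fcalc h (fun t => F t * G t) (u * v).
Proof.
move=> aF Hu Hv; have [B B0 FB] := approx_bounded aF.
have uB : unorm u <= B := fcalc_norm Hu FB.
case: Hu Hv => u1 Hu [v1 Hv]; split; first exact: fst0Ml.
move=> e e0.
have e2 : 0 < e / 2 / B by rewrite !divr_gt0.
have [q [q0 Gq vq]] := Hv _ e2; have [C C0 qC] := poly_bounded q.
have e3 : 0 < e / 2 / C by rewrite !divr_gt0.
have [p [p0 Fp up]] := Hu _ e3.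
exists (p * q); split => [|t t1|]; first by rewrite hornerM p0 mul0r.
  have -> : F t * G t - (p * q).[t] = F t * (G t - q.[t]) + (F t - p.[t]) * q.[t].
    by rewrite hornerM; ring.
  rewrite (le_trans (ler_normD _ _))// [leRHS]splitr !normrM lerD//.
    by rewrite -[leRHS](divfK (lt0r_neq0 B0)) mulrC ler_pM ?Gq ?FB.
  by rewrite -[leRHS](divfK (lt0r_neq0 C0)) ler_pM ?Fp ?qC.
have -> : u * v - ev h (p * q) = u * (v - ev h q) + (u - ev h p) * ev h q.
  by rewrite evM mulrBr mulrBl addrA subrK.
rewrite (le_trans (unormD _ _))// [leRHS]splitr lerD//.
  rewrite (le_trans (unormM _ _))// -[leRHS](divfK (lt0r_neq0 B0)) mulrC.
  by rewrite ler_pM ?unorm_ge0.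
rewrite (le_trans (unormM _ _))// -[leRHS](divfK (lt0r_neq0 C0)).
by rewrite ler_pM ?unorm_ge0// ev_bound.
Qed.

Lemma fcalc_eq0 F u : fcalc h F u ->
  (forall t, -1 <= t <= 1 -> F t = 0) -> u = 0.
Proof.
move=> Hu F0; apply: unorm_eq0; first by case: Hu.
apply/eqP; rewrite eq_le unorm_ge0 andbT.
by apply: (fcalc_norm Hu) => t /F0->; rewrite normr0.
Qed.

Lemma fcalc_uniq F u v : fcalc h F u -> fcalc h F v -> u = v.
Proof.
move=> Hu Hv; apply/eqP; rewrite -subr_eq0; apply/eqP.
by apply: (fcalc_eq0 (fcalcB Hu Hv)) => t _; rewrite subrr.
Qed.

Lemma fcalc_ex F : approx F -> F 0 = 0 -> exists u, fcalc h F u.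
Proof.
move=> aF F0.
have H (n : nat) : exists p, p.[0] = 0 /\
    forall t, -1 <= t <= 1 -> `|F t - p.[t]| <= n.+1%:R^-1.
  have e0 : 0 < (n.+1%:R^-1 / 2 : R) by rewrite divr_gt0 ?invr_gt0.
  have [p Hp] := aF _ e0; exists (p - (p.[0])%:P); split.
    by rewrite hornerD hornerN hornerC subrr.
  move=> t t1; rewrite hornerD hornerN hornerC.
  have -> : F t - (p.[t] - p.[0]) = (F t - p.[t]) + - (F 0 - p.[0]).
    by rewrite F0; ring.
  rewrite (le_trans (ler_normD _ _))// normrN [leRHS]splitr lerD ?Hp//.
  by rewrite lerN10 ler01.
have [P HP] := choice H.
have PE n : emb (ev h (P n)).2 = ev h (P n).
  have := ev_fst (P n) h1; rewrite (HP n).1 rmorph0 /emb.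
  by case: (ev h (P n)) => a x /= ->.
have Pd n m : (n <= m)%N -> unorm (ev h (P m) - ev h (P n)) <= 2 / n.+1%:R.
  move=> nm; rewrite -evB; apply: ev_bound => // t t1.
  rewrite hornerD hornerN.
  have -> : (P m).[t] - (P n).[t] = (F t - (P n).[t]) + - (F t - (P m).[t]) by ring.
  rewrite (le_trans (ler_normD _ _))// normrN.
  have -> : 2 / n.+1%:R = n.+1%:R^-1 + n.+1%:R^-1 :> R by rewrite mulrDl !mul1r.
  rewrite lerD ?(HP n).2// (le_trans ((HP m).2 t t1))//.
  by rewrite lef_pV2 ?posrE// ler_nat.
have lim (e : R) : 0 < e -> exists N : nat, 2 / N.+1%:R < e.
  move=> e0; exists (Num.truncn (2 / e)).
  rewrite ltr_pdivrMr// mulrC -ltr_pdivrMr//; exact: truncnS_gt.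
have [|l fl] := @rcauchy_cvg R A (fun n => (ev h (P n)).2).
  move=> e /lim [N HN]; exists N => n Nn.
  by rewrite -unorm_emb embD embN !PE (le_lt_trans _ HN)// Pd.
exists (emb l); split => // e e0.
have [N HN] := fl _ e0; have [M HM] := lim _ e0.
exists (P (maxn N M)); split; first exact: (HP _).1.
  move=> t t1; rewrite (le_trans ((HP _).2 t t1))//.
  apply: (le_trans _ (ltW HM)).
  apply: (@le_trans _ _ M.+1%:R^-1); last by rewrite ler_peMl// ler1n.
  by rewrite lef_pV2 ?posrE// ler_nat ltnS leq_maxr.
rewrite -PE -embN -embD unorm_emb -rnormN opprB ltW// HN// ?leq_maxl//.
Qed.

(** The powers h^(2^m) have norm one and are concentrated where |t| is close to 1,
    where F = 1: h^(2^m) differs from h^(2^m) F(h) by at most b^(2^m). *)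
Lemma fcalc_norm1 F u (b : R) : unorm h = 1 -> approx F -> fcalc h F u ->
  0 <= b < 1 -> (forall t, -1 <= t <= 1 -> 0 <= F t <= 1) ->
  (forall t, -1 <= t <= 1 -> b <= `|t| -> F t = 1) -> unorm u = 1.
Proof.
move=> hN1 aF Hu /andP[b0 b1] F01 Fb; apply/eqP; rewrite eq_le.
rewrite (fcalc_norm Hu) => [/=|t /F01/andP[F0 F1]]; last by rewrite ger0_norm.
rewrite leNgt; apply/negP => u1.
have e0 : 0 < 1 - unorm u by rewrite subr_gt0.
have nb : `|b| < 1 by rewrite ger0_norm.
have /cvgrPdist_lt/(_ _ e0)[N _ HN] := cvg_expr nb.
have := HN (2 ^ N)%N; rewrite /= sub0r normrN => /(_ (ltnW (ltn_expl N (ltnSn 1)))).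
rewrite ger0_norm ?exprn_ge0// ltNge => /negP; apply.
have K0 : (0 < 2 ^ N)%N by rewrite expn_gt0.
set K := (2 ^ N)%N in K0 *.
have HK : fcalc h (fun t => t ^+ K) (h ^+ K).
  have := @fcalc_poly ('X ^+ K); rewrite evXn evX hornerXn expr0n gtn_eqF//.
  move=> /(_ erefl); apply: fcalc_ext => t _; by rewrite hornerXn.
have aK : approx (fun t : R => t ^+ K).
  by apply: (approx_ext _ (approx_poly 'X^K)) => t _; rewrite hornerXn.
have HK1 := fcalcB HK (fcalcM aK HK Hu).
have le1 : unorm (h ^+ K - h ^+ K * u) <= b ^+ K.
  apply: (fcalc_norm HK1) => t t1.
  have -> : t ^+ K - t ^+ K * F t = t ^+ K * (1 - F t) by ring.
  have [bt|bt] := leP b `|t|.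
    by rewrite Fb// subrr mulr0 normr0 exprn_ge0.
  have /andP[F0 F1] := F01 _ t1.
  rewrite normrM normrX -[leRHS]mulr1 ler_pM//; first by rewrite lerXn2r ?nnegrE// ltW.
  by rewrite ger0_norm; lra.
have e1 : unorm (h ^+ K) = 1 by rewrite unorm_sa_pow2// hN1 expr1n.
rewrite lerBlDr; apply: (@le_trans _ _ (unorm (h ^+ K))); first by rewrite e1.
rewrite -{1}(subrK (h ^+ K * u) (h ^+ K)) (le_trans (unormD _ _))// lerD//.
by rewrite (le_trans (unormM _ _))// e1 mul1r.
Qed.

End Fixed.
End FunctionalCalculus.

(** * Real C*-subalgebras and spectral cut-offs *)

Section RealSubalgebra.
Variables (R : realType) (A : cstarAlgType R) (S : realCstarAlg A).
Local Notation U := (unitization A).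
Implicit Types (u v g h j k : U).

Definition inS u : Prop := u.1 = 0 /\ rcs_set S u.2.

Lemma inSD u v : inS u -> inS v -> inS (u + v).
Proof. by move=> [u1 u2] [v1 v2]; split; [exact: fst0D|exact: rcsD]. Qed.

Lemma inSZ (r : R) u : inS u -> inS ((r%:C)%C *: u).
Proof. by move=> [u1 u2]; split; [exact: fst0Z|exact: rcsZ]. Qed.

Lemma inSN u : inS u -> inS (- u).
Proof. by rewrite -scaleN1r -(rmorphN1 (real_complex R)) => /inSZ; exact. Qed.

Lemma inSB u v : inS u -> inS v -> inS (u - v).
Proof. by move=> Hu /inSN; exact: inSD. Qed.

Lemma inSM u v : inS u -> inS v -> inS (u * v).
Proof.
move=> [u1 u2] [v1 v2]; split; first exact: fst0Ml.
by rewrite /= u1 v1 !scale0r !add0r; exact: rcsM.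
Qed.

Lemma inS_star u : inS u -> inS (star u).
Proof. by move=> [u1 u2]; split; [exact: fst0_star|exact: rcs_star]. Qed.

Lemma inS_lim u : u.1 = 0 ->
  (forall e : R, 0 < e -> exists v, inS v /\ unorm (u - v) <= e) -> inS u.
Proof.
move=> u1 H; split => //; apply: rcs_closed => B /nbhs_ballP[e /= e0 Be].
have ee := RRe_real (gtr0_real e0).
have re0 : 0 < complex.Re e by rewrite -ltcR ee.
have [v [[v1 v2] uv]] := H _ (divr_gt0 re0 (ltr0n R 2)).
exists v.2; split => //; apply: Be; rewrite -ball_normE /= -rnormE -ee ltcR.
have uvE : emb (u.2 - v.2) = u - v by rewrite [RHS]surjective_pairing (fst0B u1 v1).
rewrite -unorm_emb uvE (le_lt_trans uv)// ltr_pdivrMr//; lra.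
Qed.

Definition sa_unit j : Prop := [/\ inS j, star j = j & unorm j = 1].

(** Says that k lives on the support of j, without a support projection, which S
    need not contain. *)
Definition below k j : Prop := forall g, g * j = j -> g * k = k.

(** For real scalars e S e may also be the complex numbers or the quaternions;
    only its self-adjoint part has to be the line of e. *)
Definition minimal_projection e : Prop :=
  [/\ inS e, star e = e, e * e = e, e <> 0 &
    forall a, inS a -> star a = a -> exists r : R, e * a * e = (r%:C)%C *: e].

(** Apply [below] to 1 - c. *)
Lemma below_orth c j k : below k j -> c * j = 0 -> c * k = 0.
Proof.
move=> kj cj; have := kj (1 - c).
rewrite !mulrBl !mul1r cj subr0 => /(_ erefl) e.
by apply/eqP; rewrite -oppr_eq0 -(inj_eq (addrI k)) addr0 e.
Qed.

Lemma fcalc_inS h F u : inS h -> star h = h -> unorm h <= 1 ->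
  fcalc h F u -> inS u.
Proof.
move=> hS hs hN; apply: (@fcalc_ind _ _ h _ inS) => //; first by case: hS.
- exact: inSD.
- by move=> r v; exact: inSZ.
- by move=> v; exact: inSM.
move=> v v1 Hv; apply: inS_lim => // e /Hv[w [_ wS vw]].
by exists w.
Qed.

Lemma approx_absbump (a b : R) : approx (fun t => bump a b `|t|).
Proof. by apply: approx_bump; apply: approx_abs; exact: approx_id. Qed.

Lemma absbump_ex h (a b : R) : h.1 = 0 -> star h = h -> unorm h <= 1 ->
  0 <= a < b -> exists u, fcalc h (fun t => bump a b `|t|) u.
Proof.
move=> h1 hs hN /andP[a0 ab]; apply: fcalc_ex => //; first exact: approx_absbump.
by rewrite normr0 bump0.
Qed.

(** Cut-offs of |j| at increasing levels. *)
Lemma plateaus j : sa_unit j -> exists p q r,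
  [/\ sa_unit p, sa_unit q, sa_unit r, p * q = q /\ q * r = r &
      unorm (1 - p) <= 1 /\ below p j].
Proof.
move=> [jS js jN]; have [j1 _] := jS; have jN1 : unorm j <= 1 by rewrite jN.
have H n : (n < 3)%N -> exists u, sa_unit u /\
    fcalc j (fun t => bump (n%:R / 4) (n.+1%:R / 4) `|t|) u.
  move=> n3; have ab : 0 <= (n%:R / 4 : R) < n.+1%:R / 4.
    by rewrite divr_ge0//= ltr_pM2r ?invr_gt0// ltr_nat.
  have [u Hu] := absbump_ex j1 js jN1 ab; exists u; split => //.
  split; [exact: (fcalc_inS _ _ _ Hu)|exact: (fcalc_star js Hu)|].
  apply: (fcalc_norm1 j1 js jN1 (b := n.+1%:R / 4) jN _ Hu).
  - exact: approx_absbump.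
  - by rewrite divr_ge0//= ltr_pdivrMr// mul1r ltr_nat.
  - by move=> t _; exact: bump_itv.
  - by move=> t _; case/andP: ab => _ ab; exact: bump1.
have [p [p1 Hp]] := H 0%N isT; have [q [q1 Hq]] := H 1%N isT.
have [r [r1 Hr]] := H 2%N isT.
exists p, q, r; split => //; last split.
- split.
    apply: (fcalc_uniq j1 js jN1 (fcalcM j1 js jN1 _ Hp Hq)).
      exact: approx_absbump.
    by apply: fcalc_ext Hq => t _; rewrite bumpM//; lra.
  apply: (fcalc_uniq j1 js jN1 (fcalcM j1 js jN1 _ Hq Hr)).
    exact: approx_absbump.
  by apply: fcalc_ext Hr => t _; rewrite bumpM//; lra.
- by apply: (fcalc_compl j1 js jN1 Hp) => t _; exact: bump_itv.
- by move=> g gj; exact: (fcalc_fix j1 gj Hp).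
Qed.

End RealSubalgebra.

(** * Splitting into orthogonal pieces *)

Section Splitting.
Variables (R : realType) (A : cstarAlgType R) (S : realCstarAlg A).
Local Notation U := (unitization A).
Local Notation inS := (inS S).
Local Notation sa_unit := (sa_unit S).
Implicit Types (u v g h j k m : U).

Lemma inS_neq0 u : inS u -> u <> 0 -> 0 < unorm u.
Proof.
move=> [u1 _] u0; rewrite lt_def unorm_ge0 andbT; apply/eqP => N0.
by apply: u0; exact: unorm_eq0.
Qed.

Lemma normalize m : inS m -> star m = m -> m <> 0 ->
  sa_unit (((unorm m)^-1%:C)%C *: m).
Proof.
move=> mS ms /(inS_neq0 mS) m0; split; [exact: inSZ|by rewrite starRZ ms|].
by rewrite unormRZ ger0_norm ?invr_ge0 ?unorm_ge0// mulVf// gt_eqF.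
Qed.

Definition splits j : Prop := exists k l,
  [/\ sa_unit k, sa_unit l, k * l = 0, below k j & below l j].

(** After normalization two nonzero orthogonal elements would split j. *)
Lemma not_splits_zero j p m n : ~ splits j -> below p j ->
  inS m -> star m = m -> p * m = m -> inS n -> star n = n -> p * n = n ->
  m * n = 0 -> m = 0 \/ n = 0.
Proof.
move=> Hj pj mS ms pm nS ns pn mn; apply: contrapT => /not_orP[m0 n0]; apply: Hj.
exists (((unorm m)^-1%:C)%C *: m), (((unorm n)^-1%:C)%C *: n); split.
- exact: normalize.
- exact: normalize.
- by rewrite -scalerAl -scalerAr mn !scaler0.
- by move=> g /pj gp; rewrite -scalerAr; congr (_ *: _); rewrite -pm mulrA gp.
- by move=> g /pj gp; rewrite -scalerAr; congr (_ *: _); rewrite -pn mulrA gp.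
Qed.

(** The part of m with |t| away from 1 is orthogonal to the part with |t| close
    to 1, which has norm one; so it vanishes, and t^3 = t on what remains. *)
Lemma not_splits_cube j p m : ~ splits j -> below p j ->
  sa_unit m -> p * m = m -> m ^+ 3 = m.
Proof.
move=> Hj pj [mS ms mN] pm; have [m1 _] := mS.
have mN1 : unorm m <= 1 by rewrite mN.
apply/eqP; rewrite -subr_eq0; apply/eqP; apply: (@unorm_small _ _ _ 4) => //.
  by apply: fst0B => //; rewrite exprS; exact: fst0Ml.
move=> e e0; pose d := Num.min e (4^-1).
have d0 : 0 < d by rewrite lt_min e0 invr_gt0 ltr0n.
have d4 : d <= 4^-1 by rewrite ge_min lexx orbT.
have de : d <= e by rewrite ge_min lexx.
pose E (t : R) := bump (1 - d) (1 - d / 2) `|t|.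
pose B (t : R) := bump (1 - d *+ 2) (1 - d) `|t|.
(* E is the cut-off near |t| = 1 and Q the part of t^3 - t orthogonal to it;
   B leaves a gap of width d between them. *)
pose P (t : R) := t ^+ 3 - t.
pose Q (t : R) := P t * (1 - B t).
have aP : approx P.
  apply: (approx_ext _ (approx_poly ('X^3 - 'X))) => t _.
  by rewrite !hornerE.
have aB : approx B by exact: approx_absbump.
have aQ : approx Q.
  apply: approxM => //.
  have aB' := approxD (approx_cst 1) (approxM (approx_cst (-1)) aB).
  apply: (approx_ext _ aB') => t _.
  by rewrite mulN1r.
have [u Hu] : exists u, fcalc m E u.
  by apply: absbump_ex => //; apply/andP; split; lra.
have [w Hw] : exists w, fcalc m Q w.
  by apply: fcalc_ex => //; rewrite /Q /P expr0n/= subrr mul0r.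
have uN : unorm u = 1.
  apply: (fcalc_norm1 m1 ms mN1 (b := 1 - d / 2) mN _ Hu).
  - exact: approx_absbump.
  - by apply/andP; split; lra.
  - by move=> t _; exact: bump_itv.
  - by move=> t _ dt; rewrite /E bump1//; lra.
have w0 : w = 0.
  have uw : u * w = 0.
    apply: (fcalc_eq0 m1 ms mN1 (fcalcM m1 ms mN1 _ Hu Hw)).
      exact: approx_absbump.
    move=> t _; have [dt|dt] := leP (1 - d) `|t|.
      by rewrite /Q /B bump1 ?subrr ?mulr0//; lra.
    by rewrite /E bump0 ?mul0r//; [lra|exact: ltW].
  have [] := not_splits_zero Hj pj _ _ _ _ _ _ uw => //.
  - exact: (fcalc_inS _ _ _ Hu).
  - exact: (fcalc_star _ Hu).
  - exact: (fcalc_fix _ _ Hu).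
  - exact: (fcalc_inS _ _ _ Hw).
  - exact: (fcalc_star _ Hw).
  - exact: (fcalc_fix _ _ Hw).
  - by move=> u0; move: uN; rewrite u0 unorm0 => /esym/eqP; rewrite oner_eq0.
have HP : fcalc m P (m ^+ 3 - m).
  have p0 : ('X^3 - 'X : {poly R}).[0] = 0.
    by rewrite hornerD hornerN hornerXn hornerX expr0n subr0.
  have := fcalc_poly m1 p0.
  by rewrite evB evXn evX; apply: fcalc_ext => t _; rewrite !hornerE.
have := fcalcB HP Hw; rewrite w0 subr0 => /(fcalc_norm m1 ms mN1); apply.
move=> t t1; have -> : P t - Q t = P t * B t by rewrite /Q; ring.
have /andP[b0 b1] := bump_itv (1 - d *+ 2) (1 - d) `|t|.
have [dt|dt] := leP `|t| (1 - d *+ 2).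
  by rewrite /B bump0// ?mulr0 ?normr0; rewrite ?mulr2n; lra.
rewrite normrM [`|B t|]ger0_norm// -[leRHS]mulr1 ler_pM//.
have -> : P t = t * (t ^+ 2 - 1) by rewrite /P; ring.
move: t1; rewrite -ler_norml => t1.
rewrite normrM -[leRHS]mul1r ler_pM// -[t ^+ 2]real_normK ?num_real//.
suff key (s : R) : 0 <= s -> s <= 1 -> 1 - d *+ 2 < s -> `|s ^+ 2 - 1| <= 4 * e.
  exact: key.
move=> s0 s1; rewrite mulr2n => ds.
have s2 : s ^+ 2 <= 1 by rewrite expr_le1.
have s3 : (1 - (d + d)) ^+ 2 <= s ^+ 2 by rewrite lerXn2r ?nnegrE ?(ltW ds)//; lra.
have d2 := sqr_ge0 d.
have s4 : 1 - 4 * d <= s ^+ 2 by apply: le_trans s3; lra.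
rewrite ler_norml; apply/andP; split; lra.
Qed.

(** By m^3 = m, the projections (m^2 + m) / 2 and (m^2 - m) / 2 are orthogonal, so
    one of them vanishes. *)
Lemma not_splits_square j p m : ~ splits j -> below p j ->
  sa_unit m -> p * m = m -> m ^+ 2 = m \/ m ^+ 2 = - m.
Proof.
move=> Hj pj Hm pm; have m3 := not_splits_cube Hj pj Hm pm.
have [mS ms _] := Hm.
have m2S : inS (m ^+ 2) by rewrite expr2; exact: inSM.
have m2s : star (m ^+ 2) = m ^+ 2 by rewrite starX ms.
have pm2 : p * m ^+ 2 = m ^+ 2 by rewrite expr2 mulrA pm.
have m4 : m ^+ 2 * m ^+ 2 = m ^+ 2 by rewrite -exprD [LHS](exprS m 3) m3 expr2.
have c : (m ^+ 2 + m) * (m ^+ 2 - m) = 0.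
  have mm2 : m * m ^+ 2 = m by rewrite -exprS.
  have m2m : m ^+ 2 * m = m by rewrite -exprSr.
  rewrite mulrBr !mulrDl m4 mm2 m2m expr2.
  by rewrite [m * m + m]addrC subrr; reflexivity.
have [] := not_splits_zero Hj pj _ _ _ _ _ _ c.
- exact: inSD.
- by rewrite starD m2s ms.
- by rewrite mulrDr pm2 pm.
- exact: inSB.
- by rewrite starB m2s ms.
- by rewrite mulrBr pm2 pm.
- by move/eqP; rewrite addr_eq0 => /eqP; right.
- by move/eqP; rewrite subr_eq0 => /eqP; left.
Qed.

(** A cut-off of j yields a projection e.  For self-adjoint a both m = e a e and
    m + t e square to real multiples of themselves; comparing the two equations
    makes m a multiple of e, unless t is 0 or an exceptional value. *)
Lemma not_splits_minimal j : sa_unit j -> ~ splits j ->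
  exists e, minimal_projection S e.
Proof.
move=> Hj Hs; have [p [q [r [_ Hq _ [pq _] [_ pj]]]]] := plateaus Hj.
have [qS qs qN] := Hq.
have q0 : q <> 0.
  by move=> q0; move: qN; rewrite q0 unorm0 => /esym/eqP; rewrite oner_eq0.
have [e [eS es ee [e0 pe]]] : exists e,
    [/\ inS e, star e = e, e * e = e & e <> 0 /\ p * e = e].
  have [q2|q2] := not_splits_square Hs pj Hq pq.
    by exists q; split => //; rewrite -expr2.
  exists (- q); split; [exact: inSN|by rewrite starN qs|by rewrite mulrNN -expr2|].
  by split; [move/eqP; rewrite oppr_eq0 => /eqP|rewrite mulrN pq].
have sq m : inS m -> star m = m -> p * m = m ->
    exists r : R, m ^+ 2 = (r%:C)%C *: m.
  move=> mS ms pm; have [->|m0] := eqVneq m 0.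
    by exists 0; rewrite expr0n scaler0.
  have {}m0 : m <> 0 by apply/eqP.
  have n0 := inS_neq0 mS m0.
  have pn : p * (((unorm m)^-1%:C)%C *: m) = ((unorm m)^-1%:C)%C *: m.
    by rewrite -scalerAr pm.
  have [n [k [mE H]]] : exists (n : R) k,
      m = (n%:C)%C *: k /\ (k ^+ 2 = k \/ k ^+ 2 = - k).
    exists (unorm m), (((unorm m)^-1%:C)%C *: m); split.
      rewrite scalerA -(rmorphM (real_complex R)) mulfV ?gt_eqF// rmorph1.
      by rewrite scale1r.
    exact: not_splits_square Hs pj (normalize mS ms m0) pn.
  rewrite mE exprZn; case: H => ->.
    by exists n; rewrite !scalerA expr2.
  by exists (- n); rewrite scalerN -scaleNr scalerA rmorphN mulNr expr2.
exists e; split => // a aS sa; set m := e * a * e.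
have mS : inS m by do !apply: inSM.
have ms : star m = m by rewrite /m !starM es sa mulrA.
have pm : p * m = m by rewrite /m !mulrA pe.
have em : e * m = m by rewrite /m !mulrA ee.
have me : m * e = m by rewrite /m -!mulrA ee.
have [l Hl] := sq _ mS ms pm.
(* the two excluded values of t are 0 and -l *)
have [t t0 tl] : exists2 t : R, 0 < t & - l < t.
  exists (`|l| + 1); first by rewrite ltr_wpDl.
  by have := ler_norm (- l); rewrite normrN; lra.
have [r1 Hr] : exists r : R, (m + (t%:C)%C *: e) ^+ 2 = (r%:C)%C *: (m + (t%:C)%C *: e).
  apply: sq; [by apply: inSD => //; exact: inSZ|by rewrite starD starRZ ms es|].
  by rewrite mulrDr pm -scalerAr pe.
have gen (a' b c d f : U) : a' + b + (b + c) = d + f -> a' + b + b - d = f - c.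
  move=> H; have -> : a' + b + b = d + f - c by rewrite -H !addrA addrK.
  by rewrite addrAC [d + f]addrC addrK.
have key : ((l + t + t - r1)%:C)%C *: m = ((r1 * t - t * t)%:C)%C *: e.
  move: Hr; rewrite expr2 mulrDl !mulrDr -expr2 Hl -!scalerAr -!scalerAl ee em me.
  rewrite [RHS]scalerDr => /gen.
  by rewrite !(rmorphB, rmorphD, rmorphM)/= !scalerBl !scalerDl !scalerA.
have [c0|c0] := eqVneq (l + t + t - r1) 0; last first.
  exists ((l + t + t - r1)^-1 * (r1 * t - t * t)).
  rewrite (rmorphM (real_complex R)) -scalerA -key scalerA.
  by rewrite -(rmorphM (real_complex R)) mulVf// rmorph1 scale1r.
have /eqP : ((r1 * t - t * t)%:C)%C *: e = 0 by rewrite -key c0 rmorph0 scale0r.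
rewrite scaler_eq0 => /orP[|/eqP//].
rewrite -(rmorph0 (real_complex R)) => /eqP/complexI/eqP.
rewrite -mulrBl mulf_eq0 => /orP[|] /eqP H.
  have : l + t + t - r1 + (r1 - t) = l + t by ring.
  by rewrite c0 H addr0 => lt0; move: tl; rewrite -subr_gt0 opprK addrC -lt0 ltxx.
by move: t0; rewrite H ltxx.
Qed.

(** Split, keep one piece and split the other. *)
Lemma orthogonal_family (N : nat) j : (forall e, ~ minimal_projection S e) ->
  sa_unit j -> exists k : nat -> U,
    (forall i, sa_unit (k i) /\ below (k i) j) /\
    (forall i l, (i < N)%N -> (l < N)%N -> i != l -> k i * k l = 0).
Proof.
move=> Hm; elim: N j => [|N IH] j Hj.
  by exists (fun=> j); split => // i; split => // g.
have [k0 [l0 [Hk0 Hl0 kl bk bl]]] : splits j.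
  by apply: contrapT => /(not_splits_minimal Hj)[e]; exact: Hm.
have [k [Hk Ho]] := IH l0 Hl0.
have k0k i : k0 * k i = 0 by apply: (below_orth (proj2 (Hk i))).
have kk0 i : k i * k0 = 0.
  have [[_ s1 _] _] := Hk i; have [_ s0 _] := Hk0.
  by rewrite -(starK (k i * k0)) starM s0 s1 k0k star0.
exists (fun i => if i is i'.+1 then k i' else k0); split.
  case=> [|i]; first by split.
  by split; [exact: (Hk i).1|move=> g /bl gl; exact: (Hk i).2].
by case=> [|i] [|l]//= iN lN il; exact: Ho.
Qed.

End Splitting.

(** * Norms of almost orthogonal sums *)

Section AlmostOrthogonalSums.
Variables (R : realType) (A : cstarAlgType R).
Local Notation U := (unitization A).
Implicit Types (u v a b p q : U).

(** Were the norm 1 + w with w > t, then squaring p + q, which up to t^2 / 2 is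
    p^2 + q^2, would at least double w; repeated squaring passes the bound 2. *)
Lemma unorm_sa_add p q (t : R) : star p = p -> star q = q ->
  unorm p <= 1 -> unorm q <= 1 -> 0 <= t -> unorm (p * q) <= t ^+ 2 / 4 ->
  unorm (p + q) <= 1 + t.
Proof.
move=> ps qs p1 q1 t0 pq; rewrite leNgt; apply/negP => H.
pose w := unorm (p + q) - 1.
have wt : t < w by rewrite /w ltrBrDl.
have w0 : 0 < w := le_lt_trans t0 wt.
have pqX k : unorm (p ^+ k.+1 * q ^+ k.+1) <= t ^+ 2 / 4.
  rewrite exprSr exprS mulrA -(mulrA _ p q) (le_trans (unormM _ _))//.
  rewrite -[leRHS]mulr1 ler_pM ?unorm_ge0//; last first.
    by rewrite (le_trans (unormX _ _))// exprn_ile1 ?unorm_ge0.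
  rewrite (le_trans (unormM _ _))// -[leRHS]mul1r ler_pM ?unorm_ge0//.
  by rewrite (le_trans (unormX _ _))// exprn_ile1 ?unorm_ge0.
have grow m : 1 + w * (2 ^ m)%:R <= unorm (p ^+ (2 ^ m) + q ^+ (2 ^ m)).
  elim: m => [|m IH]; first by rewrite !expr1 mulr1 /w addrC subrK.
  set K := (2 ^ m)%N in IH *.
  have K0 : (0 < K)%N by rewrite expn_gt0.
  have sK : star (p ^+ K + q ^+ K) = p ^+ K + q ^+ K by rewrite starD !starX ps qs.
  have pqK : unorm (p ^+ K * q ^+ K) <= t ^+ 2 / 4 by rewrite -(prednK K0).
  have qpK : unorm (q ^+ K * p ^+ K) <= t ^+ 2 / 4.
    by rewrite -unorm_star starM !starX ps qs.
  have e : (p ^+ K + q ^+ K) ^+ 2 = p ^+ (2 ^ m.+1) + q ^+ (2 ^ m.+1) +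
      (p ^+ K * q ^+ K + q ^+ K * p ^+ K).
    rewrite expr2 mulrDl !mulrDr -!exprD addnn -mul2n -expnS.
    by rewrite [X in _ + X]addrC addrACA.
  have : unorm (p ^+ K + q ^+ K) ^+ 2 <=
      unorm (p ^+ (2 ^ m.+1) + q ^+ (2 ^ m.+1)) + (t ^+ 2 / 4 + t ^+ 2 / 4).
    rewrite -unorm_sa// e (le_trans (unormD _ _))// lerD2l.
    by rewrite (le_trans (unormD _ _))// lerD.
  have K1 : 1 <= K%:R :> R by rewrite ler1n.
  have wk0 : w <= w * K%:R by rewrite ler_peMr// ltW.
  have n0 := unorm_ge0 (p ^+ K + q ^+ K).
  have : (1 + w * K%:R) ^+ 2 <= unorm (p ^+ K + q ^+ K) ^+ 2.
    by rewrite lerXn2r ?nnegrE//; lra.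
  have tw : t ^+ 2 <= (w * K%:R) ^+ 2 by rewrite lerXn2r ?nnegrE//; lra.
  have t2 := sqr_ge0 t.
  rewrite expnS natrM mulrCA -/K; move: (w * K%:R) tw => z tw; lra.
have two m : unorm (p ^+ m + q ^+ m) <= 2.
  rewrite (le_trans (unormD _ _))// (_ : 2 = 1 + 1)// lerD//.
    by rewrite (le_trans (unormX _ _))// exprn_ile1 ?unorm_ge0.
  by rewrite (le_trans (unormX _ _))// exprn_ile1 ?unorm_ge0.
pose m := (Num.truncn w^-1).+1.
have : w^-1 < (2 ^ m)%:R.
  by apply: (lt_trans (truncnS_gt _)); rewrite ltr_nat ltn_expl.
rewrite -(ltr_pM2l w0) mulfV ?gt_eqF//.
by have := le_trans (grow m) (two _); lra.
Qed.

(** Reduces to [unorm_sa_add] for a a^* and b b^* . *)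
Lemma unorm_add_orth a b (t : R) : a * star b = 0 -> unorm a <= 1 ->
  unorm b <= 1 -> 0 <= t -> unorm (star b * a) <= t ^+ 2 / 4 ->
  unorm (a + b) <= 1 + t.
Proof.
move=> ab a1 b1 t0 ba.
have ba0 : b * star a = 0 by rewrite -[b]starK -starM ab star0.
have : unorm (a + b) ^+ 2 <= 1 + t.
  rewrite -unorm_cstarr starD mulrDl !mulrDr ab ba0 addr0 add0r.
  have sq1 c : unorm c <= 1 -> unorm (c * star c) <= 1.
    by move=> c1; rewrite unorm_cstarr expr_le1// unorm_ge0.
  apply: unorm_sa_add; [by rewrite starM starK|by rewrite starM starK|
    exact: sq1|exact: sq1|by []|].
  rewrite mulrA -(mulrA a) (le_trans (unormM _ _))// unorm_star.
  rewrite -[leRHS]mulr1 ler_pM ?unorm_ge0// (le_trans (unormM _ _))//.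
  rewrite -[leRHS]mul1r ler_pM ?unorm_ge0// -unorm_star starM starK.
  exact: ba.
have n0 := unorm_ge0 (a + b).
move=> H; rewrite leNgt; apply/negP => H1.
have t2 := sqr_ge0 t; have : (1 + t) ^+ 2 < unorm (a + b) ^+ 2.
  by rewrite ltrXn2r ?nnegrE ?addr_ge0.
by move: H t2 t0; clear; move: (unorm _ ^+ 2) => z; lra.
Qed.

End AlmostOrthogonalSums.

(** * A Bessel inequality *)

Section Bessel.
Variables (R : realType) (A : cstarAlgType R) (S : realCstarAlg A).
Local Notation U := (unitization A).
Local Notation inS := (inS S).
Implicit Types (u v w x : U) (f : U -> R).

Definition contractive_functional f : Prop :=
  [/\ forall u v, inS u -> inS v -> f (u + v) = f u + f v,
      forall (r : R) u, inS u -> f ((r%:C)%C *: u) = r * f u &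
      forall u, inS u -> `|f u| <= unorm u].

(** Test f on w, the sum of the f(z_i) z_i: the norm of w is controlled through
    w w^* , where the cross terms vanish. *)
Lemma bessel f (z : nat -> U) (C : R) (N : nat) : contractive_functional f ->
  (forall i, inS (z i)) -> (forall i, unorm (z i) <= C) ->
  (forall i l, (i < N)%N -> (l < N)%N -> i != l -> z i * star (z l) = 0) ->
  \sum_(i < N) f (z i) ^+ 2 <= C ^+ 2.
Proof.
move=> [fD fZ fN] zS zC zo.
have C0 : 0 <= C := le_trans (unorm_ge0 _) (zC 0%N).
pose w := \sum_(i < N) ((f (z i))%:C)%C *: z i.
set s := \sum_(i < N) _.
have [wS fw] : inS w /\ f w = s.
  rewrite /w /s; elim/big_ind2: _ => [|u a v b [uS ua] [vS vb]|i _].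
  - have S0 : inS 0 by have := inSZ 0 (zS 0%N); rewrite scale0r.
    by split => //; have := fZ 0 _ S0; rewrite scaler0 mul0r.
  - by split; [exact: inSD|rewrite fD// ua vb].
  - by split; [exact: inSZ|rewrite fZ// expr2].
have s0 : 0 <= s by apply: sumr_ge0 => i _; exact: sqr_ge0.
have wN : unorm w ^+ 2 <= s * C ^+ 2.
  rewrite -unorm_cstarr.
  have -> : w * star w = \sum_(i < N) ((f (z i) ^+ 2)%:C)%C *: (z i * star (z i)).
    have -> : star w = \sum_(i < N) ((f (z i))%:C)%C *: star (z i).
      rewrite /w (big_morph _ (@starD _ A) (@star0 _ A)).
      by apply: eq_bigr => i _; exact: starRZ.
    rewrite /w mulr_suml; apply: eq_bigr => i _.
    rewrite mulr_sumr (bigD1 i)//= big1 => [|l li].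
      by rewrite addr0 -scalerAr -scalerAl scalerA -(rmorphM (real_complex R)) -expr2.
    by rewrite -scalerAr -scalerAl zo// ?scaler0// eq_sym.
  rewrite /s mulr_suml.
  elim/big_ind2: _ => [|u a v b ua vb|i _]; first by rewrite unorm0.
    by rewrite (le_trans (unormD _ _))// lerD.
  rewrite unormRZ ger0_norm ?sqr_ge0// ler_wpM2l ?sqr_ge0// unorm_cstarr.
  by rewrite lerXn2r ?nnegrE ?unorm_ge0.
have : s ^+ 2 <= s * C ^+ 2.
  rewrite (le_trans _ wN)// -fw -[leLHS]real_normK ?num_real//.
  by rewrite lerXn2r ?nnegrE ?unorm_ge0// fN.
rewrite expr2; have [->|sn0] := eqVneq s 0; first by rewrite sqr_ge0.
by rewrite ler_pM2l// lt_def sn0.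
Qed.

Lemma contractive_mull f x : contractive_functional f -> inS x -> unorm x <= 1 ->
  contractive_functional (fun u => f (x * u)).
Proof.
move=> [fD fZ fN] xS x1; split.
- by move=> u v uS vS; rewrite mulrDr fD//; exact: inSM.
- by move=> r u uS; rewrite -scalerAr fZ//; exact: inSM.
move=> u uS; rewrite (le_trans (fN _ _)) ?(le_trans (unormM _ _))//.
  exact: inSM.
by rewrite -[leRHS]mul1r ler_wpM2r ?unorm_ge0.
Qed.

Lemma contractive_star f : contractive_functional f ->
  contractive_functional (fun u => f (star u)).
Proof.
move=> [fD fZ fN]; split.
- by move=> u v uS vS; rewrite starD fD//; exact: inS_star.
- by move=> r u uS; rewrite starRZ fZ//; exact: inS_star.
by move=> u uS; rewrite -[leRHS]unorm_star fN//; exact: inS_star.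
Qed.

End Bessel.

(** * Slices without minimal projections *)

Section Slices.
Variables (R : realType) (A : cstarAlgType R) (S : realCstarAlg A).
Local Notation U := (unitization A).
Local Notation inS := (inS S).
Local Notation sa_unit := (sa_unit S).
Implicit Types (u v w x h g j : U) (f : U -> R).

(** The cut-offs at the two ends of the spectrum add up to a cut-off of |t|, whose
    norm is one, so one of them is nonzero. *)
Lemma spectral_end h (d : R) : sa_unit h -> 0 < d < 1 ->
  exists s g j, [/\ s = 1 \/ s = -1, sa_unit j, g * j = j &
    unorm (h * g - (s%:C)%C *: g) <= d].
Proof.
move=> [hS hs hN] /andP[d0 d1]; have [h1 _] := hS.
have hN1 : unorm h <= 1 by rewrite hN.
pose B (s t : R) := bump (1 - d / 2) (1 - d / 4) (s * t).
pose W (s t : R) := bump (1 - d) (1 - d / 2) (s * t).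
have alin (s : R) : approx (fun t => s * t).
  by apply: approxM; [exact: approx_cst|exact: approx_id].
have aW s : approx (W s) by exact: approx_bump.
have [u Hu] : exists u, fcalc h (fun t => bump (1 - d / 2) (1 - d / 4) `|t|) u.
  by apply: absbump_ex => //; apply/andP; split; lra.
have Bex s : exists u, fcalc h (B s) u.
  apply: fcalc_ex => //; first exact: approx_bump.
  by rewrite /B mulr0 bump0//; lra.
have [b Hb] := Bex 1; have [c Hc] := Bex (-1).
have uE : u = b + c.
  apply: (fcalc_uniq h1 hs hN1 Hu); apply: fcalc_ext (fcalcD Hb Hc) => t t1.
  rewrite /B mul1r mulN1r; have [t0|t0] := leP 0 t.
    by rewrite (ger0_norm t0) [X in _ + X]bump0 ?addr0//; lra.
  by rewrite (ltr0_norm t0) [X in X + _]bump0 ?add0r//; lra.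
have uN : unorm u = 1.
  apply: (fcalc_norm1 h1 hs hN1 (b := 1 - d / 4) hN _ Hu).
  - exact: approx_absbump.
  - by apply/andP; split; lra.
  - by move=> t _; exact: bump_itv.
  - by move=> t _ dt; rewrite bump1//; lra.
have [s [m [s1 Hm m0]]] : exists s m, [/\ s = 1 \/ s = -1, fcalc h (B s) m & m <> 0].
  have [b0|b0] := pselect (b = 0); last by exists 1, b; split => //; left.
  exists (-1), c; split => //; [by right|move=> c0].
  by move: uN; rewrite uE b0 c0 addr0 unorm0 => /esym/eqP; rewrite oner_eq0.
have [g Hg] : exists g, fcalc h (W s) g.
  by apply: fcalc_ex => //; rewrite /W mulr0 bump0//; lra.
have mS : inS m := fcalc_inS hS hs hN1 Hm.
have ms : star m = m := fcalc_star hs Hm.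
exists s, g, (((unorm m)^-1%:C)%C *: m); split => //.
- exact: normalize.
- rewrite -scalerAr; congr (_ *: _).
  apply: (fcalc_uniq h1 hs hN1 (fcalcM h1 hs hN1 _ Hg Hm)) => //.
  by apply: fcalc_ext Hm => t _; rewrite bumpM//; lra.
apply: (fcalc_norm h1 hs hN1 (fcalcB (fcalcM h1 hs hN1 _ (fcalc_id h1) Hg) (fcalcZ s Hg))).
  exact: approx_id.
move=> t; rewrite -ler_norml => t1; rewrite -mulrBl normrM.
have [w0 w1] := andP (bump_itv (1 - d) (1 - d / 2) (s * t)).
rewrite [`|W s t|]ger0_norm//.
have [st|st] := leP (s * t) (1 - d).
  by rewrite /W bump0 ?mulr0 ?(ltW d0)//; lra.
rewrite -[leRHS]mulr1 ler_pM//.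
by case: s1 st => ->; move: t1; rewrite !ler_norml => /andP[t1 t2] st;
  apply/andP; split; lra.
Qed.

(** The orthogonal pieces are taken below a cut-off g of h = x^* x on which h is
    nearly the constant s; g then acts as a unit on all of them. *)
Lemma plateau_family x (d : R) (N : nat) : (forall e, ~ minimal_projection S e) ->
  inS x -> unorm x = 1 -> 0 < d < 1 ->
  exists s (p q r : nat -> U), [/\ s = 1 \/ s = -1,
    forall i, [/\ sa_unit (p i), sa_unit (q i), sa_unit (r i),
      p i * q i = q i /\ q i * r i = r i & unorm (1 - p i) <= 1],
    forall i, unorm (star x * x * q i - (s%:C)%C *: q i) <= d &
    forall i l, (i < N)%N -> (l < N)%N -> i != l -> p i * p l = 0].
Proof.
move=> Hm xS xN d01; set h := star x * x.
have hS : sa_unit h.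
  split; first by apply: inSM => //; exact: inS_star.
    by rewrite /h starM starK.
  by rewrite /h unorm_cstar xN expr1n.
have [s [g [j [s1 Hj gj gd]]]] := spectral_end hS d01.
have [k [Hk Ho]] := orthogonal_family N Hm Hj.
have /choice[P HP] : forall i, exists P : U * U * U,
    [/\ sa_unit P.1.1, sa_unit P.1.2, sa_unit P.2,
      P.1.1 * P.1.2 = P.1.2 /\ P.1.2 * P.2 = P.2 &
      unorm (1 - P.1.1) <= 1 /\ below P.1.1 (k i)].
  move=> i; have [p [q [r [Hp Hq Hr e b]]]] := plateaus (Hk i).1.
  by exists (p, q, r).
exists s, (fun i => (P i).1.1), (fun i => (P i).1.2), (fun i => (P i).2).
split => //.
- by move=> i; have [Hp Hq Hr e [b _]] := HP i; split.
- move=> i; have [_ [_ _ qN] _ [pq _] [_ pk]] := HP i.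
  have gq : g * (P i).1.2 = (P i).1.2.
    by rewrite -pq mulrA; congr (_ * _); apply: pk; exact: (Hk i).2.
  rewrite -gq mulrA scalerAl -mulrBl (le_trans (unormM _ _))//.
  by rewrite qN mulr1.
move=> i l iN lN il.
have [[_ psi _] _ _ _ [_ pki]] := HP i; have [[_ psl _] _ _ _ [_ pkl]] := HP l.
have [[_ ks _] _] := Hk i.
have kp : k i * (P l).1.1 = 0 by apply: (below_orth pkl); exact: Ho.
rewrite -[LHS]starK starM psi psl.
rewrite (below_orth pki) ?star0//.
by rewrite -[LHS]starK starM ks psl kp star0.
Qed.

Lemma unorm_double u : unorm (u *+ 2) = 2 * unorm u.
Proof.
have -> : u *+ 2 = ((2 : R)%:C)%C *: u by rewrite rmorph_nat scaler_nat.
by rewrite unormRZ ger0_norm.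
Qed.

(** The square of the norm of x r is the norm of r h r, and h r is nearly s r. *)
Lemma unorm_mul_plateau x r (s d : R) : s = 1 \/ s = -1 ->
  star r = r -> unorm r = 1 -> 0 < d < 1 ->
  unorm (star x * x * r - (s%:C)%C *: r) <= d -> 1 - d <= unorm (x * r).
Proof.
move=> s1 rs rN /andP[d0 d1] Hd.
have n0 := unorm_ge0 (x * r).
have : 1 - d <= unorm (x * r) ^+ 2.
  rewrite -unorm_cstar starM rs.
  have -> : r * star x * (x * r) = (s%:C)%C *: r ^+ 2 +
      r * (star x * x * r - (s%:C)%C *: r).
    by rewrite mulrBr -scalerAr expr2 addrC subrK !mulrA.
  rewrite lerBlDr.
  have s2 : `|s| = 1 by case: s1 => ->; rewrite ?normrN normr1.
  have e1 : unorm ((s%:C)%C *: r ^+ 2) = 1.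
    by rewrite unormRZ s2 mul1r unorm_sa// rN expr1n.
  set a := (_ *: r ^+ 2) in e1 *; set b := r * _.
  have bd : unorm b <= d by rewrite (le_trans (unormM _ _))// rN mul1r.
  rewrite -e1 -[a in leLHS](addrK b) (le_trans (unormB _ _))// lerD2l.
  exact: bd.
move=> H; have [//|H1] := leP (1 - d) (unorm (x * r)).
have : unorm (x * r) ^+ 2 <= unorm (x * r) by rewrite expr2 ler_piMl//; lra.
lra.
Qed.

(** Take y = x q_0 - x q_1: it agrees with x on r_0 and with -x on r_1. *)
Lemma two_sided x (e : R) : (forall e, ~ minimal_projection S e) ->
  inS x -> unorm x = 1 -> 0 < e -> exists y, [/\ inS y, unorm y <= 1,
    2 - e <= unorm (x + y) & 2 - e <= unorm (x - y)].
Proof.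
move=> Hm xS xN e0; pose d := Num.min (e / 2) 2^-1.
have d0 : 0 < d by rewrite lt_min divr_gt0 ?invr_gt0 ?ltr0n.
have d2 : d <= 2^-1 by rewrite ge_min lexx orbT.
have de : d <= e / 2 by rewrite ge_min lexx.
have d01 : 0 < d < 1 by apply/andP; split; lra.
have [s [p [q [r [s1 H Hd Ho]]]]] := plateau_family 2 Hm xS xN d01.
have [[_ ps0 _] [qS0 qs0 qN0] [_ rs0 rN0] [pq0 qr0] _] := H 0%N.
have [[_ ps1 _] [qS1 qs1 qN1] [_ rs1 rN1] [pq1 qr1] _] := H 1%N.
have p01 : p 0%N * p 1%N = 0 by exact: Ho.
have p10 : p 1%N * p 0%N = 0 by exact: Ho.
have qp0 : q 0%N * p 0%N = q 0%N by rewrite -[LHS]starK starM qs0 ps0 pq0.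
have qp1 : q 1%N * p 1%N = q 1%N by rewrite -[LHS]starK starM qs1 ps1 pq1.
have q01 : q 0%N * q 1%N = 0 by rewrite -qp0 -pq1 mulrA -(mulrA (q _)) p01 mulr0 mul0r.
have q10 : q 1%N * q 0%N = 0 by rewrite -qp1 -pq0 mulrA -(mulrA (q _)) p10 mulr0 mul0r.
have hr i : unorm (star x * x * r i - (s%:C)%C *: r i) <= d.
  have [_ _ [_ _ rN] [_ qr] _] := H i.
  rewrite -qr mulrA scalerAl -mulrBl (le_trans (unormM _ _))// rN mulr1.
  exact: Hd.
have big i : 2 - e <= unorm (x * r i *+ 2).
  have [_ _ [_ rs rN] _ _] := H i.
  have := unorm_mul_plateau s1 rs rN d01 (hr i).
  rewrite unorm_double.
  by move=> Hx; lra.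
exists (x * (q 0%N - q 1%N)); split.
- by apply: inSM => //; exact: inSB.
- rewrite (le_trans (unormM _ _))// xN mul1r -[leRHS]addr0.
  apply: unorm_sa_add; rewrite ?starN ?unormN ?qs0 ?qs1 ?qN0 ?qN1//.
  by rewrite mulrN q01 oppr0 unorm0 expr0n/= mul0r.
- rewrite (le_trans (big 0%N))//.
  have -> : x * r 0%N *+ 2 = (x + x * (q 0%N - q 1%N)) * r 0%N.
    have q1r0 : q 1%N * r 0%N = 0 by rewrite -qr0 mulrA q10 mul0r.
    by rewrite mulrDl -mulrA mulrBl qr0 q1r0 subr0 mulr2n.
  by rewrite (le_trans (unormM _ _))// rN0 mulr1.
rewrite (le_trans (big 1%N))//.
have -> : x * r 1%N *+ 2 = (x - x * (q 0%N - q 1%N)) * r 1%N.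
  have q0r1 : q 0%N * r 1%N = 0 by rewrite -qr1 mulrA q01 mul0r.
  by rewrite mulrBl -mulrA mulrBl qr1 q0r1 sub0r mulrN opprK mulr2n.
by rewrite (le_trans (unormM _ _))// rN1 mulr1.
Qed.

(** The correction to y is u_i + x w_i with u_i ending in p_i and w_i beginning
    with p_i, so [bessel] applies to the u_i, and to the adjoints of the w_i with the
    functional f(x .). *)
Lemma slices x y f (e : R) : (forall e, ~ minimal_projection S e) ->
  inS x -> unorm x = 1 -> contractive_functional S f ->
  inS y -> unorm y <= 1 -> 0 < e ->
  exists z, [/\ inS z, unorm z <= 1, f y - e <= f z & 2 - e <= unorm (x + z)].
Proof.
move=> Hm xS xN Hf yS yN e0; pose t := Num.min (e / 4) 1.
have t0 : 0 < t by rewrite lt_min divr_gt0 ?ltr01.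
have t1 : t <= 1 by rewrite ge_min lexx orbT.
have te : t <= e / 4 by rewrite ge_min lexx.
have tt0 : 0 < t ^+ 2 by rewrite exprn_gt0.
have tt1 : t ^+ 2 <= t by rewrite expr2 ler_piMl// ltW.
(* twice d is the t^2 / 4 allowed by the almost orthogonal sum *)
pose d := t ^+ 2 / 8.
have d01 : 0 < d < 1 by rewrite /d; apply/andP; split; lra.
(* 10 = 3^2 + 1^2 is the total of the two Bessel sums below *)
pose N := (Num.truncn (10 / t ^+ 2)).+1.
have HN : 10 < N%:R * t ^+ 2 by rewrite -ltr_pdivrMr// truncnS_gt.
have [s [p [q [r [s1 H Hd Ho]]]]] := plateau_family N Hm xS xN d01.
set h := star x * x in Hd.
have hs : star h = h by rewrite /h starM starK.
have hS : inS h by apply: inSM => //; exact: inS_star.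
have hN : unorm h = 1 by rewrite /h unorm_cstar xN expr1n.
have hE : h = star x * x by [].
clearbody h; pose b i := x * p i * star x.
pose c i := b i ^+ 2.
have bs i : star (b i) = b i.
  by have [[_ ps _] _ _ _ _] := H i; rewrite /b !starM starK ps mulrA.
have bS i : inS (b i).
  have [[pS _ _] _ _ _ _] := H i.
  by apply: inSM; [exact: inSM|exact: inS_star].
have cS i : inS (c i) by rewrite /c expr2; exact: inSM.
have bN i : unorm (b i) <= 1.
  have [[_ _ pN] _ _ _ _] := H i.
  rewrite (le_trans (unormM _ _))// unorm_star xN mulr1.
  by rewrite (le_trans (unormM _ _))// xN pN mul1r.
have cN i : unorm (c i) <= 1.
  by rewrite (le_trans (unormX _ _))// exprn_ile1 ?unorm_ge0.
have c1N i : unorm (1 - c i) <= 1.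
  have -> : 1 - c i = ev (b i) (1 - 'X ^+ 2) by rewrite evB ev1 evXn evX.
  apply: ev_bound => //; first by case: (bS i).
  move=> a; rewrite -ler_norml => a1.
  rewrite hornerD hornerN hornerXn hornerC -[a ^+ 2]real_normK ?num_real//.
  have a2 : `|a| ^+ 2 <= 1 by rewrite expr_le1.
  have a3 := sqr_ge0 `|a|; rewrite ler_norml; apply/andP; split; lra.
pose u i := (c i * y - y + x * q i) * p i.
pose w i := - (p i * h * p i * star x * y).
have uS i : inS (u i).
  have [[pS _ _] [qS _ _] _ _ _] := H i.
  apply: inSM => //; apply: inSD; last exact: inSM.
  by apply: inSB => //; exact: inSM.
have wS i : inS (w i).
  have [[pS _ _] _ _ _ _] := H i; apply: inSN.
  by do !apply: inSM => //; exact: inS_star.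
have uN i : unorm (u i) <= 3.
  have [[_ _ pN] [_ _ qN] _ _ _] := H i.
  rewrite (le_trans (unormM _ _))// pN mulr1.
  rewrite (le_trans (unormD _ _))// [leRHS](_ : 3 = (1 + 1) + 1); last by ring.
  rewrite lerD//; last by rewrite (le_trans (unormM _ _))// xN qN mul1r.
  rewrite (le_trans (unormB _ _))// lerD// (le_trans (unormM _ _))//.
  by rewrite -[leRHS]mul1r ler_pM ?unorm_ge0.
have wN i : unorm (w i) <= 1.
  have [[_ _ pN] _ _ _ _] := H i.
  rewrite unormN (le_trans (unormM _ _))// -[leRHS]mul1r ler_pM ?unorm_ge0//.
  rewrite (le_trans (unormM _ _))// unorm_star xN mulr1.
  rewrite (le_trans (unormM _ _))// pN mulr1.
  by rewrite (le_trans (unormM _ _))// pN hN mul1r.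
have sum_u : \sum_(i < N) f (u i) ^+ 2 <= 3 ^+ 2.
  apply: (bessel Hf uS uN) => i l iN lN il.
  have [[_ ps _] _ _ _ _] := H l.
  by rewrite /u starM ps mulrA -(mulrA _ (p i)) Ho// mulr0 mul0r.
have xN1 : unorm x <= 1 by rewrite xN.
have Hg := contractive_star (contractive_mull Hf xS xN1).
have sum_w : \sum_(i < N) f (x * w i) ^+ 2 <= 1 ^+ 2.
  have := @bessel _ _ _ _ (fun i => star (w i)) 1 N Hg.
  under [X in _ -> _ -> _ -> X <= _]eq_bigr do rewrite starK.
  apply => [i|i|i l iN lN il]; [exact: inS_star|by rewrite unorm_star|].
  have [[_ ps _] _ _ _ _] := H i.
  rewrite starK /w starN mulrNN !starM starK ps hs.
  rewrite !mulrA -(mulrA _ (p i) (p l)) Ho//.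
  by rewrite !(mulr0, mul0r).
have [i iN fi] : exists2 i, (i < N)%N & f (u i) ^+ 2 + f (x * w i) ^+ 2 <= t ^+ 2.
  apply: contrapT => Hn.
  have : \sum_(i < N) (f (u i) ^+ 2 + f (x * w i) ^+ 2) <= 10.
    rewrite big_split /= [leRHS](_ : 10 = 3 ^+ 2 + 1 ^+ 2); last by ring.
    exact: lerD.
  apply/negP; rewrite -ltNge (lt_le_trans HN)//.
  rewrite mulr_natl -[X in _ *+ X]card_ord -sumr_const ler_sum// => i _.
  rewrite leNgt; apply/negP => Hi; apply: Hn; exists i => //; exact: ltW.
have fu : `|f (u i)| <= t.
  rewrite -ler_sqr ?nnegrE ?(ltW t0)// real_normK ?num_real//.
  by rewrite (le_trans _ fi)// lerDl sqr_ge0.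
have fw : `|f (x * w i)| <= t.
  rewrite -ler_sqr ?nnegrE ?(ltW t0)// real_normK ?num_real//.
  by rewrite (le_trans _ fi)// lerDr sqr_ge0.
have [[pS ps pN] [qS qs qN] [rS rs rN] [pq qr] p1N] := H i.
have qp : q i * p i = q i by rewrite -[LHS]starK starM qs ps pq.
have pr : p i * r i = r i by rewrite -qr mulrA pq.
pose a := (1 - c i) * y * (1 - p i).
pose z := y + u i + x * w i.
have zE : z = a + x * q i.
  have xw : x * w i = - (c i * y).
    by rewrite /w mulrN /c expr2 /b hE !mulrA.
  have e1 : u i = c i * y * p i - y * p i + x * q i.
    by rewrite /u mulrDl mulrBl -[x * q i * p i]mulrA qp.
  have e2 : a = y - c i * y - (y * p i - c i * y * p i).
    by rewrite /a mulrBl mul1r mulrBr mulr1 mulrBl.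
  rewrite /z xw e1 e2 opprB !addrA [LHS]addrAC; congr (_ + _).
  by rewrite [LHS]addrAC; congr (_ - _); rewrite addrAC.
have zS : inS z.
  by apply: inSD; [exact: inSD|exact: inSM].
have aN : unorm a <= 1.
  rewrite (le_trans (unormM _ _))// -[leRHS]mul1r ler_pM ?unorm_ge0//.
  by rewrite (le_trans (unormM _ _))// -[leRHS]mul1r ler_pM ?unorm_ge0.
have zN : unorm z <= 1 + t.
  rewrite zE; apply: unorm_add_orth => //.
  - have pq0 : (1 - p i) * q i = 0 by rewrite mulrBl mul1r pq subrr.
    by rewrite starM qs /a mulrA -(mulrA _ (1 - p i)) pq0 mulr0 mul0r.
  - by rewrite (le_trans (unormM _ _))// xN qN mul1r.
  - exact: ltW.
  (* replacing h by s twice in c x q = x p h p h q gives s^2 x q = x q *)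
  have E : (1 - c i) * (x * q i) = - (x * p i * h * p i * (h * q i - (s%:C)%C *: q i)
       + (s%:C)%C *: (x * p i * (h * q i - (s%:C)%C *: q i))).
    have ss : (s%:C)%C * (s%:C)%C = 1.
      by case: s1 => ->; rewrite -(rmorphM (real_complex R)) ?mulrNN mul1r rmorph1.
    rewrite !mulrBr -!scalerAr scalerBr scalerA ss scale1r.
    rewrite -[x * p i * q i]mulrA -[x * p i * h * p i * q i]mulrA pq.
    rewrite addrA -[x * p i * (h * q i)]/(x * p i * (h * q i)) [x * p i * (h * q i)]mulrA.
    rewrite subrK opprB mulrBl mul1r; congr (_ - _).
    by rewrite /c expr2 /b hE !mulrA.
  have -> : star (x * q i) * a = star ((1 - c i) * (x * q i)) * (y * (1 - p i)).
    rewrite [star ((1 - c i) * _)]starM starB star1 /c starX bs /a.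
    by rewrite !mulrA.
  rewrite (le_trans (unormM _ _))// unorm_star -[leRHS]mulr1.
  apply: ler_pM; rewrite ?unorm_ge0//; last first.
    by rewrite (le_trans (unormM _ _))// -[leRHS]mul1r ler_pM ?unorm_ge0.
  rewrite E unormN (le_trans (unormD _ _))// [leRHS](_ : _ = d + d); last first.
    by rewrite /d; field.
  have xp : unorm (x * p i) <= 1 by rewrite (le_trans (unormM _ _))// xN pN mul1r.
  have s2 : `|s| = 1 by case: s1 => ->; rewrite ?normrN normr1.
  rewrite unormRZ s2 mul1r lerD//.
    rewrite (le_trans (unormM _ _))// -[leRHS]mul1r ler_pM ?unorm_ge0//.
    rewrite (le_trans (unormM _ _))// pN mulr1.
    by rewrite (le_trans (unormM _ _))// hN mulr1.
  by rewrite (le_trans (unormM _ _))// -[leRHS]mul1r ler_pM ?unorm_ge0.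
have t10 : 0 < 1 + t by rewrite addr_gt0.
have it : 0 <= (1 + t)^-1 by rewrite invr_ge0 ltW.
have [fD fZ fN] := Hf.
have fz : f y - t - t <= f z.
  rewrite /z fD//; [|exact: inSD|exact: inSM]; rewrite fD//.
  move: fu fw; rewrite !ler_norml => /andP[fu _] /andP[fw _].
  by move: fu fw; move: (f y) (f (u i)) (f (x * w i)) => *; lra.
exists (((1 + t)^-1%:C)%C *: z); split.
- exact: inSZ.
- by rewrite unormRZ ger0_norm// ler_pdivrMl// mulr1.
- rewrite fZ// -ler_pdivrMl ?invr_gt0// invrK.
  have fy1 : `|f y| <= 1 by rewrite (le_trans (fN _ yS)).
  apply: le_trans fz; move: fy1; rewrite ler_norml => /andP[].
  clear -t0 t1 te; move: (f y) => k *.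
  have : 0 <= t * (1 - k) by rewrite mulr_ge0; lra.
  have : 0 <= t * (e - 4 * t) by rewrite mulr_ge0; lra.
  nra.
have hr : unorm (h * r i - (s%:C)%C *: r i) <= d.
  rewrite -qr mulrA scalerAl -mulrBl (le_trans (unormM _ _))// rN mulr1.
  exact: Hd.
rewrite hE in hr; have big := unorm_mul_plateau s1 rs rN d01 hr.
have : unorm (x * r i *+ 2) <= unorm (x + z).
  have -> : x * r i *+ 2 = (x + z) * r i.
    have pr0 : (1 - p i) * r i = 0 by rewrite mulrBl mul1r pr subrr.
    have ar : a * r i = 0 by rewrite /a -mulrA pr0 mulr0.
    by rewrite zE !mulrDl ar add0r -mulrA qr mulr2n.
  by rewrite (le_trans (unormM _ _))// rN mulr1.
rewrite unorm_double => big2.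
have : unorm (x + z) <= unorm (x + ((1 + t)^-1%:C)%C *: z) + t.
  have -> : x + z = (x + ((1 + t)^-1%:C)%C *: z) + ((t / (1 + t))%:C)%C *: z.
    rewrite -addrA -scalerDl -(rmorphD (real_complex R)).
    have -> : (1 + t)^-1 + t / (1 + t) = 1 by field; rewrite gt_eqF.
    by rewrite rmorph1 scale1r.
  rewrite (le_trans (unormD _ _))// lerD2l unormRZ ger0_norm; last first.
    by rewrite divr_ge0 ?ltW.
  by rewrite -mulrA ler_piMr ?(ltW t0)// ler_pdivrMl// mulr1.
move: big big2 d01; rewrite /d.
by move: (unorm (x * _)) (unorm (x + z)) (unorm (x + _)) => *; lra.
Qed.

End Slices.

(** * The norm near a minimal projection *)

Section MinimalProjections.
Variables (R : realType) (A : cstarAlgType R) (S : realCstarAlg A).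
Local Notation U := (unitization A).
Local Notation inS := (inS S).
Implicit Types (u v w x e : U) (a : R).

Variable e : U.
Hypothesis He : minimal_projection S e.

Lemma minimal_norm : unorm e = 1.
Proof.
have [eS es ee e0 _] := He; have n0 := inS_neq0 eS e0.
have : unorm e ^+ 2 = unorm e by rewrite -unorm_sa// expr2 ee.
rewrite expr2 -[RHS]mulr1 => /(mulfI _); apply; by rewrite gt_eqF.
Qed.

Lemma minimal_functional : exists phi : U -> R,
  (forall x, inS x -> e * (x + star x) * e = ((2 * phi x)%:C)%C *: e) /\
  (forall x, inS x -> `|phi x| <= unorm x).
Proof.
have [eS es ee e0 em] := He; have eN := minimal_norm.
have /choice[phi Hphi] : forall x, exists r : R, inS x ->
    e * (x + star x) * e = ((2 * r)%:C)%C *: e.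
  move=> x; have [xS|xS] := pselect (inS x); last by exists 0.
  have [|r ->] := em (x + star x) (inSD xS (inS_star xS)).
    by rewrite starD starK addrC.
  by exists (r / 2) => _; congr (((_)%:C)%C *: _); field.
exists phi; split=> // x xS.
have : unorm (e * (x + star x) * e) = 2 * `|phi x|.
  by rewrite (Hphi _ xS) unormRZ eN mulr1 normrM ger0_norm.
have : unorm (e * (x + star x) * e) <= unorm x + unorm x.
  rewrite (le_trans (unormM _ _))// eN mulr1 (le_trans (unormM _ _))// eN mul1r.
  by rewrite (le_trans (unormD _ _))// unorm_star.
lra.
Qed.

Variable phi : U -> R.
Hypothesis phiE : forall x, inS x -> e * (x + star x) * e = ((2 * phi x)%:C)%C *: e.
Hypothesis phiN : forall x, inS x -> `|phi x| <= unorm x.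

(** The squared norm of m = e + a x is that of m m^* = m e m^* + m (1 - e) m^* , and
    m (1 - e) = a x (1 - e) is of order a.  The same cut on the other side leaves
    k = e m e, for which k^* k is (1 + 2 a phi(x)) e up to a^2. *)
Lemma minimal_upper x a : inS x -> unorm x <= 1 -> `|a| <= 2^-1 ->
  unorm (e + (a%:C)%C *: x) <= 1 + a * phi x + 5 * a ^+ 2.
Proof.
move=> xS xN a2; have [eS es ee e0 _] := He; have eN := minimal_norm.
set m := e + _; pose e' := 1 - e.
have e'N : unorm e' <= 2.
  by rewrite (le_trans (unormB _ _))// eN lerD ?unorm1.
have e's : star e' = e' by rewrite starB star1 es.
have e'e' : e' * e' = e' by rewrite mulrBl mul1r mulrBr mulr1 ee subrr subr0.
have ee' : e * e' = 0 by rewrite mulrBr mulr1 ee subrr.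
have e'e : e' * e = 0 by rewrite mulrBl mul1r ee subrr.
have aa : `|a| ^+ 2 = a ^+ 2 by rewrite real_normK ?num_real.
have side y : unorm y <= 2 -> unorm ((a%:C)%C *: y) ^+ 2 <= 4 * a ^+ 2.
  move=> y2; rewrite unormRZ exprMn aa mulrC ler_wpM2r ?sqr_ge0//.
  have -> : 4 = 2 ^+ 2 :> R by ring.
  by rewrite lerXn2r ?nnegrE ?unorm_ge0.
have m1 : unorm m ^+ 2 <= unorm (m * e) ^+ 2 + 4 * a ^+ 2.
  rewrite -unorm_cstarr; have -> : m * star m = m * e * star (m * e) +
      m * e' * star (m * e').
    have cut c : star c = c -> c * c = c -> m * c * star (m * c) = m * c * star m.
      by move=> cs cc; rewrite starM cs mulrA -(mulrA m) cc.
    by rewrite !cut// -mulrDl -mulrDr /e' addrC subrK mulr1.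
  rewrite (le_trans (unormD _ _))// !unorm_cstarr lerD2l.
  rewrite /m mulrDl ee' add0r -scalerAl side//.
  by rewrite (le_trans (unormM _ _))// -[leRHS]mul1r ler_pM ?unorm_ge0.
have m2 : unorm (m * e) ^+ 2 <= unorm (e * m * e) ^+ 2 + 4 * a ^+ 2.
  rewrite -unorm_cstar; have -> : star (m * e) * (m * e) =
      star (e * m * e) * (e * m * e) + star (e' * m * e) * (e' * m * e).
    have cut c : star c = c -> c * c = c ->
        star (c * m * e) * (c * m * e) = star (m * e) * c * (m * e).
      by move=> cs cc; rewrite -(mulrA c) starM cs mulrA -(mulrA _ c c) cc.
    by rewrite !cut// -mulrDl -mulrDr /e' addrC subrK mulr1.
  rewrite (le_trans (unormD _ _))// !unorm_cstar lerD2l.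
  rewrite /m mulrDr mulrDl e'e mul0r add0r -scalerAr -scalerAl side//.
  rewrite (le_trans (unormM _ _))// eN mulr1.
  by rewrite (le_trans (unormM _ _))// -[leRHS]mulr1 ler_pM ?unorm_ge0.
have m3 : unorm (e * m * e) ^+ 2 <= `|1 + 2 * a * phi x| + a ^+ 2.
  have -> : e * m * e = e + (a%:C)%C *: (e * x * e).
    by rewrite /m mulrDr mulrDl ee ee -scalerAr -scalerAl.
  rewrite -unorm_cstar starD starRZ !starM es.
  have -> : (e + (a%:C)%C *: (e * (star x * e))) * (e + (a%:C)%C *: (e * x * e)) =
      ((1 + 2 * a * phi x)%:C)%C *: e +
      ((a ^+ 2)%:C)%C *: (e * star x * e * (e * x * e)).
    have -> : 1 + 2 * a * phi x = 1 + a * (2 * phi x) by ring.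
    move: (2 * phi x) (phiE xS) => k xk.
    rewrite mulrDl !mulrDr ee -!scalerAr -!scalerAl scalerA.
    rewrite -(rmorphM (real_complex R)) -expr2 !mulrA ee addrA; congr (_ + _).
    rewrite -[_ * e * e]mulrA ee rmorphD rmorph1 scalerDl scale1r -addrA.
    congr (_ + _); rewrite (rmorphM (real_complex R) a) -scalerA -xk mulrDr.
    by rewrite mulrDl scalerDr.
  rewrite (le_trans (unormD _ _))// !unormRZ eN mulr1 lerD2l.
  rewrite [`|a ^+ 2|]ger0_norm ?sqr_ge0// -[leRHS]mulr1 ler_wpM2l ?sqr_ge0//.
  have exe y : unorm y <= 1 -> unorm (e * y * e) <= 1.
    move=> y1; rewrite (le_trans (unormM _ _))// eN mulr1.
    by rewrite (le_trans (unormM _ _))// eN mul1r.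
  rewrite (le_trans (unormM _ _))// -[leRHS]mul1r ler_pM ?unorm_ge0 ?exe//.
  by rewrite unorm_star.
have p1 : `|a * phi x| <= `|a|.
  by rewrite normrM ler_piMr// (le_trans (phiN xS)).
have n0 := unorm_ge0 m.
move: p1; rewrite ler_norml => /andP[p1 p2].
have p3 : 0 <= 1 + 2 * a * phi x by rewrite -mulrA; move: p1 a2; move: (a * _) => *; lra.
move: m3; rewrite (ger0_norm p3) => m3.
have H : unorm m ^+ 2 <= 1 + 2 * (a * phi x) + 9 * a ^+ 2 by rewrite mulrA; lra.
have q0 := sqr_ge0 a.
have r0 : 0 <= 1 + a * phi x + 5 * a ^+ 2.
  by move: p1 a2; move: (a * phi x) => k *; lra.
rewrite -ler_sqr ?nnegrE// (le_trans H)//.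
move: (a * phi x) => k.
have := sqr_ge0 (k + 5 * a ^+ 2); lra.
Qed.

(** Convexity: the norms at a and -a add up to at least 2. *)
Lemma minimal_lower x a : inS x -> unorm x <= 1 -> `|a| <= 2^-1 ->
  1 + a * phi x - 5 * a ^+ 2 <= unorm (e + (a%:C)%C *: x).
Proof.
move=> xS xN a2; have eN := minimal_norm.
have Na : `|- a| <= 2^-1 by rewrite normrN.
have := minimal_upper xS xN Na; rewrite sqrrN mulNr.
have : 2 <= unorm (e + (a%:C)%C *: x) + unorm (e + ((- a)%:C)%C *: x).
  have <- : unorm (e *+ 2) = 2 by rewrite unorm_double eN mulr1.
  have -> : e *+ 2 = (e + (a%:C)%C *: x) + (e + ((- a)%:C)%C *: x).
    by rewrite addrACA -scalerDl -(rmorphD (real_complex R)) subrr rmorph0 scale0r addr0 mulr2n.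
  exact: unormD.
move: (a * phi x) => k; move: (unorm _) (unorm _) => *; lra.
Qed.

End MinimalProjections.

(** * Roughness and Frechet smoothness *)

Section Smoothness.
Variables (R : realType) (A : cstarAlgType R) (S : realCstarAlg A).
Local Notation U := (unitization A).
(* V is S as an abstract real normed space, and io its embedding in the
   unitization; this covers the realification of A and the spaces of real
   subalgebras. *)
Variables (V : normedModType R) (io : V -> U).
Hypotheses (ioD : forall x y, io (x + y) = io x + io y)
  (ioZ : forall (a : R) x, io (a *: x) = (a%:C)%C *: io x)
  (ioN : forall x, unorm (io x) = `|x|)
  (ioS : forall x, inS S (io x))
  (io_onto : forall u, inS S u -> exists v, io v = u).
Implicit Types (x y z u v h : V).

Lemma io_opp x : io (- x) = - io x.
Proof. by rewrite -scaleN1r ioZ rmorphN1 scaleN1r. Qed.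

Lemma ioB x y : io (x - y) = io x - io y.
Proof. by rewrite ioD io_opp. Qed.

Lemma io_inj : injective io.
Proof.
move=> x y xy; apply/eqP; rewrite -subr_eq0 -normr_eq0 -ioN ioB xy subrr.
by rewrite unorm0.
Qed.

Definition no_minimal : Prop := forall e, ~ minimal_projection S e.

Lemma two_sided_space u (e : R) : no_minimal -> `|u| = 1 -> 0 < e ->
  exists v, [/\ `|v| <= 1, 2 - e <= `|u + v| & 2 - e <= `|u - v|].
Proof.
move=> Hm u1 e0; have uN : unorm (io u) = 1 by rewrite ioN.
have [y [yS yN H1 H2]] := two_sided Hm (ioS u) uN e0.
have [v vy] := io_onto yS; exists v.
by rewrite -!ioN ioD ioB vy.
Qed.

Lemma unorm_shrink u v (t : R) : `|v| <= 1 -> 0 <= t <= 1 ->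
  `|u + v| - (1 - t) <= `|u + t *: v|.
Proof.
move=> v1 /andP[t0 t1].
have -> : u + v = u + t *: v + (1 - t) *: v.
  by rewrite -addrA -scalerDl [t + _]addrC subrK scale1r.
rewrite lerBlDr (le_trans (ler_normD _ _))// lerD2l normrZ ger0_norm ?subr_ge0//.
by rewrite ler_piMr// subr_ge0.
Qed.

(** The vector nearly at distance 2 from u and -u may depend on t, which lets the
    error be a small multiple of t. *)
Lemma two_sided_small u (t e : R) : no_minimal -> `|u| = 1 -> 0 < t <= 1 ->
  0 < e < 1 -> exists v, [/\ v != 0, `|v| <= 1 &
    2 + t * (2 - e) <= `|u + t *: v| + `|u - t *: v|].
Proof.
move=> Hm u1 /andP[t0 t1] /andP[e0 e1].
have te : 0 < t * e / 2 by rewrite divr_gt0// mulr_gt0.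
have [v [v1 H1 H2]] := two_sided_space Hm u1 te.
have te1 : t * e <= 1 by rewrite -[leRHS]mulr1 ler_pM// ltW.
exists v; split => //.
  apply/eqP => v0; move: H1; rewrite v0 addr0 u1; lra.
have t01 : 0 <= t <= 1 by rewrite (ltW t0).
have G1 := unorm_shrink u v1 t01.
have Nv1 : `|- v| <= 1 by rewrite normrN.
have G2 := unorm_shrink u Nv1 t01; rewrite scalerN in G2.
lra.
Qed.

Lemma no_minimal_rough : no_minimal -> extremely_rough V.
Proof.
move=> Hm u u1; apply: le_ereal_inf_tmp => _ [W W0 <-].
move: W0; rewrite /dnbhs /within /= => /nbhs_ballP[d /= d0 HW].
apply/lee_addgt0Pr => e0 e00.
pose e := Num.min e0 2^-1.
have e1 : 0 < e < 1.
  rewrite lt_min e00 invr_gt0 ltr0n /=.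
  by rewrite (@le_lt_trans _ _ 2^-1) ?ge_min ?lexx ?orbT// invf_lt1 ?ltr1n.
pose t := Num.min (d / 2) 1.
have t01 : 0 < t <= 1 by rewrite lt_min divr_gt0// ltr01 /= ge_min lexx orbT.
have [v [v0 v1 H]] := two_sided_small Hm u1 t01 e1.
have [t0 t1] := andP t01.
have h0 : t *: v != 0 by rewrite scaler_eq0 negb_or v0 gt_eqF.
have Wh : W (t *: v).
  apply: HW => //; rewrite -ball_normE /= sub0r normrN normrZ gtr0_norm//.
  apply: (@le_lt_trans _ _ t); first by rewrite ler_piMr// ltW.
  apply: (@le_lt_trans _ _ (d / 2)); first by rewrite ge_min lexx.
  by rewrite ltr_pdivrMr//; lra.
apply: (@le_trans _ _ ((2 - e)%:E + e0%:E)%E).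
  rewrite -EFinD lee_fin.
  have : e <= e0 by rewrite ge_min lexx.
  lra.
rewrite leeD2r//.
apply: (@le_trans _ _ ((`|u + t *: v| + `|u - t *: v| - 2) / `|t *: v|)%:E); last first.
  by apply: ereal_sup_ubound; exists (t *: v).
rewrite lee_fin ler_pdivlMr ?normr_gt0//.
have nt : `|t *: v| <= t by rewrite normrZ gtr0_norm// ler_piMr// ltW.
have e2 : 0 <= 2 - e by case/andP: e1 => *; lra.
have : (2 - e) * `|t *: v| <= (2 - e) * t by rewrite ler_wpM2l.
lra.
Qed.

Lemma frechet_smoothE u (l : V -> R) :
  ({uniform @unit_ball R V,
      (fun (a : R) x => (`|u + a *: x| - 1) / a) @ (0 : R)^' --> l}) <->
  (forall e : R, 0 < e -> exists2 d : R, 0 < d &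
     forall a x, `|a| < d -> a != 0 -> `|x| <= 1 ->
       `|l x - (`|u + a *: x| - 1) / a| < e).
Proof.
split=> [H e e0|H].
- have /H : nbhs (l : {uniform` @unit_ball R V -> R})
      [set g | forall x, unit_ball x -> ball (l x) e (g x)].
    apply/uniform_nbhs; exists [set xy | ball xy.1 e xy.2]; split => //.
    exact: (entourage_ball R (PosNum e0)).
  rewrite /= /nbhs /= /dnbhs /within /= => /nbhs_ballP[d /= d0 Hd].
  exists d => // a x ad a0 x1.
  have := Hd a; rewrite -ball_normE /= sub0r normrN => /(_ ad a0 x x1).
  exact.
move=> P /uniform_nbhs[E [+ EP]]; rewrite -entourage_from_ballE => -[e /= e0 He].
have [d d0 Hd] := H e e0.
rewrite /= /nbhs /= /dnbhs /within /=; apply/nbhs_ballP; exists d => //= a.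
rewrite -ball_normE /= sub0r normrN => ad a0; apply: EP => x /= x1.
by apply: He; rewrite -ball_normE /=; exact: Hd.
Qed.

Lemma no_minimal_nowhere_smooth : no_minimal -> nowhere_frechet_smooth V.
Proof.
move=> Hm u u1 [l /frechet_smoothE Hl].
have e0 : 0 < (4^-1 : R) by rewrite invr_gt0 ltr0n.
have [d d0 Hd] := Hl _ e0.
pose t := Num.min (d / 2) 1.
have t01 : 0 < t <= 1 by rewrite lt_min divr_gt0// ltr01 /= ge_min lexx orbT.
have e1 : 0 < (2^-1 : R) < 1 by rewrite invr_gt0 ltr0n invf_lt1 ?ltr1n.
have [v [v0 v1 H]] := two_sided_small Hm u1 t01 e1.
have [t0 t1] := andP t01.
have td : t < d.
  apply: (@le_lt_trans _ _ (d / 2)); first by rewrite ge_min lexx.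
  by rewrite ltr_pdivrMr//; lra.
have ntd : `|t| < d by rewrite gtr0_norm.
have ntd' : `|- t| < d by rewrite normrN.
have tn0 : t != 0 by rewrite gt_eqF.
have tn0' : - t != 0 by rewrite oppr_eq0.
have := Hd t v ntd tn0 v1; have := Hd (- t) v ntd' tn0' v1.
rewrite scaleNr !ltr_norml => /andP[_ G1] /andP[G2 _].
have : (`|u + t *: v| - 1) / t - (`|u - t *: v| - 1) / (- t) < 2^-1 by lra.
have -> : (`|u + t *: v| - 1) / t - (`|u - t *: v| - 1) / (- t) =
   (`|u + t *: v| + `|u - t *: v| - 2) / t by field.
rewrite ltr_pdivrMr// => G.
have : 0 < t * 1 by rewrite mulr1.
lra.
Qed.

(** Bound x - u by the norms of u - x / 10, which the expansion makes smaller than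
    1, and of (9 / 10) x. *)
Lemma far_from_smooth_point u (phi : V -> R) :
  (forall x (a : R), `|x| <= 1 -> `|a| <= 2^-1 ->
     `|u + a *: x| <= 1 + a * phi x + 5 * a ^+ 2) ->
  forall x, `|x| <= 1 -> 19 / 20 <= phi x -> `|x - u| < 19 / 10.
Proof.
move=> H x x1 px.
have a1 : `|- (10^-1 : R)| <= 2^-1.
  by rewrite normrN ger0_norm ?invr_ge0// lef_pV2 ?posrE ?ler_nat ?ltr0n.
have := H x _ x1 a1.
have : `|x - u| <= `|u + - 10^-1 *: x| + `|(9 / 10) *: x|.
  rewrite -[`|u + _|]normrN; have -> : x - u = - (u + - 10^-1 *: x) + (9 / 10) *: x.
    rewrite opprD scaleNr opprK -addrA -scalerDl addrC.
    have -> : 10^-1 + 9 / 10 = 1 :> R by field.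
    by rewrite scale1r.
  exact: ler_normD.
rewrite normrZ ger0_norm; last by lra.
lra.
Qed.

Lemma minimal_space e : minimal_projection S e -> exists u (phi : V -> R),
  [/\ io u = e, `|u| = 1,
      forall x, e * (io x + star (io x)) * e = ((2 * phi x)%:C)%C *: e,
      forall x, `|phi x| <= `|x| &
      forall x (a : R), `|x| <= 1 -> `|a| <= 2^-1 ->
        1 + a * phi x - 5 * a ^+ 2 <= `|u + a *: x| <= 1 + a * phi x + 5 * a ^+ 2].
Proof.
move=> He; have [eS _ _ _ _] := He; have [u ue] := io_onto eS.
have [phi [phiE phiN]] := minimal_functional He.
exists u, (phi \o io); split => //.
- by rewrite -ioN ue (minimal_norm He).
- by move=> x; rewrite /= phiE.
- by move=> x; rewrite -ioN /= phiN.
move=> x a x1 a1; rewrite -ioN ioD ioZ ue /=.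
have xN : unorm (io x) <= 1 by rewrite ioN.
by rewrite (minimal_lower He phiE phiN)//= (minimal_upper He phiE phiN).
Qed.

Lemma minimal_not_rough e : minimal_projection S e -> ~ extremely_rough V.
Proof.
move=> /minimal_space[u [phi [_ u1 _ _ H]]] /(_ u u1); apply/negP; rewrite -ltNge.
apply: (@le_lt_trans _ _ 1%:E); last by rewrite lte_fin ltr1n.
pose W := [set h : V | `|h| <= 10^-1 /\ h != 0].
apply: (@le_trans _ _ (ereal_sup [set ((`|u + h| + `|u - h| - 2) / `|h|)%:E | h in W])).
  apply: ereal_inf_lbound; exists W => //.
  rewrite /dnbhs /within /=; apply/nbhs_ballP; exists (10^-1) => /=.
    by rewrite invr_gt0 ltr0n.
  by move=> h; rewrite -ball_normE /= sub0r normrN => /ltW.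
apply: ge_ereal_sup => _ [h [hN h0] <-]; rewrite lee_fin.
have nh : 0 < `|h| by rewrite normr_gt0.
rewrite ler_pdivrMr// mul1r.
pose x := `|h|^-1 *: h.
have x1 : `|x| <= 1 by rewrite normrZ ger0_norm ?invr_ge0// mulVf ?gt_eqF.
have hx : h = `|h| *: x by rewrite scalerA mulfV ?gt_eqF// scale1r.
have ha : `| `|h| | <= 2^-1.
  by rewrite normr_id (le_trans hN)// lef_pV2 ?posrE ?ler_nat ?ltr0n.
have ha' : `| - `|h| | <= 2^-1 by rewrite normrN.
have /andP[_ H1] := H x _ x1 ha; have /andP[_ H2] := H x _ x1 ha'.
move: H1 H2; rewrite scaleNr -hx mulNr sqrrN.
have : `|h| ^+ 2 <= `|h| * 10^-1 by rewrite expr2 ler_wpM2l.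
move: (`|h| * phi x) => k; lra.
Qed.

Lemma minimal_not_nowhere_smooth e : minimal_projection S e ->
  ~ nowhere_frechet_smooth V.
Proof.
move=> /minimal_space[u [phi [_ u1 _ _ H]]] /(_ u u1); apply; exists phi.
apply/frechet_smoothE => d d0; pose b := Num.min (d / 6) 2^-1.
exists b; first by rewrite lt_min divr_gt0// invr_gt0 ltr0n.
move=> a x ab a0 x1.
have ad : `|a| < d / 6 by apply: (lt_le_trans ab); rewrite ge_min lexx.
have a2 : `|a| <= 2^-1 by apply: (le_trans (ltW ab)); rewrite ge_min lexx orbT.
have na : 0 < `|a| by rewrite normr_gt0.
have /andP[H1 H2] := H x a x1 a2.
have -> : phi x - (`|u + a *: x| - 1) / a = (1 + a * phi x - `|u + a *: x|) / a.
  by field.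
rewrite normrM normfV ltr_pdivrMr//.
apply: (@le_lt_trans _ _ (5 * a ^+ 2)).
  by rewrite ler_norml; apply/andP; split; lra.
rewrite -[a ^+ 2]real_normK ?num_real// expr2 mulrA ltr_pM2r//; lra.
Qed.

End Smoothness.

(** * Operator norms *)

Section OperatorNorm.

Lemma supremumE d (T : porderType d) (x0 s : T) (E : set T) :
  E !=set0 -> supremums E s -> supremum x0 E = s.
Proof.
move=> /set0P/negPf E0 Es; rewrite /supremum E0.
by apply: xget_subset1 => //; exact: is_subset1_supremums.
Qed.

(** The real-valued form of the operator norm, common to both scalar fields. *)
Definition op_value (R : realType) (B : Type) (nrm : B -> R) (T : B -> B) (M : R) :=
  (forall x, nrm x <= 1 -> nrm (T x) <= M) /\
  (forall e, 0 < e -> exists2 x, nrm x <= 1 & M - e <= nrm (T x)).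

Lemma op_value_ex (R : realType) (B : Type) (nrm : B -> R) (T : B -> B) (x0 : B) (C : R) :
  nrm x0 <= 1 -> (forall x, nrm x <= 1 -> nrm (T x) <= C) ->
  exists M, op_value nrm T M.
Proof.
move=> x01 TC; pose E := [set nrm (T x) | x in [set x | nrm x <= 1]].
have hE : has_sup E.
  split; first by exists (nrm (T x0)), x0.
  by exists C => _ [x /= x1 <-]; exact: TC.
exists (sup E); split => [x x1|e e0].
  by apply: ub_le_sup; [case: hE|exists x].
have [_ [x /= x1 <-] H] := sup_adherent e0 hE.
by exists x => //; exact: ltW.
Qed.

Lemma opnorm_real (R : realType) (V : normedModType R) (T : V -> V) (M : R) :
  op_value (fun x : V => `|x|) T M -> opnorm T = M.
Proof.
move=> [TM TE]; apply: supremumE.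
  by exists `|T 0|, 0 => //; rewrite /unit_ball /= normr0 ler01.
split => [_ [x x1 <-]|b Hb]; first exact: TM.
apply/ler_addgt0Pr => e /TE[x x1 H].
by rewrite -lerBlDr (le_trans H)//; apply: Hb; exists x.
Qed.

(** An upper bound of a set of norms in R[i] is itself a nonnegative real. *)
Lemma opnorm_complex (R : realType) (A : cstarAlgType R) (T : A -> A) (M : R) :
  op_value (@rnorm R A) T M -> opnorm T = (M%:C)%C.
Proof.
have ballE (x : A) : unit_ball x <-> rnorm x <= 1.
  by rewrite /unit_ball /= -rnormE -(rmorph1 (real_complex R)) lecR.
move=> [TM TE]; apply: supremumE.
  by exists `|T 0|, 0 => //; apply/ballE; rewrite rnorm0 ler01.
split => [_ [x /ballE x1 <-]|b Hb]; first by rewrite -rnormE lecR TM.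
have b0 : 0 <= b.
  apply: (le_trans (normr_ge0 (T 0))); apply: Hb; exists 0 => //.
  by apply/ballE; rewrite rnorm0 ler01.
rewrite -(RRe_real (ger0_real b0)) lecR.
apply/ler_addgt0Pr => e /TE[x x1 H].
rewrite -lerBlDr (le_trans H)// -lecR rnormE (RRe_real (ger0_real b0)).
by apply: Hb; exists x => //; apply/ballE.
Qed.

End OperatorNorm.

(** * The Daugavet property *)

Section Daugavet.
Variables (R : realType) (A : cstarAlgType R) (S : realCstarAlg A).
Local Notation U := (unitization A).
Variables (V : normedModType R) (io : V -> U).
Hypotheses (ioD : forall x y, io (x + y) = io x + io y)
  (ioZ : forall (a : R) x, io (a *: x) = (a%:C)%C *: io x)
  (ioN : forall x, unorm (io x) = `|x|)
  (ioS : forall x, inS S (io x))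
  (io_onto : forall u, inS S u -> exists v, io v = u).
Implicit Types (x y z u v h : V).

Lemma slices_space u y (f : V -> R) (e : R) : no_minimal S -> `|u| = 1 ->
  (forall x z, f (x + z) = f x + f z) -> (forall (a : R) x, f (a *: x) = a * f x) ->
  (forall x, `|f x| <= `|x|) -> `|y| <= 1 -> 0 < e ->
  exists z, [/\ `|z| <= 1, f y - e <= f z & 2 - e <= `|u + z|].
Proof.
move=> Hm u1 fD fZ fN y1 e0; have inj := io_inj ioD ioZ ioN.
have /choice[g Hg] : forall w : U, exists v, inS S w -> io v = w.
  move=> w; have [wS|wS] := pselect (inS S w); last by exists 0.
  by have [v vw] := io_onto wS; exists v.
have gio x : g (io x) = x by apply: inj; rewrite Hg.
have Hf : contractive_functional S (f \o g).
  split=> [v w vS wS|a v vS|v vS] /=.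
  - by rewrite -fD; congr f; apply: inj; rewrite ioD !Hg//; exact: inSD.
  - by rewrite -fZ; congr f; apply: inj; rewrite ioZ !Hg//; exact: inSZ.
  - by rewrite -[in leRHS](Hg v vS) ioN.
have uN : unorm (io u) = 1 by rewrite ioN.
have yN : unorm (io y) <= 1 by rewrite ioN.
have [z [zS zN fz xz]] := slices Hm (ioS u) uN Hf (ioS y) yN e0.
have [v vz] := io_onto zS; exists v.
by rewrite -!ioN ioD vz; split => //; move: fz; rewrite /= gio -vz gio.
Qed.

(** On the slice of the ball where rho is close to l, T is close to the constant
    l u.  By [slices_space] some z of that slice has u + z of norm almost 2; then
    z + T z is close to z + l u, whose norm is almost 1 + l.  The quadratic hypothesis controls the
    distance of T z to l u through the real part rho alone, so that it serves
    real and complex T. *)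
Lemma daugavet_lower (T : V -> V) u (rho : V -> R) (l : R) : no_minimal S ->
  `|u| = 1 -> 0 < l ->
  (forall x z, rho (x + z) = rho x + rho z) ->
  (forall (a : R) x, rho (a *: x) = a * rho x) ->
  (forall x, `|rho x| <= l * `|x|) ->
  (forall x, `|x| <= 1 -> `|T x - l *: u| ^+ 2 <= 2 * l * (l - rho x)) ->
  (forall e, 0 < e -> exists2 x, `|x| <= 1 & l * (1 - e) <= rho x) ->
  forall e, 0 < e -> exists2 x, `|x| <= 1 & 1 + l - e <= `|x + T x|.
Proof.
move=> Hm u1 l0 rD rZ rN Tl rE e e0.
pose c := 3 * l + 1; have c0 : 0 < c by rewrite addr_gt0// mulr_gt0.
pose t := Num.min (e / c) 1.
have t0 : 0 < t by rewrite lt_min divr_gt0// ltr01.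
have t1 : t <= 1 by rewrite ge_min lexx orbT.
have tc : t * c <= e by rewrite -ler_pdivlMr// ge_min lexx.
pose k := t ^+ 2 / 2; have k0 : 0 < k by rewrite divr_gt0// exprn_gt0.
have kt : k <= t / 2.
  by rewrite ler_pM2r ?invr_gt0// expr2 ler_piMl// ltW.
have [y y1 Hy] := rE _ k0.
pose f x := l^-1 * rho x.
have [z [z1 fz Hz]] : exists z, [/\ `|z| <= 1, f y - k <= f z & 2 - k <= `|u + z|].
  apply: slices_space => //.
  - by move=> x w; rewrite /f rD mulrDr.
  - by move=> a x; rewrite /f rZ mulrCA.
  - by move=> x; rewrite /f normrM gtr0_norm ?invr_gt0// ler_pdivrMl.
exists z => //.
have ry : 1 - k <= f y by rewrite /f ler_pdivlMl.
have rz : l * (1 - k - k) <= rho z.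
  by rewrite -ler_pdivlMl//; apply: (le_trans _ fz); rewrite lerD2r.
have Tz : `|T z - l *: u| <= 2 * l * t.
  have lt0 : 0 <= 2 * l * t by rewrite !mulr_ge0// ltW.
  rewrite -ler_sqr ?nnegrE// (le_trans (Tl z z1))//.
  have : 2 * l * (l - rho z) <= 2 * l * (l * (k + k)).
    by rewrite ler_pM2l ?mulr_gt0//; lra.
  move=> /le_trans; apply.
  have -> : 2 * l * (l * (k + k)) = 2 * (l * t) ^+ 2 by rewrite /k; field.
  have -> : (2 * l * t) ^+ 2 = 4 * (l * t) ^+ 2 by ring.
  by rewrite ler_wpM2r ?sqr_ge0// ler_nat.
have zl : 1 + l - k * (1 + l) <= `|z + l *: u|.
  have [l1|l1] := leP l 1.
    have l01 : 0 <= l <= 1 by rewrite ltW.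
    have u1' : `|u| <= 1 by rewrite u1.
    have := @unorm_shrink _ _ z u l u1' l01.
    have : 0 <= k * l by rewrite mulr_ge0// ltW.
    move: Hz; rewrite [u + z]addrC; lra.
  have -> : z + l *: u = l *: (u + z) - (l - 1) *: z.
    by rewrite scalerDr scalerBl scale1r opprB [z - _]addrC addrA addrK addrC.
  have := lerB_dist (l *: (u + z)) ((l - 1) *: z).
  rewrite !normrZ (gtr0_norm l0) gtr0_norm ?subr_gt0//.
  have : (l - 1) * `|z| <= l - 1 by rewrite ler_piMr// subr_ge0 ltW.
  have : l * (2 - k) <= l * `|u + z| by rewrite ler_pM2l.
  lra.
have := lerB_dist (z + l *: u) (l *: u - T z).
rewrite opprB [T z - _]addrC addrA addrK distrC.
have : k * (1 + l) <= t / 2 * (1 + l) by rewrite ler_wpM2r// addr_ge0// ltW.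
have : 0 < t * l by rewrite mulr_gt0.
rewrite /c in tc; lra.
Qed.

End Daugavet.

Section RealDaugavet.
Variables (R : realType) (A : cstarAlgType R) (S : realCstarAlg A).
Local Notation U := (unitization A).
Variables (V : normedModType R) (io : V -> U).
Hypotheses (ioD : forall x y, io (x + y) = io x + io y)
  (ioZ : forall (a : R) x, io (a *: x) = (a%:C)%C *: io x)
  (ioN : forall x, unorm (io x) = `|x|)
  (ioS : forall x, inS S (io x))
  (io_onto : forall u, inS S u -> exists v, io v = u).
Implicit Types (x y z u v h : V).

Lemma no_minimal_daugavet_real : no_minimal S -> daugavet V.
Proof.
move=> Hm T bT [y y0 Ty].
have [C HC] : exists C : R, forall x, `|T x| <= C * `|x|.
  have /linear_boundedP[C [_ HC]] := bT.
  by exists (C + 1); apply: HC; rewrite ltrDl.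
have /choice[a Ha] z : exists a : R, T z = a *: y.
  have : range T (T z) by exists z.
  by rewrite Ty => -[a _ <-]; exists a.
have ny : 0 < `|y| by rewrite normr_gt0.
pose u := `|y|^-1 *: y; have u1 : `|u| = 1.
  by rewrite normrZ ger0_norm ?invr_ge0// mulVf ?gt_eqF.
have u0 : u != 0 by rewrite -normr_eq0 u1 oner_eq0.
pose rho z := a z * `|y|.
have rhoE z : T z = rho z *: u.
  by rewrite Ha /u scalerA -mulrA mulfV ?gt_eqF// mulr1.
have rinj (b c : R) : b *: u = c *: u -> b = c.
  move/eqP; rewrite -subr_eq0 -scalerBl scaler_eq0 (negPf u0) orbF subr_eq0.
  by move/eqP.
have rD x z : rho (x + z) = rho x + rho z.
  by apply: rinj; rewrite -rhoE scalerDl -!rhoE linearD.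
have rZ (b : R) x : rho (b *: x) = b * rho x.
  by apply: rinj; rewrite -rhoE -scalerA -rhoE linearZ.
have rN x : `|T x| = `|rho x| by rewrite rhoE normrZ u1 mulr1.
have [M HM] : exists M, op_value (fun x : V => `|x|) T M.
  apply: (@op_value_ex _ _ _ _ 0 `|C|); first by rewrite normr0 ler01.
  move=> x x1; rewrite (le_trans (HC x))// -[leRHS]mulr1.
  by rewrite (le_trans (ler_wpM2r _ (ler_norm C)))// ler_wpM2l.
have [MT ME] := HM.
have TM x : `|T x| <= M * `|x|.
  have [->|x0] := eqVneq x 0; first by rewrite linear0 normr0 mulr0.
  have nx : 0 < `|x| by rewrite normr_gt0.
  have := MT (`|x|^-1 *: x); rewrite linearZ !normrZ ger0_norm ?invr_ge0//.
  by rewrite mulVf ?gt_eqF// lexx ler_pdivrMl// mulrC => /(_ isT).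
have M0 : 0 < M.
  have [z _ Tz] : range T y by rewrite Ty; exists 1 => //; rewrite scale1r.
  have z0 : 0 < `|z|.
    by rewrite normr_gt0; apply/eqP => z0; move: y0; rewrite -Tz z0 linear0 eqxx.
  by have := lt_le_trans ny; rewrite -{1}Tz => /(_ _ (TM z)); rewrite pmulr_lgt0.
rewrite (opnorm_real HM); apply: opnorm_real; split => [x x1|].
  by rewrite (le_trans (ler_normD _ _))// lerD// MT.
apply: (daugavet_lower ioD ioZ ioN ioS io_onto Hm u1 M0 rD rZ).
- by move=> x; rewrite -rN.
- move=> x x1; rewrite rhoE -scalerBl normrZ u1 mulr1 real_normK ?num_real//.
  have r1 : `|rho x| <= M by rewrite -rN MT.
  have : `|rho x| ^+ 2 <= M ^+ 2 by rewrite lerXn2r ?nnegrE// ltW.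
  by rewrite real_normK ?num_real//; lra.
move=> e e0; have [x x1 Hx] := ME _ (mulr_gt0 M0 e0).
have Hx' : M * (1 - e) <= `|rho x| by rewrite mulrBr mulr1 -rN.
have [r0|r0] := leP 0 (rho x).
  by exists x => //; rewrite -(ger0_norm r0).
exists (- x); first by rewrite normrN.
by rewrite -[- x]scaleN1r rZ mulN1r -(ltr0_norm r0).
Qed.

(** The operator is -phi(x) u.  If the norm of x - phi(x) u is almost 2 then |phi(x)|
    is close to 1, so x or -x is almost at distance 2 from u. *)
Lemma minimal_not_daugavet_real e : minimal_projection S e -> ~ daugavet V.
Proof.
move=> He DP; have [_ _ ee e0 _] := He.
have [u [phi [ue u1 phiE phiN H]]] := minimal_space ioD ioZ ioN ioS io_onto He.
have einj (b c : R) : (b%:C)%C *: e = (c%:C)%C *: e -> b = c.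
  have en : e != 0 by apply/eqP.
  move/eqP; rewrite -subr_eq0 -scalerBl scaler_eq0 (negPf en) orbF subr_eq0.
  by move/eqP/complexI.
have phiD x y : phi (x + y) = phi x + phi y.
  apply: (@mulfI _ 2) => //; apply: einj.
  rewrite -phiE [2 * (_ + _)]mulrDr rmorphD scalerDl -!phiE -mulrDl -mulrDr.
  by rewrite ioD starD addrACA.
have phiZ (b : R) x : phi (b *: x) = b * phi x.
  apply: (@mulfI _ 2) => //; apply: einj.
  rewrite -phiE mulrCA rmorphM/= -scalerA -phiE ioZ starRZ -scalerDr.
  by rewrite -scalerAr -scalerAl.
have phiu : phi u = 1.
  apply: (@mulfI _ 2) => //; apply: einj; rewrite -phiE ue.
  have -> : star e = e by case: He.
  by rewrite mulrDr mulrDl !ee mulr1 rmorph_nat scaler_nat mulr2n.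
pose T v := - phi v *: u.
have lT : linear T.
  by move=> b x y; rewrite /T phiD phiZ opprD scalerDl scalerA mulrN.
pose TL : {linear V -> V} := HB.pack T (GRing.isLinear.Build _ _ _ _ T lT).
have TN x : `|T x| <= `|x| by rewrite /T normrZ normrN u1 mulr1.
have bT : bounded_near TL (nbhs (0 : V)).
  apply/linear_boundedP; exists 1; split => // r r1 x.
  by rewrite (le_trans (TN x))// ler_peMl// ltW.
have rT : rank_one TL.
  exists u; first by rewrite -normr_eq0 u1 oner_eq0.
  apply/seteqP; split => [_ [x _ <-]|_ [b _ <-]]; first by exists (- phi x).
  by exists ((- b) *: u) => //; rewrite /= /T phiZ phiu mulr1 opprK.
have oT : opnorm TL = 1.
  apply: opnorm_real; split => [x x1|d d0]; first by rewrite (le_trans (TN x)).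
  exists u; first by rewrite u1.
  by rewrite /= /T phiu scaleN1r normrN u1 gerBl ltW.
have := DP TL bT rT; rewrite oT => o2.
have [M HM] : exists M, op_value (fun x : V => `|x|) (fun x => x + T x) M.
  apply: (@op_value_ex _ _ _ _ 0 2); first by rewrite normr0 ler01.
  move=> x x1; rewrite (le_trans (ler_normD _ _))// (_ : 2 = 1 + 1)// lerD//.
  by rewrite (le_trans (TN x)).
have M2 : M = 2 by rewrite -(opnorm_real HM) o2.
have [x x1 Hx] : exists2 x, `|x| <= 1 & 2 - 20^-1 <= `|x + T x|.
  by rewrite -M2; apply: HM.2; rewrite invr_gt0 ltr0n.
have {x x1 Hx} [x [x1 x0 Hx]] : exists x, [/\ `|x| <= 1, 0 <= phi x &
    2 - 20^-1 <= `|x - phi x *: u|].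
  have [p0|p0] := leP 0 (phi x); first by exists x; rewrite -scaleNr.
  exists (- x); rewrite normrN; split => //.
    by rewrite -scaleN1r phiZ mulN1r oppr_ge0 ltW.
  by rewrite -[X in phi X]scaleN1r phiZ mulN1r -opprD normrN.
have px : 19 / 20 <= phi x.
  have : `|x - phi x *: u| <= `|x| + phi x.
    by rewrite (le_trans (ler_normB _ _))// normrZ u1 mulr1 ger0_norm.
  lra.
have p1 : phi x <= 1 by rewrite (le_trans (ler_norm _))// (le_trans (phiN x)).
have Hup y a : `|y| <= 1 -> `|a| <= 2^-1 -> `|u + a *: y| <= 1 + a * phi y + 5 * a ^+ 2.
  by move=> y1 a1; case/andP: (H y a y1 a1).
have := far_from_smooth_point Hup x1 px; apply/negP; rewrite -leNgt.
have : `|x - phi x *: u| <= `|x - u| + `|(1 - phi x) *: u|.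
  have -> : x - phi x *: u = x - u + (1 - phi x) *: u.
    by rewrite scalerBl scale1r addrA subrK.
  exact: ler_normD.
rewrite normrZ u1 mulr1 ger0_norm ?subr_ge0//; lra.
Qed.

End RealDaugavet.

(** * Complex algebras *)

Section ComplexDaugavet.
Variables (R : realType) (A : cstarAlgType R).
Local Notation U := (unitization A).
Local Notation VR := (realification A).

Definition whole_algebra : realCstarAlg A :=
  @RealCstarAlg R A setT I (fun _ _ _ _ => I) (fun _ _ _ => I)
    (fun _ _ _ _ => I) (fun _ _ => I) closedT.

Definition embR (x : VR) : U := emb (x : A).

Lemma normRE (x : VR) : `|x| = rnorm (x : A).
Proof. by []. Qed.

Lemma embRD (x y : VR) : embR (x + y) = embR x + embR y.
Proof. exact: embD. Qed.

Lemma embRZ (a : R) (x : VR) : embR (a *: x) = (a%:C)%C *: embR x.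
Proof. exact: embZ. Qed.

Lemma embRN (x : VR) : unorm (embR x) = `|x|.
Proof. exact: unorm_emb. Qed.

Lemma embR_in (x : VR) : inS whole_algebra (embR x).
Proof. by []. Qed.

Lemma embR_onto (u : U) : inS whole_algebra u -> exists x, embR x = u.
Proof. by case: u => a x [/= -> _]; exists x. Qed.

(** The real functional is the real part of the coefficient of T; points where T is
    almost maximal are rotated so that this coefficient is positive. *)
Lemma no_minimal_daugavet_complex : no_minimal whole_algebra -> daugavet A.
Proof.
move=> Hm T bT [y y0 Ty].
have [C HC] : exists C : R, forall x, rnorm (T x) <= C * rnorm x.
  have /linear_boundedP[C [Cr HC]] := bT.
  exists (complex.Re (`|C| + 1)) => x; rewrite -lecR rmorphM/= !rnormE.
  have rC : `|C| + 1 \is Num.real by rewrite rpredD ?normr_real ?rpred1.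
  rewrite (RRe_real rC); apply: HC.
  by rewrite (le_lt_trans (real_ler_norm Cr))// ltrDl.
have /choice[a Ha] z : exists a : R[i], T z = a *: y.
  have : range T (T z) by exists z.
  by rewrite Ty => -[a _ <-]; exists a.
have ny : 0 < rnorm y by rewrite -ltcR rnormE normr_gt0.
pose u := ((rnorm y)^-1%:C)%C *: y.
have u1 : rnorm u = 1.
  by rewrite rnormZ normc_real ger0_norm ?invr_ge0 ?(ltW ny)// mulVf ?gt_eqF.
have u0 : u != 0.
  by apply/eqP => u0; move: u1; rewrite u0 rnorm0 => /esym/eqP; rewrite oner_eq0.
pose rc z := a z * ((rnorm y)%:C)%C.
have rcE z : T z = rc z *: u.
  rewrite Ha /u scalerA -mulrA -(rmorphM (real_complex R)) mulfV ?gt_eqF//.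
  by rewrite rmorph1 mulr1.
have rinj (b c : R[i]) : b *: u = c *: u -> b = c.
  move/eqP; rewrite -subr_eq0 -scalerBl scaler_eq0 (negPf u0) orbF subr_eq0.
  by move/eqP.
have rcD x z : rc (x + z) = rc x + rc z.
  by apply: rinj; rewrite -rcE scalerDl -!rcE linearD.
have rcZ (b : R[i]) x : rc (b *: x) = b * rc x.
  by apply: rinj; rewrite -rcE -scalerA -rcE linearZ.
have rcN x : rnorm (T x) = normc (rc x) by rewrite rcE rnormZ u1 mulr1.
pose rho (z : VR) : R := complex.Re (rc z).
have [M HM] : exists M, op_value (@rnorm R A) T M.
  apply: (@op_value_ex _ _ _ _ 0 `|C|); first by rewrite rnorm0 ler01.
  move=> x x1; rewrite (le_trans (HC x))// -[leRHS]mulr1.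
  by rewrite (le_trans (ler_wpM2r (rnorm_ge0 x) (ler_norm C)))// ler_wpM2l.
have [MT ME] := HM.
have TM x : rnorm (T x) <= M * rnorm x.
  have [->|x0] := eqVneq x 0; first by rewrite linear0 rnorm0 mulr0.
  have nx : 0 < rnorm x by rewrite -ltcR rnormE normr_gt0.
  have := MT (((rnorm x)^-1%:C)%C *: x); rewrite linearZ !rnormZ normc_real.
  rewrite ger0_norm ?invr_ge0 ?(ltW nx)//.
  by rewrite mulVf ?gt_eqF// lexx ler_pdivrMl// mulrC => /(_ isT).
have M0 : 0 < M.
  have [z _ Tz] : range T y by rewrite Ty; exists 1 => //; rewrite scale1r.
  have z0 : 0 < rnorm z.
    rewrite -ltcR rnormE normr_gt0; apply/eqP => z0.
    by move: y0; rewrite -Tz z0 linear0 eqxx.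
  by have := lt_le_trans ny; rewrite -{1}Tz => /(_ _ (TM z)); rewrite pmulr_lgt0.
rewrite (opnorm_complex HM) -(rmorph1 (real_complex R)) -(rmorphD (real_complex R)).
apply: opnorm_complex; split => [x x1|].
  by rewrite (le_trans (rnormD _ _))// lerD// MT.
have Re_le (b : R[i]) : `|complex.Re b| <= normc b.
  by rewrite -lecR -normc_val normc_ge_Re.
have sq_normc (b : R[i]) : normc b ^+ 2 = complex.Re b ^+ 2 + complex.Im b ^+ 2.
  by case: b => b c; rewrite /= sqr_sqrtr// addr_ge0 ?sqr_ge0.
apply: (@daugavet_lower _ _ _ VR _ embRD embRZ embRN embR_in embR_onto T u rho M) => //.
- by move=> x z; rewrite /rho rcD; case: (rc x) (rc z) => ? ? [].
- move=> b x; rewrite /rho -[b *: x]/((b%:C)%C *: (x : A)) rcZ.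
  by case: (rc x) => c d; rewrite /= mul0r subr0.
- by move=> x; rewrite (le_trans (Re_le _))// -rcN TM.
- move=> x x1.
  have -> : `|(T x : VR) - M *: (u : VR)| = normc (rc x - (M%:C)%C).
    rewrite normRE (_ : _ - _ = (rc x - (M%:C)%C) *: u :> A).
      by rewrite rnormZ u1 mulr1.
    by rewrite scalerBl -rcE.
  have : normc (rc x) ^+ 2 <= M ^+ 2.
    have rM : normc (rc x) <= M by rewrite -rcN MT.
    by rewrite lerXn2r ?nnegrE ?(ltW M0)// -rcN rnorm_ge0.
  rewrite !sq_normc /rho; case: (rc x) => b c /=; rewrite subr0; lra.
move=> e e0; have [x x1 Hx] := ME _ (mulr_gt0 M0 e0).
have Hx' : M * (1 - e) <= normc (rc x) by rewrite mulrBr mulr1 -rcN.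
have [r0|r0] := eqVneq (rc x) 0.
  by exists x => //; rewrite /rho r0; move: Hx'; rewrite r0 normc0.
have n0 : normc (rc x) != 0 by apply: contra_neq r0; exact: eq0_normc.
have np : 0 < normc (rc x) by rewrite -ltcR -normc_val normr_gt0.
pose w := (((normc (rc x))%:C)%C / rc x).
have w1 : normc w = 1.
  by rewrite /w normcM normcV normc_real gtr0_norm// mulfV.
exists (w *: x : A); first by rewrite normRE rnormZ w1 mul1r.
by rewrite /rho rcZ /w divfK.
Qed.

(** The operator - e x e is complex-linear of rank one, since the compression of a
    self-adjoint element, hence of any element, is a multiple of e. *)
Lemma minimal_not_daugavet_complex e : minimal_projection whole_algebra e ->
  ~ daugavet A.
Proof.
move=> He DP; have [[e1 _] es ee e0 em] := He.
have eN := minimal_norm He.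
pose p : A := e.2; have pE : emb p = e by rewrite [RHS]surjective_pairing e1.
have pN : rnorm p = 1 by rewrite -unorm_emb pE.
have [im [im2 imJ]] : exists im : R[i], im * im = -1 /\ im^* = - im.
  by exists 'i%C; rewrite -expr2 sqr_i; split => //; simpc.
have [hf hf2] : exists hf : R[i], hf + hf = 1.
  by exists 2^-1; have := splitr (1 : R[i]); rewrite !mul1r.
have coef (x : U) : inS whole_algebra x -> exists c : R[i], e * x * e = c *: e.
  move=> xS; pose v := im *: (star x - x).
  have sv : star v = v.
    by rewrite /v starZ starB starK imJ scaleNr -scalerN opprB.
  have vS : inS whole_algebra v.
    by split => //; apply: fst0Z; apply: fst0B; [apply: fst0_star|]; case: xS.
  have wS : inS whole_algebra (x + star x) by apply: inSD => //; exact: inS_star.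
  have [|r Hr] := em (x + star x) wS; first by rewrite starD starK addrC.
  have [s Hs] := em v vS sv.
  have xE : x = hf *: ((x + star x) + im *: v).
    rewrite /v scalerA im2 scaleN1r opprB addrACA subrr addr0 scalerDr -scalerDl.
    by rewrite hf2 scale1r.
  exists (hf * ((r%:C)%C + im * (s%:C)%C)).
  rewrite [in LHS]xE -scalerAr -scalerAl mulrDr mulrDl Hr -scalerAr -scalerAl Hs.
  by rewrite !scalerA -scalerDl scalerA.
have en0 : e != 0 by apply/eqP.
pose T (x : A) : A := - cmul (cmul p x) p.
have embT x : emb (T x) = - (e * emb x * e) by rewrite /T embN !embM pE.
have lT : linear T.
  move=> b x y; rewrite /T cmulDr cmulZr cmulDl cmulZl opprD scalerN.
  by [].
pose TL : {linear A -> A} := HB.pack T (GRing.isLinear.Build _ _ _ _ T lT).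
have TN x : rnorm (T x) <= rnorm x.
  rewrite /T rnormN (le_trans (rnormM _ _))// pN mulr1.
  by rewrite (le_trans (rnormM _ _))// pN mul1r.
have Tp : T p = - p.
  rewrite /T; congr (- _).
  have : emb (cmul (cmul p p) p) = emb p by rewrite !embM pE !ee.
  by case.
have Tc x : exists c : R[i], T x = c *: p /\ e * emb x * e = - c *: e.
  have [c Hc] := coef (emb x) (conj erefl I).
  exists (- c); rewrite opprK; split => //.
  have : emb (T x) = emb (- c *: p) by rewrite embT Hc embZ pE scaleNr.
  by case.
have bT : bounded_near TL (nbhs (0 : A)).
  apply/linear_boundedP; exists 1; split => // r r1 x.
  have r0 : 0 <= r by rewrite (le_trans ler01)// ltW.
  rewrite (@le_trans _ _ `|x|)//; first by rewrite -!rnormE lecR TN.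
  by rewrite ler_peMl// ltW.
have rT : rank_one TL.
  exists p; first by rewrite -normr_eq0 -rnormE pN rmorph1 oner_eq0.
  apply/seteqP; split => [_ [x _ <-]|_ [b _ <-]].
    by have [c [Hc _]] := Tc x; exists c.
  exists ((- b) *: p) => //=.
  rewrite /T cmulZr cmulZl -scalerN -[- cmul _ _]/(T p) Tp scalerN scaleNr opprK.
  by [].
have oT : opnorm TL = ((1 : R)%:C)%C.
  apply: opnorm_complex; split => [x x1|d d0]; first by rewrite (le_trans (TN x)).
  exists p; first by rewrite pN.
  by rewrite /= Tp rnormN pN gerBl ltW.
have := DP TL bT rT; rewrite oT => o2.
have [M HM] : exists M, op_value (@rnorm R A) (fun x => x + T x) M.
  apply: (@op_value_ex _ _ _ _ 0 2); first by rewrite rnorm0 ler01.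
  move=> x x1; rewrite (le_trans (rnormD _ _))// (_ : 2 = 1 + 1)// lerD//.
  by rewrite (le_trans (TN x)).
have M2 : M = 2.
  apply: (fmorph_inj (real_complex R)); rewrite /= -(opnorm_complex HM) o2.
  by rewrite -(rmorph1 (real_complex R)) -(rmorphD (real_complex R)).
have [x x1 Hx] : exists2 x, rnorm x <= 1 & 2 - 20^-1 <= rnorm (x + T x).
  by rewrite -M2; apply: HM.2; rewrite invr_gt0 ltr0n.
have [c [Hc xc]] := Tc x.
have cn : 19 / 20 <= normc c.
  have : rnorm (x + T x) <= rnorm x + normc c.
    by rewrite (le_trans (rnormD _ _))// Hc rnormZ pN mulr1.
  lra.
have c0 : c != 0 by apply/eqP => c0; move: cn; rewrite c0 normc0; lra.
have cn1 : normc c <= 1.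
  by have := TN x; rewrite Hc rnormZ pN mulr1 => /le_trans; apply.
have nc0 : 0 < normc c by apply: lt_le_trans cn; rewrite divr_gt0.
(* rotate x so that its compression is a positive multiple of the projection *)
have [w [w1 wc]] : exists w : R[i], normc w = 1 /\ w * c = - ((normc c)%:C)%C.
  exists (- (((normc c)%:C)%C / c)); rewrite mulNr divfK//; split => //.
  by rewrite normcN normcM normcV normc_real gtr0_norm// mulfV// gt_eqF.
pose z : A := w *: x.
have z1 : rnorm z <= 1 by rewrite rnormZ w1 mul1r.
have ze : e * emb z * e = ((normc c)%:C)%C *: e.
  rewrite /z embZ -scalerAr -scalerAl xc scalerA; congr (_ *: _).
  by rewrite mulrN wc opprK.
have [u [phi [ue u1 phiE phiN H]]] :=
  minimal_space embRD embRZ embRN embR_in embR_onto He.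
have up : (u : A) = p by move: ue; rewrite -pE => -[].
have phiz : phi z = normc c.
  have zs : e * star (emb z) * e = ((normc c)%:C)%C *: e.
    have <- : star (e * emb z * e) = e * star (emb z) * e by rewrite !starM es mulrA.
    by rewrite ze starRZ es.
  have := phiE z; rewrite -/(emb z) mulrDr mulrDl ze zs -scalerDl.
  rewrite -(rmorphD (real_complex R)) => /eqP; rewrite -subr_eq0 -scalerBl.
  rewrite scaler_eq0 (negPf en0) orbF subr_eq0 => /eqP/complexI; lra.
have Hup (y : VR) a : `|y| <= 1 -> `|a| <= 2^-1 ->
    `|u + a *: y| <= 1 + a * phi y + 5 * a ^+ 2.
  by move=> y1 a1; case/andP: (H y a y1 a1).
have zp : 19 / 20 <= phi z by rewrite phiz.
have : rnorm (z - p) < 19 / 10.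
  by have := far_from_smooth_point Hup z1 zp; rewrite normRE -up.
have : rnorm (x + T x) <= rnorm (z - p) + (1 - normc c).
  have -> : rnorm (x + T x) = rnorm (z - ((normc c)%:C)%C *: p).
    have -> : z - ((normc c)%:C)%C *: p = w *: (x + T x).
      by rewrite scalerDr Hc scalerA wc scaleNr.
    by rewrite rnormZ w1 mul1r.
  have -> : z - ((normc c)%:C)%C *: p = (z - p) + ((1 - normc c)%:C)%C *: p.
    by rewrite rmorphB rmorph1 scalerBl scale1r addrA subrK.
  by rewrite (le_trans (rnormD _ _))// rnormZ pN mulr1 normc_real ger0_norm ?subr_ge0.
lra.
Qed.

End ComplexDaugavet.

(** * Real algebras and the equivalence *)

Section RealCase.
Variables (R : realType) (A : cstarAlgType R) (S : realCstarAlg A).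
Local Notation V := (rcs_space S).

Definition embS (x : V) : unitization A := embR (val x).

Lemma embSD (x y : V) : embS (x + y) = embS x + embS y.
Proof. by rewrite /embS raddfD embRD. Qed.

Lemma embSZ (a : R) (x : V) : embS (a *: x) = (a%:C)%C *: embS x.
Proof. by rewrite /embS linearZ embRZ. Qed.

Lemma embSN (x : V) : unorm (embS x) = `|x|.
Proof. exact: embRN. Qed.

Lemma embS_in (x : V) : inS S (embS x).
Proof. by split => //; have := valP x; rewrite unfold_in /= inE. Qed.

Lemma embS_onto (u : unitization A) : inS S u -> exists x, embS x = u.
Proof.
case: u => a x [/= -> xS]; have xP : (x : realification A) \in rcs_pred S.
  by rewrite unfold_in /= inE.
by exists (exist _ x xP).
Qed.

End RealCase.

Theorem corollary4p1 (R : realType) :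
  (forall A : cstarAlgType R,
     (daugavet A <-> extremely_rough (realification A)) /\
     (extremely_rough (realification A) <->
        nowhere_frechet_smooth (realification A))) /\
  (forall (A : cstarAlgType R) (S : realCstarAlg A),
     (daugavet (rcs_space S) <-> extremely_rough (rcs_space S)) /\
     (extremely_rough (rcs_space S) <-> nowhere_frechet_smooth (rcs_space S))).
Proof.
have iff3 (P D E F : Prop) : (P <-> D) -> (P <-> E) -> (P <-> F) ->
    (D <-> E) /\ (E <-> F) by tauto.
split=> [A|A S].
  have cD := @embRD R A; have cZ := @embRZ R A; have cN := @embRN R A.
  have cI := @embR_in R A; have cO := @embR_onto R A.
  apply: (iff3 (no_minimal (whole_algebra A))); split => H.
  - exact: no_minimal_daugavet_complex.
  - by move=> e /minimal_not_daugavet_complex; apply.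
  - exact: (no_minimal_rough cD cZ cN cI cO).
  - by move=> e /(minimal_not_rough cD cZ cN cI cO); apply.
  - exact: (no_minimal_nowhere_smooth cD cZ cN cI cO).
  - by move=> e /(minimal_not_nowhere_smooth cD cZ cN cI cO); apply.
have cD := @embSD R A S; have cZ := @embSZ R A S; have cN := @embSN R A S.
have cI := @embS_in R A S; have cO := @embS_onto R A S.
apply: (iff3 (no_minimal S)); split => H.
- exact: (no_minimal_daugavet_real cD cZ cN cI cO).
- by move=> e /(minimal_not_daugavet_real cD cZ cN cI cO); apply.
- exact: (no_minimal_rough cD cZ cN cI cO).
- by move=> e /(minimal_not_rough cD cZ cN cI cO); apply.
- exact: (no_minimal_nowhere_smooth cD cZ cN cI cO).
- by move=> e /(minimal_not_nowhere_smooth cD cZ cN cI cO); apply.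
Qed.
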